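(* Let $K\in\mathbb N$, and consider $\mathcal R$-graphs $G_{\mathcal R}=G_{\mathcal R}(\{\mathfrak p_l:0\le l\le K\},\mathcal E^-\cup\mathcal E^+)$ (with $K+1$ distinct vertices) such that (i) $\mathcal E^-(\mathfrak p_l,\mathfrak p_0)\neq\emptyset$ and $\mathcal E^-(\mathfrak p_{l-1},\mathfrak p_l)\ne\emptyset$ for $0<l\le K$; (ii) $\mathcal E^-=\bigcup_{0<l\le K}\bigl(\mathcal E^-(\mathfrak p_l,\mathfrak p_0)\cup\mathcal E^-(\mathfrak p_{l-1},\mathfrak p_l)\bigr)$; (iii) $\mathfrak p_l\in\mathfrak P^{(1)}_{\mathcal R}$ for $0<l\le K$; (iv) in the case $K=1$, also $\mathfrak p_0\in\mathfrak P^{(1)}\setminus\mathfrak P^{(1)}_{\mathcal R}$. Say that $G_{\mathcal R}$ satisfies Condition (D) if for all $l$ with $0<l\le K$ $$\gcd\Bigl(\operatorname{card}(\mathcal E^-(\mathfrak p_{l-1},\mathfrak p_l))\operatorname{card}(\mathcal E^+(\mathfrak p_{l-1},\mathfrak p_l)),\ \sum_{(\widehat e^-,\widehat e^+)\in\widehat{\mathcal R}_l}\operatorname{card}(\widehat e^-)\operatorname{card}(\widehat e^+)\Bigr)=1$$ and $$\gcd\{\operatorname{card}(\widehat e^-):\widehat e^-\in[\mathcal E^-(\mathfrak p_l,\mathfrak p_0)]_{\sim(\mathcal R,-)}\}=\gcd\{\operatorname{card}(\widehat e^+):\widehat e^+\in[\mathcal E^+(\mathfrak p_l,\mathfrak p_0)]_{\sim(\mathcal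 R,+)}\}=1 .$$ Then, for $\mathcal R$-graphs satisfying (i)–(iv): Condition (D) is an invariant of topological conjugacy of the $\mathcal R$-graph shift $X(G_{\mathcal R})$ (if two such $\mathcal R$-graphs have topologically conjugate $\mathcal R$-graph shifts, then one satisfies (D) iff the other does); and if $G_{\mathcal R}$ satisfies Condition (D), then the topological conjugacy class of $X(G_{\mathcal R})$ determines the isomorphism class of the $\mathcal R$-graph $G_{\mathcal R}$ (if two such $\mathcal R$-graphs satisfy (D) and have topologically conjugate $\mathcal R$-graph shifts, then they are isomorphic as $\mathcal R$-graphs).
   Context: **$\mathcal R$-graphs.** $s$ and $t$ denote source and target of an edge. An $\mathcal R$-graph $G_{\mathcal R}(\mathfrak P,\mathcal E^-\cup\mathcal E^+)$ is a finite directed graph with vertex set $\mathfrak P$ and edge set partitioned into $\mathcal E^-$ and $\mathcal E^+$, together with relations $\mathcal R(\mathfrak q,\mathfrak r)\subset\mathcal E^-(\mathfrak q,\mathfrak r)\times\mathcal E^+(\mathfrak q,\mathfrak r)$ $(\mathfrak q,\mathfrak r\in\mathfrak P)$, where $\mathcal E^-(\mathfrak q,\mathfrak r)=\{e\in\mathcal E^-: s(e)=\mathfrak q,\ t(e)=\mathfrak r\}$ and $\mathcal E^+(\mathfrak q,\mathfrak r)=\{e\in\mathcal E^+: s(e)=\mathfrak r,\ t(e)=\mathfrak q\}$. It is assumed that $\mathcal E^-(\mathfrak q,\mathfrak r)\ne\emptyset$ iff $\mathcal E^+(\mathfrak q,\mathfrak r)\neq\emptyset$, that $(\mathfrak P,\mathcal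 E^-)$ is strongly connected (equivalently $(\mathfrak P,\mathcal E^+)$ is), and that the relations are complete: every element of $\mathcal E^-(\mathfrak q,\mathfrak r)$ is related to at least one element of $\mathcal E^+(\mathfrak q,\mathfrak r)$ and vice versa. Set $\mathcal R=\bigcup_{\mathfrak q,\mathfrak r}\mathcal R(\mathfrak q,\mathfrak r)$. An isomorphism of $\mathcal R$-graphs consists of bijections of the vertex sets, of the sets $\mathcal E^-$ and of the sets $\mathcal E^+$, respecting sources and targets and carrying one relation $\mathcal R$ onto the other. $\mathfrak P^{(1)}$ is the set of $\mathfrak p\in\mathfrak P$ for which there is exactly one $\mathfrak q\in\mathfrak P$ (possibly $\mathfrak q=\mathfrak p$) with $\mathcal E^-(\mathfrak q,\mathfrak p)\neq\emptyset$; this $\mathfrak q$ is denoted $\eta(\mathfrak p)$. $\mathfrak P^{(1)}_{\mathcal R}=\{\mathfrak p\in\mathfrak P^{(1)}:\mathcal R(\eta(\mathfrak p),\mathfrak p)=\mathcal E^-(\eta(\mathfrak p),\mathfrak p)\times\mathcal E^+(\eta(\mathfrak p),\mathfrak p)\}$. **Semigroup and shift.** $\mathcal S(G_{\mathcal R})$ is the semigroup with zero generated by $\mathcal E^-\cup\mathcal E^+$ and idempotents $\mathbf 1_{\mathfrak p}$, $\mathfrak p\in\mathfrak P$, with defining relations $\mathbf 1_{\mathfrak p}^2=\mathbf 1_{\mathfrak p}$; $\mathbf 1_{\mathfrak q}\mathbf 1_{\mathfrak r}=0$ for $\mathfrak q\ne\mathfrak r$; $\mathbf 1_{s(e)}e=e\mathbf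 1_{t(e)}=e$ for all edges $e$; and, for $f^-\in\mathcal E^-$, $g^+\in\mathcal E^+$: $f^-g^+=\mathbf 1_{\mathfrak q}$ if $(f^-,g^+)\in\mathcal R(\mathfrak q,\mathfrak r)$ for some $\mathfrak q,\mathfrak r$, and $f^-g^+=0$ if $(f^-,g^+)\notin\mathcal R$. The $\mathcal R$-graph shift $X(G_{\mathcal R})\subset(\mathcal E^-\cup\mathcal E^+)^{\mathbb Z}$ is the subshift whose admissible words are the finite words $\sigma_1\cdots\sigma_I$ with $\prod_{1\le i\le I}\sigma_i\ne0$ in $\mathcal S(G_{\mathcal R})$. **Classes.** Two elements of $\mathcal E^-(\mathfrak q,\mathfrak r)$ are $\sim(\mathcal R,-)$-equivalent if they are related by $\mathcal R(\mathfrak q,\mathfrak r)$ to the same elements of $\mathcal E^+(\mathfrak q,\mathfrak r)$; $\sim(\mathcal R,+)$ on $\mathcal E^+(\mathfrak q,\mathfrak r)$ is defined symmetrically. $[\,\cdot\,]_{\sim}$ denotes the set of equivalence classes, and $\operatorname{card}(\widehat e^{\mp})$ is the number of elements of the class $\widehat e^{\mp}$. For $0<l\le K$, $\widehat{\mathcal R}_l=\{(\widehat e^-,\widehat e^+)\in[\mathcal E^-(\mathfrak p_l,\mathfrak p_0)]_{\sim(\mathcal R,-)}\times[\mathcal E^+(\mathfrak p_l,\mathfrak p_0)]_{\sim(\mathcal R,+)}:\widehat e^-\times\widehat e^+\subset\mathcal R(\mathfrak p_l,\mathfrak p_0)\}$. *)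

(* Defs.v *)
From HB Require Import structures.
From mathcomp Require Import all_boot all_order all_algebra.

Set Implicit Arguments.
Unset Strict Implicit.
Unset Printing Implicit Defensive.

Record rgraph_data := MkRgraphData {
  vertex : finType;
  nedge : finType;  (* the edges in E^- *)
  pedge : finType;  (* the edges in E^+ *)
  nsrc : nedge -> vertex;
  ntgt : nedge -> vertex;
  psrc : pedge -> vertex;
  ptgt : pedge -> vertex;
  related : nedge -> pedge -> bool  (* the union of all the R(q, r) *)
}.

(** Beware of the reversed direction in [Epos]. *)
Definition Eneg (G : rgraph_data) (q r : vertex G) : {set nedge G} :=
  [set e | (nsrc e == q) && (ntgt e == r)].

Definition Epos (G : rgraph_data) (q r : vertex G) : {set pedge G} :=
  [set e | (psrc e == r) && (ptgt e == q)].

(** The sets [Eneg q r] are pairwise disjoint, and so are the sets [Epos q r];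
    hence R(q, r) is recovered from the union of the relations. *)
Definition Rel (G : rgraph_data) (q r : vertex G) :
    {set nedge G * pedge G} :=
  [set x in setX (Eneg q r) (Epos q r) | related x.1 x.2].

Record Rgraph := MkRgraph {
  rgraph_base :> rgraph_data;
  related_Rel : forall (e : nedge rgraph_base) (f : pedge rgraph_base),
    related e f -> exists q r, (e, f) \in Rel q r;
  Eneg_Epos_neq0 : forall q r : vertex rgraph_base,
    (Eneg q r != set0) <-> (Epos q r != set0);
  Eneg_strongly_connected : forall q r : vertex rgraph_base,
    connect (fun u v => Eneg u v != set0) q r;
  Rel_complete_neg : forall (q r : vertex rgraph_base),
    {in Eneg q r, forall e, exists f, (e, f) \in Rel q r};
  Rel_complete_pos : forall (q r : vertex rgraph_base),
    {in Epos q r, forall f, exists e, (e, f) \in Rel q r}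
}.

Definition rgraph_iso (G H : Rgraph) : Prop :=
  exists (fv : vertex G -> vertex H) (fn : nedge G -> nedge H)
         (fp : pedge G -> pedge H),
    [/\ bijective fv, bijective fn & bijective fp] /\
    [/\ forall e, nsrc (fn e) = fv (nsrc e),
        forall e, ntgt (fn e) = fv (ntgt e),
        forall e, psrc (fp e) = fv (psrc e),
        forall e, ptgt (fp e) = fv (ptgt e) &
        forall e f, related (fn e) (fp f) = related e f].

Definition predecessors (G : Rgraph) (p : vertex G) : {set vertex G} :=
  [set q | Eneg q p != set0].

Definition P1 (G : Rgraph) : {set vertex G} :=
  [set p | #|predecessors p| == 1].

(** Only meaningful for [p \in P1 G], where the choice is unique. *)
Definition eta (G : Rgraph) (p : vertex G) : vertex G :=
  odflt p [pick q in predecessors p].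

Definition P1R (G : Rgraph) : {set vertex G} :=
  [set p in P1 G | Rel (eta p) p == setX (Eneg (eta p) p) (Epos (eta p) p)].

Definition nequiv (G : Rgraph) (q r : vertex G) (e e' : nedge G) : bool :=
  [forall f in Epos q r, ((e, f) \in Rel q r) == ((e', f) \in Rel q r)].

Definition pequiv (G : Rgraph) (q r : vertex G) (f f' : pedge G) : bool :=
  [forall e in Eneg q r, ((e, f) \in Rel q r) == ((e, f') \in Rel q r)].

Definition nclasses (G : Rgraph) (q r : vertex G) : {set {set nedge G}} :=
  equivalence_partition (nequiv q r) (Eneg q r).

Definition pclasses (G : Rgraph) (q r : vertex G) : {set {set pedge G}} :=
  equivalence_partition (pequiv q r) (Epos q r).

Definition Rhat (G : Rgraph) (q r : vertex G) :
    {set {set nedge G} * {set pedge G}} :=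
  [set x in setX (nclasses q r) (pclasses q r)
     | setX x.1 x.2 \subset Rel q r].

(** The standing conditions on an R-graph with vertices
    p_0, ..., p_K; [p (inord l.-1)] is p_(l-1). *)
Definition family_conditions (K : nat) (G : Rgraph) (p : 'I_K.+1 -> vertex G) :
    Prop :=
  [/\ bijective p,
      forall l : 'I_K.+1, 0 < l ->
        Eneg (p l) (p ord0) != set0 /\ Eneg (p (inord l.-1)) (p l) != set0,
      forall e : nedge G, exists2 l : 'I_K.+1, 0 < l &
        (e \in Eneg (p l) (p ord0)) \/ (e \in Eneg (p (inord l.-1)) (p l)),
      forall l : 'I_K.+1, 0 < l -> p l \in P1R G &
      K = 1 -> p ord0 \in P1 G :\: P1R G].

(** [0] is neutral for [gcdn], so the big operator is the gcd of a set. *)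
Definition condition_D (K : nat) (G : Rgraph) (p : 'I_K.+1 -> vertex G) :
    Prop :=
  forall l : 'I_K.+1, 0 < l ->
    [/\ gcdn (#|Eneg (p (inord l.-1)) (p l)| * #|Epos (p (inord l.-1)) (p l)|)
             (\sum_(x in Rhat (p l) (p ord0)) #|x.1| * #|x.2|) = 1,
        \big[gcdn/0]_(c in nclasses (p l) (p ord0)) #|c| = 1 &
        \big[gcdn/0]_(c in pclasses (p l) (p ord0)) #|c| = 1].

Definition edge (G : Rgraph) : Type := (nedge G + pedge G)%type.

Definition esrc (G : Rgraph) (e : edge G) : vertex G :=
  match e with inl e => nsrc e | inr e => psrc e end.

Definition etgt (G : Rgraph) (e : edge G) : vertex G :=
  match e with inl e => ntgt e | inr e => ptgt e end.

Inductive sgen (G : Rgraph) : Type :=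
  | Unit of vertex G
  | Edge of edge G.

(** Words in the generators, with [None] for the zero. The empty word occurs in
    no defining relation: allowing it merely adjoins an identity element. *)
Definition sword (G : Rgraph) : Type := option (seq (sgen G)).

Definition smul (G : Rgraph) (a b : sword G) : sword G :=
  match a, b with Some u, Some v => Some (u ++ v) | _, _ => None end.

Inductive defining_relation (G : Rgraph) : sword G -> sword G -> Prop :=
  | unit_idem q :
      defining_relation (Some [:: Unit q; Unit q]) (Some [:: Unit q])
  | unit_orth q r : q <> r ->
      defining_relation (Some [:: Unit q; Unit r]) None
  | unit_src e :
      defining_relation (Some [:: Unit (esrc e); Edge e]) (Some [:: Edge e])
  | unit_tgt e :
      defining_relation (Some [:: Edge e; Unit (etgt e)]) (Some [:: Edge e])
  | mul_related (f : nedge G) (g : pedge G) q r : (f, g) \in Rel q r ->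
      defining_relation (Some [:: Edge (inl f); Edge (inr g)])
                        (Some [:: Unit q])
  | mul_unrelated (f : nedge G) (g : pedge G) : ~~ related f g ->
      defining_relation (Some [:: Edge (inl f); Edge (inr g)]) None.

(** The congruence generated by the defining relations, i.e. equality in the
    semigroup S(G). *)
Inductive sg_eq (G : Rgraph) : sword G -> sword G -> Prop :=
  | sg_rel a b : defining_relation a b -> sg_eq a b
  | sg_refl a : sg_eq a a
  | sg_sym a b : sg_eq a b -> sg_eq b a
  | sg_trans a b c : sg_eq a b -> sg_eq b c -> sg_eq a c
  | sg_mul a a' b b' :
      sg_eq a a' -> sg_eq b b' -> sg_eq (smul a b) (smul a' b').

Definition admissible (G : Rgraph) (w : seq (edge G)) : Prop :=
  ~ sg_eq (Some (map (@Edge G) w)) None.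

From mathcomp Require Import boolp classical_sets topology.
Import GRing.Theory.
Local Open Scope classical_set_scope.
Local Open Scope ring_scope.

Notation full_shift G :=
  {ptws int -> discrete_topology (nedge G + pedge G)%type}.

Definition block (A : Type) (x : int -> A) (i : int) (n : nat) : seq A :=
  [seq x (i + k%:Z) | k <- iota 0 n].

Definition rgraph_shift (G : Rgraph) : set (full_shift G) :=
  [set x | forall (i : int) (n : nat), admissible (block (x : int -> edge G) i n.+1)].
Arguments rgraph_shift : clear implicits.

Definition shift_seq (A : Type) (x : int -> A) : int -> A := fun i => x (i + 1).

Lemma rgraph_shift_invariant (G : Rgraph) (x : full_shift G) :
  rgraph_shift G x -> rgraph_shift G (shift_seq x : full_shift G).
Proof.
move=> Xx i n; suff -> : block (shift_seq x) i n.+1 = block x (i + 1) n.+1.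
  exact: Xx.
by apply: eq_map => k; rewrite /shift_seq addrAC.
Qed.

(** [set_type (rgraph_shift G)] carries the topology induced by the product
    topology of [full_shift G]. *)
Definition shift_map (G : Rgraph) (x : set_type (rgraph_shift G)) :
    set_type (rgraph_shift G) :=
  SigSub (mem_set (rgraph_shift_invariant (set_valP x))).

Definition topologically_conjugate (G H : Rgraph) : Prop :=
  exists (phi : set_type (rgraph_shift G) -> set_type (rgraph_shift H))
         (psi : set_type (rgraph_shift H) -> set_type (rgraph_shift G)),
    [/\ cancel phi psi, cancel psi phi, continuous phi, continuous psi &
        forall x, phi (shift_map x) = shift_map (phi x)].

(* Main.v *)
(** Contract the edges between p_(l-1) and p_l: since p_l lies in P^(1)_R these
    carry no information, and a path is admissible iff the word of the classes
    (for ~(R,-) and ~(R,+)) of its remaining edges is nonzero in the monoid with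
    zero generated by the classes i of negative and j of positive edges, where
    ij = 1 if the two classes are related and ij = 0 otherwise.

    A periodic point is neutral iff some pair of points homoclinic to it cannot
    be glued along any long power of it, so a conjugacy maps neutral periodic
    points to neutral ones. Fix a neutral base point q. The points homoclinic to
    q, up to equality of contexts, form the above monoid, whose elements are
    determined by their contexts; hence the conjugacy induces an isomorphism of
    monoids, that is, bijections of the classes preserving the relation. Shadowing
    a periodic point by points homoclinic to q shows that the number of periodic
    points of period m with multiplier a given class is preserved too.

    For a class i of edges from p_l to p_0 this number is m card(i) times the
    number of paths of length m - 1 from p_0 to p_l of value 1. Put
    d_l = card E^-(p_(l-1),p_l) card E^+(p_(l-1),p_l) and S_l = card R(p_l,p_0).
    The lengths l, l + 2 and, for l = 1, l + 4 show that the conjugacy preserves l,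
    card(i) prod_(k <= l) card E^-(p_(k-1),p_k), the sums of the d_(k+1) + S_k over
    k <= l, and d_1 S_1 + d_2 (d_3 + S_2). If (D) holds on one side then, for the
    other side, the gcds of the cardinalities of classes are forced to be 1 for
    l = K, K - 1, ..., 1 in turn, and all these numbers agree. *)

Require Import Defs.
From mathcomp Require Import all_boot all_order all_algebra zify.
From mathcomp Require Import boolp classical_sets functions cardinality filter topology.

Set Implicit Arguments.
Unset Strict Implicit.
Unset Printing Implicit Defensive.

(** * The monoid of classes *)

(** A conjugacy sees neither vertices nor signs of edges. Neutrality of the base point turns what it
    sees into algebra: powers of a neutral period change no value, so concatenating excursions from
    the base point multiplies their values. Contexts then separate values because some pair of
    classes is unrelated: for K = 1 this is (iv), for K > 1 two classes with different l provide it.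
    The counts fix the numbers only up to an unknown factor g_l, the product of the two gcds of
    class sizes on the other side: S'_l = g_l S_l and d_1 ... d_l = g_l d'_1 ... d'_l. Consecutive
    sums differ by d_(l+1) + S_l, which yields g_l = 1 from g_(l+1) = 1 as long as l > 1. At l = 1
    the descent stops, since no class has l = 0 and the sum for l = 0 is not observable. For K > 1
    the count with two extra pairs of edges replaces it. For K = 1 a second solution d'_1 = S_1, d_1
    = g_1 S_1 remains; the first gcd of (D) excludes it, since (iv) makes S_1 > 1. *)

Section Polycyclic.
Variables (I J : eqType) (R : I -> J -> bool).

(* [(U, V)] stands for the product of the positive letters of [U] and the
   negative letters of [rev V]: [V] is a stack, with its top first. *)
Definition nform := (seq J * seq I)%type.

Definition mstep (s : option nform) (x : I + J) : option nform :=
  if s is Some (U, V) then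
    match x with
    | inl i => Some (U, i :: V)
    | inr j => if V is i :: V' then (if R i j then Some (U, V') else None)
               else Some (rcons U j, [::])
    end
  else None.

Definition mval (w : seq (I + J)) : option nform :=
  foldl mstep (Some ([::], [::])) w.

Definition nword (s : nform) : seq (I + J) :=
  map inr s.1 ++ map inl (rev s.2).

Lemma foldl_mstep_None w : foldl mstep None w = None.
Proof. by elim: w. Qed.

Lemma mval_cat u v : mval (u ++ v) = foldl mstep (mval u) v.
Proof. by rewrite /mval foldl_cat. Qed.

Lemma mval_rcons u x : mval (rcons u x) = mstep (mval u) x.
Proof. by rewrite /mval foldl_rcons. Qed.

Lemma foldl_inl U V W :
  foldl mstep (Some (U, V)) (map inl W) = Some (U, rev W ++ V).
Proof.
elim: W V => //= i W IH V.
by rewrite IH rev_cons cat_rcons.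
Qed.

Lemma foldl_inr U W :
  foldl mstep (Some (U, [::])) (map inr W) = Some (U ++ W, [::]).
Proof. by elim: W U => [|j W IH] U /=; rewrite ?cats0 // IH cat_rcons. Qed.

Lemma mval_nword s : mval (nword s) = Some s.
Proof.
case: s => U V; rewrite /mval foldl_cat foldl_inr foldl_inl.
by rewrite revK cats0.
Qed.

(** Makes equality of values a congruence. Induction on the last letter: when it cancels, the letter
    it cancels is the last one of [nword]. *)
Lemma foldl_mval a w :
  foldl mstep a w = if mval w is Some s then foldl mstep a (nword s) else None.
Proof.
elim/last_ind: w => [|w x IH]; first by [].
rewrite foldl_rcons mval_rcons IH.
case: (mval w) => [[U V]|] //; case: x => [i|j] /=.
  by rewrite /nword /= rev_cons map_rcons -rcons_cat foldl_rcons.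
case: V => [|i V] /=.
  by rewrite /nword /= !cats0 map_rcons foldl_rcons.
have -> : nword (U, i :: V) = rcons (nword (U, V)) (inl i).
  by rewrite /nword /= rev_cons map_rcons rcons_cat.
rewrite foldl_rcons; case Rij: (R i j); case: (foldl _ a _) => [[U' V']|] //=;
  by rewrite Rij.
Qed.

Lemma mval_congr u u' v v' :
  mval u = mval u' -> mval v = mval v' -> mval (u ++ v) = mval (u' ++ v').
Proof. by move=> e e'; rewrite !mval_cat e foldl_mval e' -foldl_mval. Qed.

Lemma mval_catl u v v' : mval v = mval v' -> mval (u ++ v) = mval (u ++ v').
Proof. exact: mval_congr. Qed.

Lemma mval_catr u u' v : mval u = mval u' -> mval (u ++ v) = mval (u' ++ v).
Proof. by move=> e; apply: mval_congr. Qed.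

Lemma mval_infix a b c : mval (a ++ b ++ c) <> None -> mval b <> None.
Proof.
move=> h e; apply: h.
by rewrite mval_cat foldl_cat [foldl _ (mval a) b]foldl_mval e foldl_mstep_None.
Qed.

Lemma mval_prefix a b : mval (a ++ b) <> None -> mval a <> None.
Proof. exact: (@mval_infix [::]). Qed.

Lemma mval_suffix a b : mval (a ++ b) <> None -> mval b <> None.
Proof. by move=> h; apply: (@mval_infix a b [::]); rewrite cats0. Qed.

Definition neutral w := mval w = mval [::].

Lemma neutral_catl u v : neutral u -> mval (u ++ v) = mval v.
Proof. by move=> h; rewrite (mval_catr v h). Qed.

(** A cancellation removes one letter of each sign, so the height, negative minus positive letters,
    depends on the value alone. *)
Lemma mval_height w U V : mval w = Some (U, V) ->
  size V + count (fun x => ~~ is_inl x) w = size U + count is_inl w.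
Proof.
elim/last_ind: w U V => [|w x IH] U V; first by case=> <- <-.
rewrite mval_rcons -cats1 !count_cat /=.
case: (mval w) IH => [[U0 V0]|] // IH; have {IH} := IH _ _ (erefl _).
case: x => [i|j] /=; first by move=> h [<- <-] /=; lia.
case: V0 => [|i V0]; first by move=> /= h [<- <-]; rewrite size_rcons /=; lia.
by case: (R i j) => //= h [<- <-]; lia.
Qed.

(** The cut comes after the last positive letter read with an empty stack; beyond it the stack never
    underflows. *)
Lemma mval_split w U V : mval w = Some (U, V) ->
  exists w1 w2, [/\ w = w1 ++ w2, mval w1 = Some (U, [::])
                  & mval w2 = Some ([::], V)].
Proof.
elim/last_ind: w U V => [|w x IH] U V.
  by case=> <- <-; exists [::], [::].
rewrite mval_rcons; case E: (mval w) IH => [[U0 V0]|] // IH.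
have {IH} [w1 [w2 [ew e1 e2]]] := IH _ _ (erefl _).
case: x => [i|j] /=.
  by case=> <- <-; exists w1, (rcons w2 (inl i)); rewrite ew rcons_cat mval_rcons e2.
case: V0 E e2 => [|i V0] E e2.
  case=> <- <-; exists (rcons w (inr j)), [::]; rewrite cats0 mval_rcons E.
  by [].
case Rij: (R i j) => // -[<- <-].
by exists w1, (rcons w2 (inr j)); rewrite ew rcons_cat mval_rcons e2 /= Rij.
Qed.

Lemma foldl_stack_inr V W U' V' :
  foldl mstep (Some ([::], V)) (map inr W) = Some (U', V') ->
  U' = [::] \/ V' = [::].
Proof.
elim: W V => [|j W IH] V /=; first by case=> <-; left.
case: V => [|i V]; last by case: (R i j); [exact: IH | rewrite foldl_mstep_None].
by rewrite foldl_inr => -[_ <-]; right.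
Qed.

(* [w2 ++ w1] is [w] rotated to the point where its positive part has just
   been emitted; its value is then purely negative or purely positive. *)
Lemma mval_rotation w : mval (w ++ w) <> None ->
  exists w1 w2 U V, [/\ w = w1 ++ w2, mval w1 = Some (U, [::]),
    mval w2 = Some ([::], V) &
    exists U' V', mval (w2 ++ w1) = Some (U', V') /\ (U' = [::] \/ V' = [::])].
Proof.
move=> h; case E: (mval w) (mval_prefix h) => [[U V]|] // _.
have [w1 [w2 [ew e1 e2]]] := mval_split E; exists w1, w2, U, V; split=> //.
have h2 : mval (w2 ++ w1) <> None.
  apply: (@mval_infix w1 _ w2).
  by move: h; rewrite ew -!catA.
case E2: (mval (w2 ++ w1)) h2 => [[U' V']|] // _; exists U', V'; split=> //.
move: E2; rewrite mval_cat e2 foldl_mval e1 /nword /= cats0.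
exact: foldl_stack_inr.
Qed.

Definition wpow (T : Type) (w : seq T) n : seq T := flatten (nseq n w).

Lemma wpowS T (w : seq T) n : wpow w n.+1 = w ++ wpow w n.
Proof. by []. Qed.

Lemma wpowD T (w : seq T) m n : wpow w (m + n) = wpow w m ++ wpow w n.
Proof. by rewrite /wpow nseqD flatten_cat. Qed.

Lemma wpow1 T (w : seq T) : wpow w 1 = w.
Proof. exact: cats0. Qed.

Lemma wpowSr T (w : seq T) n : wpow w n.+1 = wpow w n ++ w.
Proof. by rewrite -addn1 wpowD wpow1. Qed.

Lemma size_wpow T (w : seq T) n : size (wpow w n) = n * size w.
Proof. by elim: n => // n IH; rewrite wpowS size_cat IH mulSn. Qed.

Lemma wpow_rot T (u v : seq T) n : u ++ wpow (v ++ u) n = wpow (u ++ v) n ++ u.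
Proof.
elim: n => [|n IH]; first by rewrite /= cats0.
by rewrite !wpowS -!catA IH.
Qed.

Lemma wpow_rotS T (u v : seq T) n :
  wpow (u ++ v) n.+1 = u ++ wpow (v ++ u) n ++ v.
Proof. by rewrite [RHS]catA wpow_rot wpowSr -catA. Qed.

Lemma pmap_wpow T T' (f : T -> option T') w n :
  pmap f (wpow w n) = wpow (pmap f w) n.
Proof. by elim: n => // n IH; rewrite !wpowS pmap_cat IH. Qed.

Lemma wpow_letter T (x : T) n : wpow [:: x] n = nseq n x.
Proof. by elim: n => // n IH; rewrite wpowS IH. Qed.

Lemma neutral_wpow w n : neutral w -> neutral (wpow w n).
Proof. by move=> h; elim: n => // n IH; rewrite wpowS /neutral neutral_catl. Qed.

Lemma wpow_negative w V n : mval w = Some ([::], V) ->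
  mval (wpow w n) = Some ([::], wpow V n).
Proof.
move=> e; elim: n => // n IH.
rewrite wpowSr mval_cat IH foldl_mval e /nword /= foldl_inl revK.
by rewrite wpowS.
Qed.

(** Each letter pops at most one element, so a positive letter never meets an empty stack. *)
Lemma foldl_deep_stack V w U' V' : size w <= size V ->
  foldl mstep (Some ([::], V)) w = Some (U', V') -> U' = [::].
Proof.
elim: w V => [|[i|j] w IH] V /=; first by move=> _ [<-].
- by move=> h; apply: IH => /=; lia.
- case: V => // i V /= h; case: (R i j); last by rewrite foldl_mstep_None.
  by apply: IH; lia.
Qed.

(** The exponent is crude: every copy of [w] leaves at least one letter, and [size x] of them
    suffice against all positive letters of [x]. *)
Lemma negative_absorb w V x : mval w = Some ([::], V) -> V <> [::] ->
  mval (wpow w (size x) ++ x) <> None ->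
  exists W, mval (wpow w (size x) ++ x) = Some ([::], W).
Proof.
move=> e nV; rewrite mval_cat (wpow_negative _ e).
case E: (foldl _ _ _) => [[U W]|] // _; exists W.
rewrite (foldl_deep_stack _ E) // size_wpow.
by case: V nV {e E} => // i V _ /=; lia.
Qed.

Lemma cat_negative x y V : mval x <> None -> mval y = Some ([::], V) ->
  mval (x ++ y) <> None.
Proof.
move=> nx e; rewrite mval_cat; case: (mval x) nx => [[U W]|] // _.
by rewrite foldl_mval e /nword /= foldl_inl.
Qed.

(** A strictly negative rotation of [r] builds, between [x] and [y], a stack so high that [y] cannot
    empty it; hence [x] and [y] never interact. *)
Lemma negative_gluing r r1 r2 U V W x y :
  r = r1 ++ r2 -> mval r1 = Some (U, [::]) -> mval r2 = Some ([::], V) ->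
  mval (r2 ++ r1) = Some ([::], W) -> W <> [::] ->
  (forall N, mval (wpow r N ++ x ++ wpow r N) <> None) ->
  (forall N, mval (wpow r N ++ y ++ wpow r N) <> None) ->
  exists M, forall N, mval (wpow r N ++ x ++ wpow r M ++ y ++ wpow r N) <> None.
Proof.
move=> er e1 e2 e nW hx hy.
(* Words are regrouped at the cut between [r1] and [r2], where the period is purely negative: [z] is
   [y] seen from there, and k rotated periods absorb it. One more period in the middle and one on
   the right supply the missing [r1] and [r2]. *)
pose z := r2 ++ y ++ r1; pose k := size z.
have rotr n : wpow r n.+1 = r1 ++ wpow (r2 ++ r1) n ++ r2.
  by rewrite er wpow_rotS.
exists k.+1 => N; apply: (@mval_infix r _ r).
have -> : r ++ (wpow r N ++ x ++ wpow r k.+1 ++ y ++ wpow r N) ++ r =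
    ((wpow r N.+1 ++ x ++ r1) ++ (wpow (r2 ++ r1) k ++ z)) ++
    (wpow (r2 ++ r1) N ++ r2).
  rewrite (rotr k) (wpowS r N) /z -!catA; do 7 ! congr (_ ++ _).
  by rewrite -wpowSr rotr.
have [Z eZ] : exists Z, mval (wpow (r2 ++ r1) k ++ z) = Some ([::], Z).
  apply: (negative_absorb e nW).
  apply: (@mval_infix r1 _ (wpow (r2 ++ r1) k ++ r2)).
  by have := hy k.+1; rewrite rotr /z -!catA.
have [V' eV'] : exists V', mval (wpow (r2 ++ r1) N ++ r2) = Some ([::], V').
  rewrite mval_cat (wpow_negative _ e) foldl_mval e2 /nword /= foldl_inl.
  by eexists.
apply: (cat_negative _ eV'); apply: (cat_negative _ eZ).
apply: (@mval_prefix _ (wpow (r2 ++ r1) N ++ r2)).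
by have := hx N.+1; rewrite {2}rotr -!catA.
Qed.

End Polycyclic.

Arguments mval {I J} R w.
Arguments neutral {I J} R w.

Section Dual.
Variables (I J : eqType) (R : I -> J -> bool).

Definition swap (A B : Type) (x : A + B) : B + A :=
  match x with inl a => inr a | inr b => inl b end.

Definition dualw (A B : Type) (w : seq (A + B)) : seq (B + A) :=
  rev (map (@swap A B) w).

Lemma dualwK (A B : Type) : cancel (@dualw A B) (@dualw B A).
Proof.
by move=> w; rewrite /dualw map_rev revK mapK //; case.
Qed.

Lemma dualw_cat (A B : Type) (u v : seq (A + B)) :
  dualw (u ++ v) = dualw v ++ dualw u.
Proof. by rewrite /dualw map_cat rev_cat. Qed.

Lemma dualw_wpow (A B : Type) (w : seq (A + B)) n :
  dualw (wpow w n) = wpow (dualw w) n.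
Proof. by elim: n => // n IH; rewrite wpowSr dualw_cat IH. Qed.

(** Reversal with exchange of signs is an anti-isomorphism onto the monoid of the transposed
    relation, so statements on positive letters follow from those on negative ones. *)
Lemma mval_dual w :
  mval (fun j i => R i j) (dualw w) =
  omap (fun s => (s.2, s.1)) (mval R w).
Proof.
elim/last_ind: w => [|w x IH] //.
rewrite -cats1 dualw_cat [in RHS]mval_cat.
case: (mval R w) IH => [[U V]|] IH; last first.
  by rewrite mval_cat foldl_mval IH.
rewrite /= in IH.
have -> : mval (fun j i => R i j) (dualw [:: x] ++ dualw w) =
  mval (fun j i => R i j) ([:: swap x] ++ nword (V, U)).
  by apply: mval_catl; rewrite IH mval_nword.
case: x => [i|j] /=; first exact: (mval_nword _ (i :: V, U)).
case: V {IH} => [|i V] /=.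
  by rewrite -(mval_nword (fun j i => R i j) ([::], rcons U j)) /nword rev_rcons.
rewrite /mval /=; case: (R i j); last exact: foldl_mstep_None.
exact: (mval_nword _ (V, U)).
Qed.

Lemma mval_dualN w :
  mval (fun j i => R i j) (dualw w) <> None <-> mval R w <> None.
Proof. by rewrite mval_dual; case: (mval R w). Qed.

Lemma mval_dual_eq w w' :
  mval (fun j i => R i j) (dualw w) = mval (fun j i => R i j) (dualw w') <->
  mval R w = mval R w'.
Proof.
rewrite !mval_dual; split=> [|-> //].
by case: (mval R w) => [[? ?]|]; case: (mval R w') => [[? ?]|] //= [-> ->].
Qed.

End Dual.

Section DualGluing.
Variables (I J : eqType) (R : I -> J -> bool).

(* The second alternative is the property that recognizes, by gluing homoclinic
   points, the periodic points that are not neutral. *)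
Lemma neutral_or_gluing r x y :
  (forall N, mval R (wpow r N ++ x ++ wpow r N) <> None) ->
  (forall N, mval R (wpow r N ++ y ++ wpow r N) <> None) ->
  (exists r1 r2, r = r1 ++ r2 /\ neutral R (r2 ++ r1)) \/
  exists M, forall N,
    mval R (wpow r N ++ x ++ wpow r M ++ y ++ wpow r N) <> None.
Proof.
move=> hx hy.
have hr : mval R (r ++ r) <> None.
  by have := mval_prefix (hx 2); rewrite /wpow /= cats0.
have [r1 [r2 [U [V [er e1 e2 [U' [V' [e [eU|eV]]]]]]]]] := mval_rotation hr.
  case: V' e => [|i V'] e.
    by left; exists r1, r2; split=> //; rewrite /neutral e eU.
  right; rewrite eU in e; exact: (negative_gluing er e1 e2 e).
case: U' e => [|j U'] e.
  by left; exists r1, r2; split=> //; rewrite /neutral e eV.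
right; rewrite eV in e.
have ed : dualw r = dualw r2 ++ dualw r1 by rewrite er dualw_cat.
(* A strictly positive rotation is negative in the dual; reversal also exchanges the order of [x]
   and [y]. *)
have [||||||M hM] := @negative_gluing J I (fun j i => R i j) (dualw r)
    (dualw r2) (dualw r1) V U (j :: U') (dualw y) (dualw x) ed.
- by rewrite mval_dual e2.
- by rewrite mval_dual e1.
- by rewrite -dualw_cat mval_dual e.
- by [].
- by move=> N; rewrite -dualw_wpow -!dualw_cat mval_dualN -catA.
- by move=> N; rewrite -dualw_wpow -!dualw_cat mval_dualN -catA.
exists M => N; have := hM N; rewrite -!dualw_wpow -!dualw_cat mval_dualN.
by rewrite -!catA.
Qed.

End DualGluing.

(** * Values are determined by their contexts *)

Section Faithful.
Variables (I J : eqType) (R : I -> J -> bool).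

(** The last clause excludes the full relation: it gives the bicyclic monoid, which has no zero
    products, so that contexts would distinguish nothing. *)
Definition reduced_relation :=
  [/\ forall i, exists j, R i j, forall j, exists i, R i j,
      forall i i', R i =1 R i' -> i = i',
      forall j j', R^~ j =1 R^~ j' -> j = j' &
      exists i j, ~~ R i j].

Hypothesis redR : reduced_relation.

Lemma mval_single i j : mval R [:: inl i; inr j] <> None <-> R i j.
Proof. by rewrite /mval /=; case: (R i j). Qed.

(* If [w] had value (U, V) <> 1, then [i w j] would be nonzero under a condition
   on [i] alone and a condition on [j] alone, so that all pairs would be related. *)
Lemma neutral_test w :
  (forall i j, mval R ([:: inl i] ++ w ++ [:: inr j]) <> None <-> R i j) ->
  neutral R w.
Proof.
have [rows cols _ _ [i2 [j2 /negP nR]]] := redR.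
move=> h.
have : mval R w <> None.
  have [j ij] := rows i2; exact: mval_infix (iffRL (h i2 j) ij).
case E: (mval R w) => [[U V]|] // _.
have {}h i j : mval R ([:: inl i] ++ nword (U, V) ++ [:: inr j]) <> None <-> R i j.
  rewrite -h; have e : mval R (nword (U, V)) = mval R w by rewrite mval_nword.
  by rewrite (mval_catl [:: inl i] (mval_catr [:: inr j] e)).
suff [eU eV] : U = [::] /\ V = [::] by rewrite /neutral E eU eV.
(* Both [i2] and [j2] occur in some related pair. In each case below relatedness splits into a
   condition on i and one on j, so the pair (i2, j2) would inherit it. *)
have [i3 h3] := cols j2; have [j3 h4] := rows i2.
case: V h {E} => [|i1 V]; case: U => [|j1 U] h; split=> //; exfalso.
- have {}h i j : R i j1 <-> R i j.
    rewrite -(h i j) /mval /=; case: (R i j1); last by rewrite foldl_mstep_None; split.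
    by rewrite cats0 foldl_cat foldl_inr.
  by apply: nR; apply/h; apply/h; exact: h4.
- have {}h i j : R i1 j <-> R i j.
    rewrite -(h i j) /mval /= foldl_cat foldl_inl revK /=.
    by case: (R i1 j).
  by apply: nR; apply/h; apply/h; exact: h3.
- have {}h i j : R i j1 /\ R i1 j <-> R i j.
    rewrite -(h i j) /mval /=; case: (R i j1); last first.
      by rewrite foldl_mstep_None; split=> // -[].
    rewrite !foldl_cat foldl_inr foldl_inl revK /=.
    by case: (R i1 j); split=> // -[].
  apply: nR; apply/h; split.
    by have [_ /(_ h4)[]] := h i2 j3.
  by have [_ /(_ h3)[]] := h i3 j2.
- have {}h i j : R i j1 /\ R i1 j <-> R i j.
    rewrite -(h i j) /mval /=; case: (R i j1); last first.
      by rewrite foldl_mstep_None; split=> // -[].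
    rewrite !foldl_cat foldl_inr foldl_inl revK /=.
    by case: (R i1 j); split=> // -[].
  apply: nR; apply/h; split.
    by have [_ /(_ h4)[]] := h i2 j3.
  by have [_ /(_ h3)[]] := h i3 j2.
Qed.

Lemma stack_cancel A U :
  foldl (mstep R) (Some ([::], A)) (map inr U) = Some ([::], [::]) <->
  all2 R A U.
Proof.
elim: U A => [|j U IH] [|i A] //=; first by rewrite (foldl_inr R [:: j] U).
by case: (R i j) => //=; rewrite foldl_mstep_None.
Qed.

Lemma foldl_no_positive U V w V' :
  foldl (mstep R) (Some (U, V)) w = Some ([::], V') -> U = [::].
Proof.
elim: w U V => [|[i|j] w IH] U V /=; first by case.
  exact: IH.
case: V => [|i V]; last by case: (R i j); [exact: IH | rewrite foldl_mstep_None].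
by move/IH; case: U.
Qed.

Definition same_contexts w w' :=
  forall a b, mval R (a ++ w ++ b) <> None <-> mval R (a ++ w' ++ b) <> None.

Lemma foldl_pop A U V :
  foldl (mstep R) (Some ([::], A)) (map inr U) = Some ([::], V) ->
  size A = size U + size V.
Proof.
elim: U A => [|j U IH] [|i A] //=; try by case=> <-.
  by move/foldl_no_positive.
by case: (R i j) => [/IH ->|]; rewrite ?addSn // foldl_mstep_None.
Qed.

(** Being 1 is visible in contexts by [neutral_test], so what cancels (U, V) to 1 also cancels (U',
    V'). This first compares lengths; once they agree, letters must cancel one by one. *)
Lemma same_contexts_cancel U V U' V' A B :
  same_contexts (nword (U, V)) (nword (U', V')) ->
  all2 R A U -> all2 R V B ->
  size U' <= size U /\
  (size U <= size U' -> all2 R A U' /\ all2 R V' B).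
Proof.
move=> h hA hB.
have sA : size A = size U by move: hA; rewrite all2E => /andP[/eqP].
pose a : seq (I + J) := map inl (rev A); pose b : seq (I + J) := map inr B.
have ea : mval R a = Some ([::], A) by rewrite /mval foldl_inl revK cats0.
have e1 : neutral R (a ++ nword (U, V) ++ b).
  rewrite /neutral /nword !mval_cat !foldl_cat ea /=.
  by move/stack_cancel: hA => ->; rewrite foldl_inl revK cats0; apply/stack_cancel.
have {h e1} : neutral R (a ++ nword (U', V') ++ b).
  apply: neutral_test => i j; rewrite -mval_single.
  have <- : mval R ([:: inl i] ++ (a ++ nword (U, V) ++ b) ++ [:: inr j]) =
    mval R [:: inl i; inr j] := mval_catl [:: inl i] (neutral_catl [:: inr j] e1).
  have := h ([:: inl i] ++ a) (b ++ [:: inr j]); rewrite -!catA => h1.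
  exact: iff_sym.
rewrite /neutral /nword /= -!catA catA mval_cat.
case e2 : (mval R _) => [[U1 V1]|]; last by rewrite foldl_mstep_None.
move=> h; have e3 := foldl_no_positive h; move: e2 h; rewrite {}e3 mval_cat ea.
move=> e2 h; have e3 := foldl_pop e2.
split=> [|le]; first by lia.
have e4 : V1 = [::] by apply: size0nil; lia.
rewrite e4 in e2 h; split; first exact/stack_cancel.
by move: h; rewrite foldl_cat foldl_inl revK cats0 => /stack_cancel.
Qed.

Lemma all2_witnessl U : exists A, all2 R A U.
Proof.
have [_ cols _ _ _] := redR; elim: U => [|j U [A h]]; first by exists [::].
by have [i ij] := cols j; exists (i :: A); rewrite /= ij.
Qed.

Lemma all2_witnessr V : exists B, all2 R V B.
Proof.
have [rows _ _ _ _] := redR; elim: V => [|i V [B h]]; first by exists [::].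
by have [j ij] := rows i; exists (j :: B); rewrite /= ij.
Qed.

Lemma all2_injl U U' : (forall A, all2 R A U = all2 R A U') -> U = U'.
Proof.
have [_ cols _ redc _] := redR.
elim: U U' => [|j U IH] [|j' U'] h //.
- by have := h [::].
- by have := h [::].
have [A hA] := all2_witnessl U; have [i ij] := cols j.
have := h (i :: A); rewrite /= ij hA /= => /esym /andP[ij' hA'].
have ej : j = j'.
  by apply: redc => k /=; have := h (k :: A); rewrite /= hA hA' !andbT.
rewrite -ej in h *; congr cons; apply: IH => B.
by have := h (i :: B); rewrite /= ij.
Qed.

Lemma all2_injr V V' : (forall B, all2 R V B = all2 R V' B) -> V = V'.
Proof.
have [rows _ redr _ _] := redR.
elim: V V' => [|i V IH] [|i' V'] h //.
- by have := h [::].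
- by have := h [::].
have [B hB] := all2_witnessr V; have [j ij] := rows i.
have := h (j :: B); rewrite /= ij hB /= => /esym /andP[ij' hB'].
have ei : i = i'.
  by apply: redr => k /=; have := h (k :: B); rewrite /= hB hB' !andbT.
rewrite -ei in h *; congr cons; apply: IH => A.
by have := h (j :: A); rewrite /= ij.
Qed.

(** The length bounds in both directions give equal lengths. Then [U] and [U'] have the same left
    partners, [V] and [V'] the same right partners, and distinct columns and rows recover the
    letters. *)
Lemma mval_faithful w w' : mval R w <> None -> mval R w' <> None ->
  same_contexts w w' -> mval R w = mval R w'.
Proof.
case E: (mval R w) => [[U V]|] // _; case E': (mval R w') => [[U' V']|] // _ h.
have {}h : same_contexts (nword (U, V)) (nword (U', V')).
  have e v s a b : mval R v = Some s ->
      mval R (a ++ nword s ++ b) = mval R (a ++ v ++ b).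
    by move=> ev; apply/mval_catl/mval_catr; rewrite mval_nword.
  by move=> a b; rewrite (e _ _ _ _ E) (e _ _ _ _ E').
have h' : same_contexts (nword (U', V')) (nword (U, V)).
  by move=> a b; apply: iff_sym.
have [A hA] := all2_witnessl U; have [B hB] := all2_witnessr V.
have [A' hA'] := all2_witnessl U'; have [B' hB'] := all2_witnessr V'.
have [le1 _] := same_contexts_cancel h hA hB.
have [le2 _] := same_contexts_cancel h' hA' hB'.
have -> : U = U'.
  apply: all2_injl => C; apply/idP/idP => hC.
    by have [_ /(_ le2)[]] := same_contexts_cancel h hC hB.
  by have [_ /(_ le1)[]] := same_contexts_cancel h' hC hB'.
have -> // : V = V'.
apply: all2_injr => C; apply/idP/idP => hC.
  by have [_ /(_ le2)[]] := same_contexts_cancel h hA hC.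
by have [_ /(_ le1)[]] := same_contexts_cancel h' hA' hC.
Qed.

End Faithful.

Lemma reduced_relation_dual (I J : eqType) (R : I -> J -> bool) :
  reduced_relation R -> reduced_relation (fun j i => R i j).
Proof. by case=> ? ? ? ? [i [j ?]]; split=> //; exists j, i. Qed.

(** * Multiplicative correspondences between two monoids of classes *)

Section Correspondence.

(** A relation between words instead of a map of values: homoclinic points produce words, and
    [corr_eq] shows afterwards that the relation is single-valued on values. *)
Definition multiplicative (I J I' J' : eqType) (R : I -> J -> bool)
    (R' : I' -> J' -> bool) (th : seq (I + J) -> seq (I' + J') -> Prop) :=
  [/\ forall w, mval R w <> None -> exists w', th w w',
      forall w', mval R' w' <> None -> exists w, th w w',
      forall w w', th w w' -> mval R w <> None /\ mval R' w' <> None,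
      forall u u' v v', th u u' -> th v v' ->
        (mval R (u ++ v) <> None <-> mval R' (u' ++ v') <> None) &
      forall u u' v v', th u u' -> th v v' -> mval R (u ++ v) <> None ->
        th (u ++ v) (u' ++ v')].

Lemma multiplicative_sym (I J I' J' : eqType) (R : I -> J -> bool)
    (R' : I' -> J' -> bool) th :
  multiplicative R R' th -> multiplicative R' R (fun w' w => th w w').
Proof.
case=> tot sur def cat1 cat2; split=> //.
- by move=> w w' /def[].
- by move=> u u' v v' h1 h2; apply: iff_sym; apply: cat1.
- by move=> u u' v v' h1 h2 h; apply: cat2 => //; apply/cat1; eauto.
Qed.

Lemma multiplicative_dual (I J I' J' : eqType) (R : I -> J -> bool)
    (R' : I' -> J' -> bool) th :
  multiplicative R R' th ->
  multiplicative (fun j i => R i j) (fun j i => R' i j)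
    (fun w w' => th (dualw w) (dualw w')).
Proof.
have dual (A B : eqType) (T : A -> B -> bool) w :
    mval (fun j i => T i j) w <> None <-> mval T (dualw w) <> None.
  by rewrite -{1}[w]dualwK mval_dualN.
case=> tot sur def cat1 cat2; split.
- move=> w /dual/tot[w' h]; exists (dualw w'); by rewrite dualwK.
- move=> w /dual/sur[w' h]; exists (dualw w'); by rewrite dualwK.
- by move=> w w' /def[? ?]; split; apply/dual.
- move=> u u' v v' h1 h2; have := cat1 _ _ _ _ h2 h1.
  by rewrite -!dualw_cat => -[c1 c2]; split=> /dual h; apply/dual; auto.
- move=> u u' v v' h1 h2 /dual; rewrite !dualw_cat => h; exact: cat2.
Qed.

Variables (I J I' J' : eqType) (R : I -> J -> bool) (R' : I' -> J' -> bool).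
Variable th : seq (I + J) -> seq (I' + J') -> Prop.
Hypothesis redR' : reduced_relation R'.
Hypothesis mth : multiplicative R R' th.

(** The two parts of a nonzero context have correspondents, so [w'] and [v'] are nonzero in the same
    contexts and [mval_faithful] applies. *)
Lemma corr_eq w w' v v' : th w w' -> th v v' -> mval R w = mval R v ->
  mval R' w' = mval R' v'.
Proof.
have [tot sur def cat1 cat2] := mth.
move=> hw hv e; have [nw nw'] := def _ _ hw; have [nv nv'] := def _ _ hv.
apply: (mval_faithful redR') => // a b.
have half x x' y y' : th x x' -> th y y' -> mval R x = mval R y ->
    mval R' (a ++ x' ++ b) <> None -> mval R' (a ++ y' ++ b) <> None.
  move=> hx hy exy h.
  have [a0 ha] := sur _ (mval_prefix h).
  have [b0 hb] := sur _ (mval_suffix (mval_suffix h)).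
  have h1 : mval R (x ++ b0) <> None by apply/(cat1 _ _ _ _ hx hb)/(mval_suffix h).
  have h2 : mval R (y ++ b0) <> None by rewrite -(mval_catr _ exy).
  apply/(cat1 _ _ _ _ ha (cat2 _ _ _ _ hy hb h2)).
  rewrite -(mval_catl _ (mval_catr _ exy)).
  exact/(cat1 _ _ _ _ ha (cat2 _ _ _ _ hx hb h1)).
by split; apply: half; eauto.
Qed.

(** A preimage [z] of the empty word absorbs [w] on its left; comparing the images of [w ++ z] and
    [z] gives 1. *)
Lemma corr_neutral w w' : th w w' -> neutral R w -> neutral R' w'.
Proof.
have [tot sur def cat1 cat2] := mth.
move=> h n; have [z hz] := sur [::] ltac:(by []).
have e : mval R (w ++ z) = mval R z by exact: neutral_catl.
have h' : th (w ++ z) (w' ++ [::]).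
  by apply: cat2 => //; rewrite e; have [] := def _ _ hz.
by have := corr_eq h' hz e; rewrite cats0.
Qed.

End Correspondence.

Section CorrespondenceLetters.
Variables (I J I' J' : eqType) (R : I -> J -> bool) (R' : I' -> J' -> bool).
Variable th : seq (I + J) -> seq (I' + J') -> Prop.
Hypotheses (redR : reduced_relation R) (redR' : reduced_relation R').
Hypothesis mth : multiplicative R R' th.

(** Negative values are exactly those with a right inverse, a property that the correspondence
    respects. *)
Lemma corr_negative w w' V' : th w w' -> mval R' w' = Some ([::], V') ->
  exists V, mval R w = Some ([::], V).
Proof.
have [tot sur def cat1 cat2] := mth.
move=> h e; have [B hB] := all2_witnessr redR' V'.
have n' : neutral R' (w' ++ map inr B).
  by rewrite /neutral mval_cat e; apply/stack_cancel.
have [z hz] : exists z, th z (map inr B).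
  by apply: sur; apply: (@mval_suffix _ _ _ w'); rewrite n'.
have h1 : mval R (w ++ z) <> None by apply/(cat1 _ _ _ _ h hz); rewrite n'.
have := corr_neutral redR (multiplicative_sym mth) (cat2 _ _ _ _ h hz h1) n'.
rewrite /neutral mval_cat; case: (mval R w) => [[U V]|].
  by move/foldl_no_positive => ->; exists V.
by rewrite foldl_mstep_None.
Qed.

End CorrespondenceLetters.

Section CorrespondenceBijection.
Variables (I J I' J' : eqType) (R : I -> J -> bool) (R' : I' -> J' -> bool).
Variable th : seq (I + J) -> seq (I' + J') -> Prop.
Hypotheses (redR : reduced_relation R) (redR' : reduced_relation R').
Hypothesis mth : multiplicative R R' th.

Let mthS := multiplicative_sym mth.

(** Letters are the irreducible negative values: a factorization of the image into two nontrivial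
    negative factors would pull back to a factorization of the letter. *)
Lemma corr_letter_neg w w' i : th w w' -> mval R w = mval R [:: inl i] ->
  exists i', mval R' w' = mval R' [:: inl i'].
Proof.
have [tot sur def cat1 cat2] := mth.
move=> h e; have [V' e'] := corr_negative redR' redR mthS h e.
have nn s s' : th s s' -> neutral R s -> neutral R' s' :=
  @corr_neutral _ _ _ _ _ _ _ redR' mth s s'.
case: V' e' => [|x V1] e'.
  by have := corr_neutral redR mthS h e'; rewrite /neutral e.
case: V1 e' => [|y V1] e'; first by exists x.
exfalso; pose s1' : seq (I' + J') := map inl (rev (y :: V1)).
have e1 : mval R' s1' = Some ([::], y :: V1).
  by rewrite /mval foldl_inl revK cats0.
have e12 : mval R' (s1' ++ [:: inl x]) = mval R' w' by rewrite mval_cat e1 e'.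
have [s1 h1] : exists s, th s s1' by apply: sur; rewrite e1.
have [s2 h2] : exists s, th s [:: inl x] by apply: sur.
have h12 : mval R (s1 ++ s2) <> None.
  by apply/(cat1 _ _ _ _ h1 h2); rewrite e12 e'.
have := corr_eq redR mthS (cat2 _ _ _ _ h1 h2 h12) h e12.
have [V3 e3] := corr_negative redR redR' mth h1 e1.
have [V4 e4] := @corr_negative _ _ _ _ _ _ _ redR redR' mth _ _ [:: x] h2 (erefl _).
rewrite e mval_cat e3 foldl_mval e4 /nword /= foldl_inl revK.
case: V4 e4 => [|v V4] e4; first by have := nn _ _ h2 e4.
case: V3 e3 => [|u V3] e3; first by have := nn _ _ h1 e3; rewrite /neutral e1.
by case=> _ /(congr1 size); rewrite size_cat /= addnS.
Qed.

End CorrespondenceBijection.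

Definition sum_map (A B A' B' : Type) (f : A -> A') (g : B -> B') (x : A + B) :=
  match x with inl a => inl (f a) | inr b => inr (g b) end.

Section CorrespondenceMap.
Variables (I J I' J' : eqType) (R : I -> J -> bool) (R' : I' -> J' -> bool).
Variable th : seq (I + J) -> seq (I' + J') -> Prop.
Hypotheses (redR : reduced_relation R) (redR' : reduced_relation R').
Hypothesis mth : multiplicative R R' th.

Lemma corr_letter_pos w w' j : th w w' -> mval R w = mval R [:: inr j] ->
  exists j', mval R' w' = mval R' [:: inr j'].
Proof.
move=> h e.
have [||j' ej'] := @corr_letter_neg _ _ _ _ _ _ _ (reduced_relation_dual redR)
  (reduced_relation_dual redR') (multiplicative_dual mth) (dualw w) (dualw w') j.
- by rewrite !dualwK.
- exact/(mval_dual_eq R w [:: inr j]).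
by exists j'; apply/(mval_dual_eq R' w' [:: inr j']).
Qed.

Lemma corr_letters : exists f g, forall w w' x, th w w' ->
  mval R w = mval R [:: x] -> mval R' w' = mval R' [:: sum_map f g x].
Proof.
have [tot sur def cat1 cat2] := mth.
have [f hf] : {f & forall i w w', th w w' ->
    mval R w = mval R [:: inl i] -> mval R' w' = mval R' [:: inl (f i)]}.
  apply: (@choice _ _ (fun i i' => forall w w', th w w' ->
    mval R w = mval R [:: inl i] -> mval R' w' = mval R' [:: inl i'])) => i.
  have [w0 h0] := tot [:: inl i] ltac:(by []).
  have [i' e'] := corr_letter_neg redR redR' mth h0 (erefl _).
  by exists i' => w w' h e; rewrite -e'; apply: (corr_eq redR' mth h h0).
have [g hg] : {g & forall j w w', th w w' ->
    mval R w = mval R [:: inr j] -> mval R' w' = mval R' [:: inr (g j)]}.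
  apply: (@choice _ _ (fun j j' => forall w w', th w w' ->
    mval R w = mval R [:: inr j] -> mval R' w' = mval R' [:: inr j'])) => j.
  have [w0 h0] := tot [:: inr j] ltac:(by []).
  have [j' e'] := corr_letter_pos h0 (erefl _).
  by exists j' => w w' h e; rewrite -e'; apply: (corr_eq redR' mth h h0).
by exists f, g => w w' [i|j]; [exact: hf | exact: hg].
Qed.

End CorrespondenceMap.

Lemma mval_letter_inj (I J : eqType) (R : I -> J -> bool) x y :
  mval R [:: x] = mval R [:: y] -> x = y.
Proof. by case: x => x; case: y => y //= [->]. Qed.

Lemma multiplicative_letters (I J I' J' : eqType) (R : I -> J -> bool)
    (R' : I' -> J' -> bool) th :
  reduced_relation R -> reduced_relation R' -> multiplicative R R' th ->
  exists (f : I -> I') (g : J -> J'),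
    [/\ bijective f, bijective g, forall i j, R' (f i) (g j) = R i j &
        forall w w' x, th w w' ->
          mval R w = mval R [:: x] <-> mval R' w' = mval R' [:: sum_map f g x]].
Proof.
move=> redR redR' mth; have mthS := multiplicative_sym mth.
have [f [g h]] := corr_letters redR redR' mth.
have [f' [g' h']] := corr_letters redR' redR mthS.
have [tot sur def cat1 cat2] := mth.
have K x : sum_map f' g' (sum_map f g x) = x.
  have [w ww] := tot [:: x] ltac:(by case: x).
  exact/esym/(@mval_letter_inj _ _ R)/(h' _ _ _ ww)/(h _ _ _ ww).
have K' x : sum_map f g (sum_map f' g' x) = x.
  have [w ww] := sur [:: x] ltac:(by case: x).
  exact/esym/(@mval_letter_inj _ _ R')/(h _ _ _ ww)/(h' _ _ _ ww).
exists f, g; split.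
- exists f' => i; first by have [] := K (inl i).
  by have [] := K' (inl i).
- exists g' => j; first by have [] := K (inr j).
  by have [] := K' (inr j).
- move=> i j; have [wi hi] := tot [:: inl i] ltac:(by []).
  have [wj hj] := tot [:: inr j] ltac:(by []).
  apply/idP/idP => [/mval_single|/mval_single] hR; apply/mval_single.
    apply/(cat1 _ _ _ _ hi hj).
    by rewrite (mval_congr (h _ _ _ hi (erefl _)) (h _ _ _ hj (erefl _))).
  have := iffLR (cat1 _ _ _ _ hi hj) hR.
  by rewrite (mval_congr (h _ _ _ hi (erefl _)) (h _ _ _ hj (erefl _))).
move=> w w' x ww; split; first exact: h.
by move/(h' _ _ _ ww); rewrite K.
Qed.

(** * Recognizing a letter from the powers of a period *)

Section Multiplier.
Variables (I J : eqType) (R : I -> J -> bool).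

Lemma foldl_stack_mem i Z U W U' V' : i \in drop (size Z) W ->
  foldl (mstep R) (Some (U, W)) Z = Some (U', V') -> i \in V'.
Proof.
elim: Z U W => [|[k|k] Z IH] U W /=; first by rewrite drop0 => h [_ <-].
  move=> h; apply: IH; case: (size Z) h => [|n] /= h.
    by rewrite inE (mem_drop h) orbT.
  by move: h; rewrite -[n.+2]/(2 + n) -drop_drop => /mem_drop.
case: W => //= a W h; case: (R a k); last by rewrite foldl_mstep_None.
exact: IH.
Qed.

Lemma mval_wpow_neg i n : mval R (wpow [:: inl i] n) = Some ([::], nseq n i).
Proof. by rewrite (@wpow_negative _ _ R _ [:: i]) // wpow_letter. Qed.

(** Heights at N = 0 and N = 1 show that [S] has height 1, so its pure rotation is a single negative
    letter [k]. In a high power some [k] survives the fixed word [D], and the given value identifies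
    it with [i]. *)
Lemma multiplier_rotation_neg i S C D c :
  (forall N, mval R (C ++ wpow S N ++ D) = mval R (wpow [:: inl i] (N + c))) ->
  exists S1 S2, S = S1 ++ S2 /\ mval R (S2 ++ S1) = mval R [:: inl i].
Proof.
move=> h; have hS : mval R (S ++ S) <> None.
  have : mval R (C ++ wpow S 2 ++ D) <> None by rewrite h mval_wpow_neg.
  by rewrite wpowS wpow1 => /mval_infix.
have [S1 [S2 [_ [_ [eS _ _ [U [V [e pure]]]]]]]] := mval_rotation hS.
exists S1, S2; split=> //.
have height N := mval_height (etrans (h N) (mval_wpow_neg _ _)).
have := mval_height e; have := height 0; have := height 1.
rewrite !wpow1 eS /= !count_cat !size_nseq => h1 h0 h2.
have {h0 h1 h2} h1 : size V = (size U).+1 by lia.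
have eU : U = [::] by case: pure h1 => // ->.
case: V h1 e {pure} => [|k [|? ?]] // ; rewrite eU //= => _ e.
suff -> : i = k by [].
(* At most n letters can be popped by [S2 ++ D]; of the n + 1 copies of [k] pushed before, one
   remains. *)
pose n := size (S2 ++ D).
have := etrans (h n.+2) (mval_wpow_neg _ _).
rewrite eS wpow_rotS; pose m := n.+1; rewrite -/m.
have -> : C ++ (S1 ++ wpow (S2 ++ S1) m ++ S2) ++ D =
    (C ++ S1) ++ wpow (S2 ++ S1) m ++ (S2 ++ D) by rewrite -!catA.
rewrite mval_cat foldl_cat; case: (mval R (C ++ S1)) => [[U1 V1]|]; last first.
  by rewrite !foldl_mstep_None.
rewrite (foldl_mval _ _ (wpow _ m)) (wpow_negative _ e) wpow_letter.
rewrite /nword /= foldl_inl revK.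
move/foldl_stack_mem => /(_ k).
rewrite -[k :: nseq n k]/(nseq n.+1 k) -[i :: _]/(nseq (n.+2 + c) i).
rewrite drop_cat size_nseq leqnn drop_nseq subSnn inE eqxx => /(_ isT).
by rewrite mem_nseq => /andP[_ /eqP].
Qed.

End Multiplier.

Lemma multiplier_rotation (I J : eqType) (R : I -> J -> bool) x S C D c :
  (forall N, mval R (C ++ wpow S N ++ D) = mval R (wpow [:: x] (N + c))) ->
  exists S1 S2, S = S1 ++ S2 /\ mval R (S2 ++ S1) = mval R [:: x].
Proof.
case: x => [i|j] h; first exact: multiplier_rotation_neg h.
have [|S1 [S2 [eS e]]] := @multiplier_rotation_neg J I (fun j i => R i j) j
    (dualw S) (dualw D) (dualw C) c.
  move=> N; rewrite -dualw_wpow -!dualw_cat -catA.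
  have -> : wpow [:: inl j] (N + c) = dualw (wpow [:: inr j : I + J] (N + c)).
    by rewrite dualw_wpow.
  exact/mval_dual_eq.
exists (dualw S2), (dualw S1); rewrite -dualw_cat -eS dualwK; split=> //.
by apply/mval_dual_eq; rewrite -dualw_cat dualwK.
Qed.

(** * Periodic words of a given multiplier *)

(* An edge of kind [inl l] joins p_(l-1) and p_l; an edge of kind [inr i] joins
   p_(tneg i) and p_0, where [i] is its class. *)
Record chain := Chain {
  clen : nat;
  cneg : finType;
  cpos : finType;
  lneg : finType;
  lpos : finType;
  tneg : lneg -> nat;
  tpos : lpos -> nat;
  crel : lneg -> lpos -> bool;
  kneg : cneg -> nat + lneg;
  kpos : cpos -> nat + lpos
}.

Arguments crel : clear implicits.
Arguments tneg {c}.
Arguments tpos {c}.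
Arguments kneg {c}.
Arguments kpos {c}.

Definition half_chain_ok (K : nat) (E L : finType) (t : L -> nat)
    (k : E -> nat + L) :=
  [/\ forall i, 0 < t i <= K, forall e l, k e = inl l -> 0 < l <= K,
      forall l, 0 < l <= K -> exists e, k e = inl l,
      forall i, exists e, k e = inr i &
      forall l, 0 < l <= K -> exists i, t i = l].

Definition chain_ok (C : chain) :=
  [/\ 0 < clen C, half_chain_ok (clen C) (@tneg C) (@kneg C),
      half_chain_ok (clen C) (@tpos C) (@kpos C),
      forall i j, crel C i j -> tneg i = tpos j &
      reduced_relation (crel C)].

Definition dual_chain (C : chain) :=
  @Chain (clen C) (cpos C) (cneg C) (lpos C) (lneg C) tpos tneg
    (fun j i => crel C i j) kpos kneg.

Lemma dual_chain_ok C : chain_ok C -> chain_ok (dual_chain C).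
Proof. by case=> ? ? ? h /reduced_relation_dual ?; split=> // i j /h. Qed.

Section ChainPaths.
Variable C : chain.

Definition cedge := (cneg C + cpos C)%type.

Definition ksrc (T : Type) (t : T -> nat) (k : nat + T) :=
  match k with inl l => l.-1 | inr i => t i end.

Definition ktgt (T : Type) (k : nat + T) := if k is inl l then l else 0.

Definition csrc (a : cedge) : nat :=
  match a with inl e => ksrc tneg (kneg e) | inr e => ktgt (kpos e) end.

Definition ctgt (a : cedge) : nat :=
  match a with inl e => ktgt (kneg e) | inr e => ksrc tpos (kpos e) end.

Definition cletter (a : cedge) : option (lneg C + lpos C) :=
  match a with
  | inl e => if kneg e is inr i then Some (inl i) else None
  | inr e => if kpos e is inr j then Some (inr j) else None
  end.

Fixpoint conn (u : nat) (w : seq cedge) (v : nat) : bool :=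
  if w is a :: w' then (csrc a == u) && conn (ctgt a) w' v else u == v.

Definition cval (w : seq cedge) := mval (crel C) (pmap cletter w).

Lemma conn_cat u w1 w2 v :
  conn u (w1 ++ w2) v <-> exists2 z, conn u w1 z & conn z w2 v.
Proof.
elim: w1 u => [|a w1 IH] u /=.
  by split=> [h|[z /eqP->]] //; exists u.
split=> [/andP[-> /IH]|[z /andP[-> h1] h2]] //.
by apply/IH; exists z.
Qed.

Lemma conn_rcons u w a v :
  conn u (rcons w a) v = conn u w (csrc a) && (ctgt a == v).
Proof.
elim: w u => [|b w IH] u /=; first by rewrite eq_sym.
by rewrite IH andbA.
Qed.

Lemma cval_cat u v : cval (u ++ v) = foldl (mstep (crel C)) (cval u) (pmap cletter v).
Proof. by rewrite /cval pmap_cat mval_cat. Qed.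

Lemma cval_congr u u' v v' :
  cval u = cval u' -> cval v = cval v' -> cval (u ++ v) = cval (u' ++ v').
Proof. by rewrite /cval !pmap_cat; exact: mval_congr. Qed.

Lemma cval_rcons u a : cval (rcons u a) =
  if cletter a is Some x then mstep (crel C) (cval u) x else cval u.
Proof. by rewrite -cats1 cval_cat /=; case: (cletter a). Qed.

Lemma cval_infix a b c : cval (a ++ b ++ c) <> None -> cval b <> None.
Proof. by rewrite /cval !pmap_cat => /mval_infix. Qed.

Lemma cval_catl0 u v : cval u = cval [::] -> cval (u ++ v) = cval v.
Proof. by move=> h; rewrite (cval_congr h (erefl (cval v))). Qed.

Lemma cval_catr0 u v : cval v = cval [::] -> cval (u ++ v) = cval u.
Proof. by move=> h; rewrite (cval_congr (erefl (cval u)) h) cats0. Qed.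

Lemma cval_height w U V : cval w = Some (U, V) ->
  size V + count (fun x => ~~ is_inl x) (pmap cletter w) =
  size U + count is_inl (pmap cletter w).
Proof. exact: mval_height. Qed.

Definition closed_word (u : seq cedge) := cycle (fun a b => ctgt a == csrc b) u.

Lemma path_conn a w b :
  path (fun a b => ctgt a == csrc b) a (rcons w b) = conn (ctgt a) w (csrc b).
Proof.
elim: w a => [|c w IH] a /=; first by rewrite andbT.
by rewrite IH eq_sym.
Qed.

Lemma closed_word_cons a w : closed_word (a :: w) = conn (ctgt a) w (csrc a).
Proof. by rewrite /closed_word /= path_conn. Qed.

(** The value of a period depends on where it is cut, hence the quantification over rotations. The
    definition is boolean because such words are counted. *)
Definition has_multiplier (x : lneg C + lpos C) (u : seq cedge) :=
  closed_word u &&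
  has (fun t => cval (rot t u) == mval (crel C) [:: x]) (iota 0 (size u)).

Lemma has_multiplierP x u : reflect
  (closed_word u /\ exists u1 u2, u = u1 ++ u2 /\
     cval (u2 ++ u1) = mval (crel C) [:: x]) (has_multiplier x u).
Proof.
apply: (iffP andP) => -[cu]; last first.
  case=> u1 [u2 [eu h]]; split=> //; apply/hasP.
  case: u2 eu h => [|a u2] eu h.
    exists 0; last by rewrite rot0 eu cats0; apply/eqP.
    rewrite mem_iota /= lt0n size_eq0; apply/eqP => u0.
    by move: h; rewrite u0 in eu; case: u1 eu => //; case: x.
  exists (size u1); last by rewrite eu rot_size_cat; apply/eqP.
  by rewrite mem_iota eu size_cat /=; lia.
case/hasP => t; rewrite mem_iota => /andP[_ lt] /eqP h; split=> //.
by exists (take t u), (drop t u); rewrite cat_take_drop -h.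
Qed.

Definition periodic_words x m : {set m.-tuple cedge} :=
  [set u : m.-tuple cedge | has_multiplier x u].

(* Every periodic word with multiplier [i] has exactly one marked rotation: the
   one starting at the edge of class [i] that is never cancelled. *)
Definition marked_word (i : lneg C) (u : seq cedge) :=
  if u is a :: w then
    [&& cletter a == Some (inl i), closed_word u & cval w == cval [::]]
  else false.

(** The edge sought is the push of [i] that is never cancelled. The induction is on length because a
    final edge that cancels an earlier push makes the search skip the whole block between them. *)
Lemma cval_last_push i V w : cval w = Some ([::], i :: V) ->
  exists w1 a w2, [/\ w = w1 ++ a :: w2, cval w1 = Some ([::], V),
    cletter a = Some (inl i) & cval w2 = cval [::]].
Proof.
have [n] := ubnP (size w); elim: n w i V => // n IH w i V.
case/lastP: w => [|w a]; first by [].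
rewrite size_rcons ltnS cval_rcons => lt.
case ea: (cletter a) => [[i'|j]|].
- case ew: (cval w) => [[U0 V0]|] //= -[eU ei eV].
  by exists w, a, [::]; rewrite -cats1 ew eU eV ea ei.
- case ew: (cval w) => [[U0 V0]|] //=.
  case: V0 ew => [|i0 V0] ew; first by case: (U0).
  case R0: (crel C i0 j) => // -[eU eV]; rewrite {}eU {}eV in ew.
  (* The first use finds the push [a1] that the last edge cancels, the second the surviving push of
     [i] before it. *)
  have [w1 [a1 [w2 [e1 e2 e3 e4]]]] := IH _ _ _ lt ew.
  have lt1 : size w1 < n by move: lt; rewrite e1 size_cat /=; lia.
  have [w3 [a3 [w4 [e5 e6 e7 e8]]]] := IH _ _ _ lt1 e2.
  exists w3, a3, (w4 ++ a1 :: rcons w2 a).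
  rewrite e1 e5 rcons_cat -catA; split=> //.
  have e9 : mval (crel C) (pmap cletter w2 ++ [:: inr j]) =
    mval (crel C) [:: inr j] := neutral_catl _ e4.
  rewrite cval_catl0 // /cval /= e3 -cats1 pmap_cat /= ea.
  by rewrite -cat1s (mval_catl _ e9) /mval /= R0.
- move=> ew; have [w1 [a1 [w2 [e1 e2 e3 e4]]]] := IH _ _ _ lt ew.
  exists w1, a1, (rcons w2 a); rewrite e1 rcons_cat; split=> //.
  by rewrite cval_rcons ea.
Qed.

Lemma closed_word_cat u v : closed_word (u ++ v) -> closed_word (v ++ u).
Proof. by rewrite -rot_size_cat /closed_word rot_cycle. Qed.

(** In the rotation of value [i] the words before and after the surviving push are both neutral, so
    rotating to that push leaves a neutral remainder. *)
Lemma marked_rotation i u : has_multiplier (inl i) u ->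
  exists t : 'I_(size u), marked_word i (rot t u).
Proof.
case/has_multiplierP => cu [u1 [u2 [eu h]]].
have [w1 [a [w2 [e e1 e2 e3]]]] := @cval_last_push i [::] _ h.
have hm : marked_word i (a :: w2 ++ w1).
  apply/and3P; split; first exact/eqP; last by rewrite cval_catl0 // e1.
  apply: (@closed_word_cat w1 (a :: w2)); rewrite -e.
  by apply: closed_word_cat; rewrite -eu.
have su : size u = (size (w2 ++ w1)).+1.
  have := congr1 size e; rewrite eu !size_cat /= ; lia.
suff [t lt ht] : exists2 t, t < size u & rot t u = a :: w2 ++ w1.
  by exists (Ordinal lt); rewrite /= ht.
have : a :: w2 ++ w1 = rot (size w1) (rot (size u1) u).
  by rewrite eu rot_size_cat e rot_size_cat.
have le1 : size w1 <= size u by rewrite su size_cat; lia.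
have le2 : size u1 <= size u by rewrite eu size_cat; lia.
rewrite rot_add_mod // => ->.
(* The sum of the two rotations may be [size u] itself, which is outside ['I_(size u)] and is
   replaced by 0. *)
set t := if _ then _ else _; have le : t <= size u by rewrite /t; case: ifP; lia.
case: (ltngtP t (size u)) le => // [lt _|et _]; first by exists t.
by exists 0; rewrite ?su // et rot0 rot_size.
Qed.

(* Otherwise the height (negative minus positive letters) of a neutral word would
   be at least 1. *)
Lemma marked_rotation_uniq i u t : 0 < t < size u ->
  marked_word i u -> ~~ marked_word i (rot t u).
Proof.
case: u t => [|a w] [|t] //= lt.
have et : drop t w = nth a w t :: drop t.+1 w by rewrite (drop_nth a).
rewrite /rot /= et; set b := nth a w t; set w2 := drop _ _; set w1 := take _ _.
case/and3P=> /eqP ea _ /eqP h; apply/negP => /and3P[/eqP eb _ /eqP h'].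
have ew : w = w1 ++ b :: w2 by rewrite -(cat_take_drop t w) et.
(* A prefix of a neutral word emits no positive letter, so its height is nonnegative; this is used
   for [w1] and for [w2]. *)
have push v x y : cval (v ++ x :: y) = cval [::] ->
    count is_inl (pmap cletter v) >= count (fun x => ~~ is_inl x) (pmap cletter v).
  rewrite cval_cat; case e: (cval v) => [[U V]|]; last first.
    by rewrite foldl_mstep_None.
  move/foldl_no_positive => eU; have := cval_height e; rewrite eU /=; lia.
rewrite ew in h; have p1 := push _ _ _ h.
have p2 := push _ _ _ h'.
have := cval_height h; rewrite !pmap_cat /= eb /= !count_cat /=; lia.
Qed.
End ChainPaths.

Section PeriodicCount.
Variable C : chain.

Lemma marked_word_multiplier (i : lneg C) u t :
  marked_word i (rot t u) -> has_multiplier (inl i) u.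
Proof.
move=> h; apply/has_multiplierP; move: h; rewrite /rot.
case e: (drop t u ++ take t u) => [|a w]; first by [].
case/and3P=> /eqP ea cw /eqP h; split.
  by rewrite -(cat_take_drop t u); apply: closed_word_cat; rewrite e.
exists (take t u), (drop t u); rewrite cat_take_drop e; split=> //.
by rewrite /cval /= ea; apply: (@mval_catl _ _ _ [:: inl i] _ [::] h).
Qed.

(** Double counting of pairs of a word and a rotation marking it: a periodic word has exactly one
    such rotation, and each of the m rotations permutes the words. *)
Lemma card_periodic_marked (i : lneg C) m :
  #|periodic_words (inl i) m| =
  m * #|[set u : m.-tuple (cedge C) | marked_word i u]|.
Proof.
have -> : #|periodic_words (inl i) m| =
    \sum_(u : m.-tuple (cedge C)) \sum_(t < m) marked_word i (rot t u).
  rewrite -sum1_card big_mkcond /=; apply: eq_bigr => u _; rewrite inE.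
  case: ifPn => hu; last first.
    rewrite big1 // => t _; case e: (marked_word _ _) => //.
    by rewrite (marked_word_multiplier e) in hu.
  have [t0 ht0] := marked_rotation hu; rewrite size_tuple in t0 ht0.
  rewrite (bigD1 t0) //= ht0 big1 ?addn0 // => t nt; apply/eqP; rewrite eqb0.
  have no (t1 t2 : 'I_m) : t1 < t2 -> marked_word i (rot t1 u) ->
      ~~ marked_word i (rot t2 u).
    move=> lt; have -> : rot t2 u = rot (t2 - t1) (rot t1 u).
      by rewrite -rotD ?size_tuple subnK // ltnW.
    apply: marked_rotation_uniq; rewrite size_rot size_tuple subn_gt0 lt /=.
    exact: leq_ltn_trans (leq_subr _ _) (ltn_ord t2).
  have [lt|lt|/val_inj e] := ltngtP t t0; last 1 first.
  - by rewrite e eqxx in nt.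
  - by apply/negP => /(no _ _ lt); rewrite ht0.
  - exact: no ht0.
rewrite exchange_big /= -[X in _ = X * _]card_ord -sum_nat_const.
apply: eq_bigr => t _; rewrite -sum1_card [RHS]big_mkcond /=.
rewrite [RHS](reindex_inj (h := fun u : m.-tuple (cedge C) => [tuple of rot t u])) /=.
  by apply: eq_bigr => u _; rewrite inE; case: ifP.
by move=> u v /(congr1 val) /rot_inj /val_inj.
Qed.
End PeriodicCount.

(** * Counting walks by their last edge *)

Section WordSums.
Variable A : finType.

(** Nested sums, so that a letter can be split off at either end of the word. *)
Fixpoint wsum (m : nat) (F : seq A -> nat) : nat :=
  if m is m'.+1 then \sum_(a : A) wsum m' (fun w => F (a :: w)) else F [::].

Lemma eq_wsum m F G : (forall w, size w = m -> F w = G w) -> wsum m F = wsum m G.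
Proof.
elim: m F G => [|m IH] F G h /=; first exact: h.
by apply: eq_bigr => a _; apply: IH => w sw; apply: h; rewrite /= sw.
Qed.

Lemma wsum_rcons m F : wsum m.+1 F = \sum_(a : A) wsum m (fun w => F (rcons w a)).
Proof.
elim: m F => [|m IH] F //.
rewrite -[LHS]/(\sum_(a : A) wsum m.+1 (fun w => F (a :: w))).
under eq_bigr => a _ do rewrite IH.
by rewrite exchange_big.
Qed.

Lemma wsum_mull m c F : wsum m (fun w => c * F w) = c * wsum m F.
Proof.
elim: m F => [|m IH] F //=; rewrite big_distrr.
by apply: eq_bigr => a _; rewrite IH.
Qed.

Lemma wsum_sum (T : finType) m (F : T -> seq A -> nat) :
  wsum m (fun w => \sum_(i : T) F i w) = \sum_(i : T) wsum m (F i).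
Proof.
elim: m F => [|m IH] F //=; rewrite exchange_big.
by apply: eq_bigr => a _; rewrite IH.
Qed.

Lemma wsum0 m F : (forall w, size w = m -> F w = 0) -> wsum m F = 0.
Proof.
move=> h; rewrite (@eq_wsum _ _ (fun w => 0 * F w)); first by rewrite wsum_mull.
by move=> w /h ->.
Qed.

Lemma card_tuple_wsum m (P : seq A -> bool) :
  #|[set u : m.-tuple A | P u]| = wsum m P.
Proof.
rewrite -sum1_card big_mkcond /=.
under eq_bigr => u _ do rewrite inE -[if _ then _ else _]/(nat_of_bool (P u)).
elim: m P => [|m IH] P /=.
  rewrite (bigD1 [tuple]) //= big1 ?addn0 // => u.
  by case/eqP; exact: tuple0.
under [RHS]eq_bigr => a _ do rewrite -IH.
rewrite pair_big /=.
rewrite (reindex (fun p : A * m.-tuple A => [tuple of p.1 :: p.2])) //=.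
exists (fun u => (thead u, [tuple of behead u])) => [[a u] _|u _] /=.
  by rewrite theadE; congr pair; apply: val_inj.
by rewrite [RHS]tuple_eta.
Qed.
End WordSums.

Section WalkCount.
Variable C : chain.
Hypothesis okC : chain_ok C.

Definition num_neg l := #|[set e : cneg C | kneg e == inl l]|.
Definition num_pos l := #|[set e : cpos C | kpos e == inl l]|.
Definition num_nclass i := #|[set e : cneg C | kneg e == inr i]|.
Definition num_pclass j := #|[set e : cpos C | kpos e == inr j]|.

(** Periodic words involve only the empty stack; other stacks appear because undoing a final
    cancellation restores a letter. *)
Definition walks m k V :=
  wsum m (fun w : seq (cedge C) => conn 0 w k && (cval w == Some ([::], V))).

(** A marked word is an edge of class [i] followed by a neutral walk from p_0 back to the source of
    that edge. *)
Lemma card_periodic_neg i m :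
  #|periodic_words (inl i : lneg C + lpos C) m.+1| =
  m.+1 * (num_nclass i * walks m (tneg i) [::]).
Proof.
rewrite card_periodic_marked card_tuple_wsum; congr (_ * _).
rewrite /= big_sumType /= [X in _ + X]big1 ?addn0; last first.
  move=> e _; apply: wsum0 => w _.
  by case: (kpos e).
rewrite /num_nclass -sum1_card big_distrl /= [RHS]big_mkcond /=.
apply: eq_bigr => e _; rewrite inE mul1n.
case: (kneg e =P inr i) => ek; last first.
  apply: wsum0 => w _; rewrite /marked_word /=.
  by case: (kneg e) ek => //= k nk; case: eqP => // -[ki]; rewrite ki in nk.
by apply: eq_wsum => w _; rewrite path_conn /= ek /= eqxx.
Qed.

Lemma sum_indicator (T : finType) (P : pred T) c :
  \sum_(t : T) P t * c = #|[set t | P t]| * c.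
Proof.
rewrite -sum1_card big_distrl /= [RHS]big_mkcond /=.
by apply: eq_bigr => t _; rewrite inE; case: (P t); rewrite ?mul1n.
Qed.

Lemma neg_step e m k V :
  wsum m (fun w => conn 0 (rcons w (inl e)) k &&
                   (cval (rcons w (inl e)) == Some ([::], V))) =
  match kneg e with
  | inl l => (l == k) * walks m l.-1 V
  | inr i => if V is i' :: V' then (k == 0) * ((i == i') * walks m (tneg i) V')
             else 0
  end.
Proof.
rewrite (@eq_wsum _ _ _ (fun w => (ktgt (kneg e) == k) *
  (conn 0 w (ksrc tneg (kneg e)) && (cval (rcons w (inl e)) == Some ([::], V))))).
  rewrite wsum_mull; case ek: (kneg e) => [l|i] /=.
    by congr (_ * _); apply: eq_wsum => w _; rewrite cval_rcons /= ek.
  case: V => [|i' V].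
    rewrite wsum0 ?muln0 // => w _; rewrite cval_rcons /= ek.
    by case: (cval w) => [[U W]|] /=; case: eqP => //; rewrite ?andbF // => -[].
  rewrite eq_sym; congr (_ * _).
  rewrite -wsum_mull; apply: eq_wsum => w _; rewrite cval_rcons /= ek.
  case: (cval w) => [[U W]|] /=; last by rewrite andbF muln0.
  have -> : (Some (U, i :: W) == Some ([::], i' :: V)) =
      (i == i') && (Some (U, W) == Some ([::], V)).
    apply/eqP/andP => [[-> -> ->]|[/eqP-> /eqP[-> ->]]] //.
  by case: (i == i'); rewrite ?andbF ?mul1n.
by move=> w _; rewrite conn_rcons mulnb /= andbAC andbC andbA.
Qed.

(** A final positive edge of class [j] leaves p_0 and pops some [i] related to [j], hence the sum
    over the possible tops of the previous stack. *)
Lemma pos_step e m k V :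
  wsum m (fun w => conn 0 (rcons w (inr e)) k &&
                   (cval (rcons w (inr e)) == Some ([::], V))) =
  match kpos e with
  | inl l => (l == k.+1) * walks m l V
  | inr j => \sum_(i : lneg C | crel C i j) (tneg i == k) * walks m 0 (i :: V)
  end.
Proof.
have [_ _ [_ hp _ _ _] hR _] := okC.
rewrite (@eq_wsum _ _ _ (fun w => (ksrc tpos (kpos e) == k) *
  (conn 0 w (ktgt (kpos e)) && (cval (rcons w (inr e)) == Some ([::], V))))); last first.
  by move=> w _; rewrite conn_rcons mulnb /= andbAC andbC andbA.
rewrite wsum_mull; case ek: (kpos e) => [l|j] /=.
  (* Positivity of l matters: the truncated predecessor of 0 would also match k = 0. *)
  have -> : (l.-1 == k) = (l == k.+1) by have := hp _ _ ek; lia.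
  by congr (_ * _); apply: eq_wsum => w _; rewrite cval_rcons /= ek.
rewrite (eq_bigr (fun i => (tpos j == k) * walks m 0 (i :: V))); last first.
  by move=> i /hR ->.
rewrite -big_distrr; congr (_ * _).
rewrite [RHS]big_mkcond /= (eq_bigr (fun i : lneg C => wsum m (fun w =>
  crel C i j * (conn 0 w 0 && (cval w == Some ([::], i :: V)))))); last first.
  by move=> i _; rewrite wsum_mull; case: (crel C i j); rewrite ?mul1n.
rewrite -wsum_sum; apply: eq_wsum => w _; rewrite cval_rcons /= ek.
case: (conn 0 w 0) => /=; last by rewrite big1 // => i _; rewrite muln0.
case: (cval w) => [[U [|i W]]|] /=; last 1 first.
- by rewrite big1 // => i _; rewrite muln0.
- rewrite big1 => [|i _]; last by case: eqP; rewrite ?muln0.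
  by case: eqP => // -[]; case: (U).
- rewrite (bigD1 i) //= big1 ?addn0 => [|i' ni].
    case: (crel C i j) => //=; rewrite mul1n; apply: congr1.
    by apply/eqP/eqP => [[-> ->]|[-> ->]].
  by case: eqP => [[_ ei _]|]; [rewrite ei eqxx in ni | rewrite muln0].
Qed.

(** The terms correspond to the last edge: a negative link, a negative edge to p_0, a positive link,
    a positive edge from p_0. *)
Lemma walksS m k V : walks m.+1 k V =
  num_neg k * walks m k.-1 V +
  (if V is i :: V' then num_nclass i * ((k == 0) * walks m (tneg i) V') else 0) +
  num_pos k.+1 * walks m k.+1 V +
  \sum_(i : lneg C | tneg i == k)
    (\sum_(j : lpos C | crel C i j) num_pclass j) * walks m 0 (i :: V).
Proof.
rewrite {1}/walks wsum_rcons big_sumType /= -addnA; congr (_ + _).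
  under eq_bigr => e _ do rewrite neg_step.
  rewrite -sum_indicator.
  case: V => [|i V].
    rewrite addn0; apply: eq_bigr => e _; case: (kneg e) => [l|i] //=.
    by rewrite (inj_eq (@inl_inj _ _)); case: eqP => [->|].
  rewrite -sum_indicator -big_split /=; apply: eq_bigr => e _.
  case: (kneg e) => [l|i'] /=; rewrite (inj_eq (@inl_inj _ _), inj_eq (@inr_inj _ _)).
    by rewrite addn0; case: eqP => [->|].
  by rewrite add0n; case: (i' =P i) => [->|_]; rewrite ?mul1n ?muln0.
under eq_bigr => e _ do rewrite pos_step.
rewrite -sum_indicator.
have -> : \sum_(i : lneg C | tneg i == k)
      (\sum_(j : lpos C | crel C i j) num_pclass j) * walks m 0 (i :: V) =
    \sum_(e : cpos C) \sum_(i : lneg C | tneg i == k)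
      \sum_(j : lpos C | crel C i j) (kpos e == inr j) * walks m 0 (i :: V).
  rewrite exchange_big; apply: eq_bigr => i _; rewrite exchange_big big_distrl.
  by apply: eq_bigr => j _; rewrite sum_indicator.
rewrite -big_split; apply: eq_bigr => e _ /=.
case: (kpos e) => [l|j].
  rewrite (inj_eq (@inl_inj _ _)) [X in _ + X]big1 ?addn0.
    by case: eqP => [->|].
  by move=> i _; rewrite big1.
rewrite add0n [LHS]big_mkcond [RHS]big_mkcond; apply: eq_bigr => i _ /=.
case: (tneg i == k); last by case: ifP; rewrite ?mul0n.
case: ifP => Rij; last first.
  rewrite big1 // => j' Rij'; rewrite (inj_eq (@inr_inj _ _)).
  by case: eqP => // ej; rewrite -ej Rij in Rij'.
rewrite (bigD1 j) //= eqxx big1 ?addn0 // => j' /andP[_ nj].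
by rewrite (inj_eq (@inr_inj _ _)) eq_sym (negPf nj).
Qed.

(** The length of the shortest walk: each letter left on the stack costs [tneg i] links and one edge
    to p_0, and k more links lead to p_k. *)
Definition depth k (V : seq (lneg C)) := k + \sum_(i <- V) (tneg i).+1.

Lemma depth_cons k i V : depth k (i :: V) = (depth k V + tneg i).+1.
Proof. rewrite /depth big_cons; lia. Qed.

Lemma num_neg0 : num_neg 0 = 0.
Proof.
have [_ [_ h _ _ _] _ _ _] := okC.
by apply: eq_card0 => e; rewrite inE; apply/eqP => /h.
Qed.

Lemma num_negS : num_neg (clen C).+1 = 0.
Proof.
have [_ [_ h _ _ _] _ _ _] := okC.
by apply: eq_card0 => e; rewrite inE; apply/eqP => /h; rewrite ltnn.
Qed.

Lemma walks_small m k V : m < depth k V -> walks m k V = 0.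
Proof.
elim: m k V => [|m IH] k V.
  rewrite /walks /=; case: k => [|k] //; case: V => [|i V] //.
  by rewrite /depth big_nil.
move=> lt; rewrite walksS (IH k.+1) ?muln0; last by move: lt; rewrite /depth; lia.
rewrite big1 ?addn0 => [|i /eqP ti]; last first.
  by rewrite (IH 0) ?muln0 // depth_cons ti; move: lt; rewrite /depth; lia.
have -> : num_neg k * walks m k.-1 V = 0.
  case: k lt => [|k] lt; first by rewrite num_neg0.
  by rewrite IH ?muln0.
case: V lt => // i V lt; case: eqP => [k0|_] /=; rewrite ?muln0 //.
by rewrite (IH (tneg i)) ?muln0 //; move: lt; rewrite k0 depth_cons /depth; lia.
Qed.

Definition neg_paths k := \prod_(1 <= l < k.+1) num_neg l.

(** The cardinality of R(p_k, p_0), which is the sum in the first gcd of (D). *)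
Definition related_pairs k :=
  \sum_(i : lneg C | tneg i == k)
    num_nclass i * \sum_(j : lpos C | crel C i j) num_pclass j.

(* The number of cancelling pairs of edges that can be inserted at p_k. *)
Definition detours k := num_neg k.+1 * num_pos k.+1 + related_pairs k.

Definition total_detours k := \sum_(0 <= l < k.+1) detours l.

Lemma neg_pathsS k : neg_paths k.+1 = neg_paths k * num_neg k.+1.
Proof. by rewrite /neg_paths big_nat_recr. Qed.

Lemma neg_paths0 : neg_paths 0 = 1.
Proof. by rewrite /neg_paths big_geq. Qed.

Lemma related_pairs0 : related_pairs 0 = 0.
Proof.
have [_ [h _ _ _ _] _ _ _] := okC.
by apply: big1 => i /eqP t0; have := h i; rewrite t0.
Qed.

Lemma walks_direct k : walks k k [::] = neg_paths k.
Proof.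
elim: k => [|k IH]; first by rewrite neg_paths0.
rewrite walksS /= IH (walks_small (k := k.+2)) ?muln0 ?addn0; last first.
  by rewrite /depth big_nil; lia.
rewrite big1 ?addn0 => [|i /eqP ti]; first by rewrite neg_pathsS mulnC.
by rewrite walks_small ?muln0 // depth_cons /depth big_nil; lia.
Qed.

Lemma walks_letter i :
  walks (tneg i).+1 0 [:: i] = num_nclass i * neg_paths (tneg i).
Proof.
have [_ [ht _ _ _ _] _ _ _] := okC.
rewrite walksS num_neg0 eqxx mul1n add0n walks_direct.
rewrite (walks_small (k := 1)) ?muln0 ?addn0; last first.
  by rewrite /depth big_cons big_nil; lia.
by rewrite big1 ?addn0 // => i' /eqP t0; have := ht i'; rewrite t0.
Qed.

(** With two steps to spare, the shortest walk carries exactly one cancelling pair, inserted at one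
    of p_0, ..., p_k. *)
Lemma walks_detour k : walks k.+2 k [::] = neg_paths k * total_detours k.
Proof.
have [_ [ht _ _ _ _] _ _ _] := okC.
elim: k => [|k IH].
  rewrite walksS num_neg0 walks_direct big1; last first.
    by move=> i /eqP t0; have := ht i; rewrite t0.
  rewrite neg_pathsS neg_paths0 /total_detours big_nat1 /detours related_pairs0.
  lia.
rewrite walksS /= IH walks_direct.
have -> : \sum_(i : lneg C | tneg i == k.+1)
     (\sum_(j : lpos C | crel C i j) num_pclass j) * walks k.+2 0 [:: i] =
   neg_paths k.+1 * related_pairs k.+1.
  rewrite /related_pairs big_distrr; apply: eq_bigr => i /eqP ti /=.
  by rewrite -ti walks_letter; lia.
rewrite /total_detours [in RHS]big_nat_recr //= /detours !neg_pathsS.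
nia.
Qed.

(** The extra pair is inserted either before the surviving letter is pushed or after it, at p_0,
    where it must be a pair of links to p_1 and back. *)
Lemma walks_letter_detour i : walks (tneg i).+3 0 [:: i] =
  num_nclass i * neg_paths (tneg i) *
    (total_detours (tneg i) + num_neg 1 * num_pos 1).
Proof.
have [_ [ht _ _ _ _] _ _ _] := okC.
rewrite walksS num_neg0 eqxx mul1n add0n walks_detour.
rewrite [X in _ + X]big1 ?addn0; last first.
  by move=> i' /eqP t0; have := ht i'; rewrite t0.
have -> : walks (tneg i).+2 1 [:: i] = num_neg 1 * walks (tneg i).+1 0 [:: i].
  rewrite walksS /= (walks_small (k := 2)); last first.
    by rewrite /depth big_cons big_nil; lia.
  rewrite big1 => [|i' /eqP ti']; first by lia.
  by rewrite walks_small ?muln0 // !depth_cons /depth big_nil; lia.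
rewrite walks_letter; nia.
Qed.

(** The shortest walk to p_1 is one link, so four steps are two extra pairs. This count supplies the
    equation that stands in for the unobservable sum at l = 0. *)
Lemma walks_two_detours : walks 5 1 [::] =
  num_neg 1 * (num_neg 1 * num_pos 1 * total_detours 1 +
    num_neg 2 * num_pos 2 * total_detours 2 +
    related_pairs 1 * (total_detours 1 + num_neg 1 * num_pos 1)).
Proof.
have [_ [ht _ _ _ _] _ _ _] := okC.
rewrite walksS /= walks_detour.
have -> : walks 4 0 [::] = num_pos 1 * walks 3 1 [::].
  rewrite walksS num_neg0 /= big1; first by lia.
  by move=> i' /eqP t0; have := ht i'; rewrite t0.
rewrite walks_detour.
have -> : \sum_(i : lneg C | tneg i == 1)
     (\sum_(j : lpos C | crel C i j) num_pclass j) * walks 4 0 [:: i] =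
   neg_paths 1 * related_pairs 1 * (total_detours 1 + num_neg 1 * num_pos 1).
  rewrite /related_pairs big_distrr big_distrl; apply: eq_bigr => i /eqP ti /=.
  have := walks_letter_detour i; rewrite ti => ->; nia.
rewrite !neg_pathsS neg_paths0; nia.
Qed.

End WalkCount.

Section DualChain.
Variable C : chain.

Lemma cletter_swap (a : cedge C) :
  @cletter (dual_chain C) (swap a) = omap (@swap _ _) (cletter a).
Proof. by case: a => e /=; [case: (kneg e) | case: (kpos e)]. Qed.

Lemma pmap_cletter_dual (u : seq (cedge C)) :
  pmap (@cletter (dual_chain C)) (dualw u) = dualw (pmap (@cletter C) u).
Proof.
elim: u => //= a u IH; rewrite -cat1s dualw_cat pmap_cat IH /=.
rewrite cletter_swap; case: (cletter a) => [x|] /=; last by rewrite cats0.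
by rewrite -[x :: _]cat1s dualw_cat.
Qed.

Lemma closed_word_dual (u : seq (cedge C)) :
  @closed_word (dual_chain C) (dualw u) = closed_word u.
Proof.
rewrite /closed_word /dualw -map_rev cycle_map -rev_cycle revK.
apply: eq_cycle => a b /=; rewrite eq_sym.
by case: a => a; case: b => b.
Qed.

Lemma cval_dual_letter j (u : seq (cedge C)) :
  @cval (dual_chain C) (dualw u) = mval (crel (dual_chain C)) [:: inl j] <->
  cval u = mval (crel C) [:: inr j].
Proof.
rewrite /cval pmap_cletter_dual.
exact: (mval_dual_eq (crel C) (pmap (@cletter C) u) [:: inr j]).
Qed.

Lemma has_multiplier_dual j (u : seq (cedge C)) :
  @has_multiplier (dual_chain C) (inl j) (dualw u) = has_multiplier (inr j) u.
Proof.
apply/has_multiplierP/has_multiplierP => -[cu [u1 [u2 [eu h]]]].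
  split; first by rewrite -closed_word_dual.
  exists (dualw u2), (dualw u1); rewrite -dualw_cat -eu dualwK; split=> //.
  by apply/cval_dual_letter; rewrite -dualw_cat dualwK.
split; first by rewrite closed_word_dual.
exists (dualw u2), (dualw u1); rewrite -!dualw_cat -eu; split=> //.
exact/cval_dual_letter.
Qed.

Lemma size_dualw (A B : Type) (u : seq (A + B)) : size (dualw u) = size u.
Proof. by rewrite /dualw size_rev size_map. Qed.

Lemma card_periodic_dual j m :
  #|periodic_words (inr j : lneg C + lpos C) m| =
  #|@periodic_words (dual_chain C) (inl j) m|.
Proof.
pose f (u : m.-tuple (cedge C)) : m.-tuple (cedge (dual_chain C)) :=
  [tuple of rev (map_tuple (@swap _ _) u)].
have fE u : f u = dualw u :> seq _ by [].
have injf : injective f.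
  by move=> u v /(congr1 val) /= h; apply/val_inj/(can_inj (@dualwK _ _))/h.
rewrite -(card_imset _ injf); congr #|pred_of_set _|; apply/setP => v.
apply/imsetP/idP => [[u]|].
  by rewrite !inE => h ->; rewrite -has_multiplier_dual in h.
rewrite inE => h; have sv : size (dualw v) == m by rewrite size_dualw size_tuple.
exists (Tuple sv); last by apply: val_inj; rewrite [RHS]fE /= dualwK.
by rewrite inE -has_multiplier_dual /= dualwK.
Qed.

End DualChain.

(** * Homoclinic points and block codes *)

Section Points.
Variables (T : Type) (x0 : T).

(* The bi-infinite sequence [a^oo w b^oo], with [w] starting at position 0. *)
Definition lpt (a w b : seq T) (i : int) : T :=
  match i with
  | Posz n => if n < size w then nth x0 w n
              else nth x0 b ((n - size w) %% size b)
  | Negz n => nth x0 (rev a) (n %% size a)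
  end.

Lemma size_block (x : int -> T) i n : size (block x i n) = n.
Proof. by rewrite size_map size_iota. Qed.

Lemma nth_block (x : int -> T) i n k : k < n ->
  nth x0 (block x i n) k = x (i + k%:Z)%R.
Proof. by move=> lt; rewrite (nth_map 0) ?size_iota // nth_iota. Qed.

Lemma block_cat (x : int -> T) i m n :
  block x i (m + n) = block x i m ++ block x (i + m%:Z)%R n.
Proof.
apply: (@eq_from_nth _ x0); first by rewrite size_cat !size_block.
move=> k; rewrite size_block => lt; rewrite nth_block // nth_cat size_block.
case: ltnP => le; rewrite nth_block //; last by lia.
by congr x; lia.
Qed.

Lemma eq_block (x y : int -> T) i j n :
  (forall k, k < n -> x (i + k%:Z)%R = y (j + k%:Z)%R) ->
  block x i n = block y j n.
Proof.
move=> h; apply/eq_in_map => k; rewrite mem_iota add0n => /andP[_]; exact: h.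
Qed.

Lemma lpt_prefix a p s s' b b' (i : int) : (i < (size p)%:Z)%R ->
  lpt a (p ++ s) b i = lpt a (p ++ s') b' i.
Proof.
case: i => n // lt /=; have {}lt : n < size p by lia.
by rewrite !size_cat !nth_cat lt !ltn_addr.
Qed.

Lemma lpt_suffix a a' p p' s b k :
  lpt a (p ++ s) b (size p + k)%:Z = lpt a' (p' ++ s) b (size p' + k)%:Z.
Proof.
rewrite /= !size_cat !ltn_add2l !nth_cat !subnDl.
by rewrite ![_ + k < _]ltnNge !leq_addr /= !addKn.
Qed.

Lemma lpt_wpow_right a w b h : 0 < size b -> lpt a (w ++ wpow b h) b =1 lpt a w b.
Proof.
move=> b0; elim: h => [|h IH] i; first by rewrite cats0.
rewrite -IH wpowSr catA; case: i => // n /=; rewrite size_cat nth_cat.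
have [lt|le] := ltnP n (size (w ++ wpow b h)); first by rewrite ltn_addr.
case: ltnP => lt; first by rewrite modn_small //; lia.
by rewrite subnDA -[in RHS](@subnK (size b) (n - _)) ?modnDr //; lia.
Qed.

Lemma lpt_wpow_left a w b h i : 0 < size a ->
  lpt a (wpow a h ++ w) b i = lpt a w b (i - (h * size a)%:Z)%R.
Proof.
move=> a0; elim: h i => [|h IH] i; first by rewrite GRing.subr0.
have -> : (i - (h.+1 * size a)%:Z = (i - (size a)%:Z) - (h * size a)%:Z)%R by lia.
rewrite -IH wpowS -catA; set w' := _ ++ w.
case: i => n.
  have [lt|le] := ltnP n (size a).
    have -> : (Posz n - (size a)%:Z)%R = Negz (size a - n.+1) by lia.
    rewrite /= size_cat ltn_addr // nth_cat lt modn_small ?nth_rev; try lia.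
    by congr nth; lia.
  have -> : (Posz n - (size a)%:Z)%R = Posz (n - size a) by lia.
  have nlt : (n < size a) = false by lia.
  by rewrite /= size_cat nth_cat nlt ltn_subLR // subnDA.
have -> : (Negz n - (size a)%:Z)%R = Negz (n + size a) by lia.
by rewrite /= modnDr.
Qed.

Lemma lpt_periodic (y : int -> T) p : 0 < p ->
  (forall i, y (i + p%:Z)%R = y i) ->
  y = lpt (block y 0 p) [::] (block y 0 p).
Proof.
move=> p0 per; have perk k i : y (i + (k * p)%:Z)%R = y i.
  elim: k i => [|k IH] i; first by congr y; lia.
  by rewrite -(IH i) -[in RHS]per; congr y; lia.
apply/funext => -[n|n] /=; rewrite size_block.
  rewrite nth_block ?ltn_pmod // subn0 [in LHS](divn_eq n p) -[in RHS](perk (n %/ p)).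
  by congr y; lia.
have lt := ltn_pmod n p0.
rewrite nth_rev ?size_block // nth_block; last by lia.
rewrite -[LHS](perk (n %/ p).+1); congr y.
have := divn_eq n p; move: lt; set r := n %% p; set k := n %/ p.
by rewrite mulSn; lia.
Qed.

Lemma block_lpt a w b N M : 0 < size a -> 0 < size b ->
  block (lpt a w b) (- (N * size a)%:Z)%R (N * size a + size w + M * size b) =
  wpow a N ++ w ++ wpow b M.
Proof.
move=> a0 b0; apply: (@eq_from_nth _ x0).
  by rewrite size_block !size_cat !size_wpow addnA.
move=> k; rewrite size_block => lt; rewrite nth_block // GRing.addrC.
rewrite -lpt_wpow_left // -(@lpt_wpow_right _ _ _ M) // -catA /=.
by rewrite !size_cat !size_wpow addnA lt.
Qed.

Lemma block_lpt_period a : block (lpt a [::] a) 0 (size a) = a.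
Proof.
apply: (@eq_from_nth _ x0); rewrite size_block // => k lt.
by rewrite nth_block // GRing.add0r /= subn0 modn_small.
Qed.

Lemma lpt_wpow_periodic a h : 0 < size a -> lpt a (wpow a h) a = lpt a [::] a.
Proof. by move=> a0; apply/funext => i; rewrite -(lpt_wpow_right _ [::] h). Qed.

End Points.

(** * Eventually periodic points of the shift *)

Section ChainShift.
Variable C : chain.
Variable x0 : cedge C.

Definition good (w : seq (cedge C)) := (exists u v, conn u w v) /\ cval w <> None.

Definition chain_shift (x : int -> cedge C) := forall i n, good (block x i n).

Lemma good_infix (a b c : seq (cedge C)) : good (a ++ b ++ c) -> good b.
Proof.
case=> -[u [v /conn_cat[z _ /conn_cat[z' h _]]]] /cval_infix nz.
by split=> //; exists z, z'.
Qed.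

Definition start (a : seq (cedge C)) := csrc (head x0 a).

Lemma conn_start u (a : seq (cedge C)) v : 0 < size a -> conn u a v -> u = start a.
Proof. by case: a => // b a _ /andP[/eqP]. Qed.

Lemma conn_end u (a : seq (cedge C)) v v' : conn u a v -> conn u a v' -> v = v'.
Proof.
elim: a u => [|b a IH] u /=; first by move=> /eqP-> /eqP.
by move=> /andP[_ h] /andP[_ h']; apply: IH h h'.
Qed.

Lemma conn_wpow u (a : seq (cedge C)) n : conn u a u -> conn u (wpow a n) u.
Proof.
move=> h; elim: n => [|n IH]; first exact: eqxx.
by rewrite wpowS; apply/conn_cat; exists u.
Qed.

Lemma chain_shift_lptP (a w b : seq (cedge C)) : 0 < size a -> 0 < size b ->
  chain_shift (lpt x0 a w b) <->
  [/\ conn (start a) a (start a), conn (start a) w (start b),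
      conn (start b) b (start b) &
      forall N, cval (wpow a N ++ w ++ wpow b N) <> None].
Proof.
move=> a0 b0; split=> [h|[ha hw hb hN] i n].
  have {}h N : good (wpow a N ++ w ++ wpow b N) by rewrite -(block_lpt x0).
  (* Two copies of each period are needed to see that it ends where it starts. *)
  have [[u [v hc]] _] := h 2; move: hc.
  rewrite !wpowS /= !cats0 -!catA => /conn_cat[z1 h1 /conn_cat[z2 h2]].
  move=> /conn_cat[z3 h3 /conn_cat[z4 h4 h5]].
  have e1 := conn_start a0 h1; have e2 := conn_start a0 h2; subst u z1.
  have e3 := conn_end h2 h1; subst z2.
  have e4 := conn_start b0 h4; have e5 := conn_start b0 h5; subst z3 z4.
  by split=> // N; have [] := h N.
(* Periods have length at least 1, so N of them on either side of [w] cover the positions from i to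
   i + n. *)
pose N := absz i + n.
have gN : good (wpow a N ++ w ++ wpow b N).
  split=> //; exists (start a), (start b); apply/conn_cat.
  exists (start a); first exact: conn_wpow.
  by apply/conn_cat; exists (start b) => //; apply: conn_wpow.
move: gN; rewrite -(block_lpt x0) //.
have leN p : 0 < p -> N <= N * p by move=> p0; rewrite leq_pmulr.
have l1 := leN _ a0; have l2 := leN _ b0.
pose k := absz (i + (N * size a)%:Z)%R.
have ek : (- (N * size a)%:Z + k%:Z = i)%R by rewrite /k /N in l1 *; lia.
have [m em] : exists m, N * size a + size w + N * size b = k + (n + m).
  exists (N * size a + size w + N * size b - (k + n)).
  by rewrite /k /N in l1 l2 *; lia.
by rewrite em !block_cat // ek => /good_infix.
Qed.

End ChainShift.

Section ChainShiftPoints.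
Variable C : chain.
Variable x0 : cedge C.

Lemma chain_shift_shift (x x' : int -> cedge C) (s : int) :
  (forall i, x' i = x (i - s)%R) -> chain_shift x -> chain_shift x'.
Proof.
move=> h Xx i n; have -> : block x' i n = block x (i - s)%R n; last exact: Xx.
apply: eq_block => k _; rewrite h; congr x; lia.
Qed.

Lemma chain_shift_wpow (a w b : seq (cedge C)) h k : 0 < size a -> 0 < size b ->
  chain_shift (lpt x0 a (wpow a h ++ w ++ wpow b k) b) <->
  chain_shift (lpt x0 a w b).
Proof.
move=> a0 b0; split.
  apply: (@chain_shift_shift _ _ (- (h * size a)%:Z)%R) => i.
  by rewrite lpt_wpow_left // lpt_wpow_right //; congr lpt; lia.
apply: (@chain_shift_shift _ _ (h * size a)%:Z%R) => i.
by rewrite lpt_wpow_left // lpt_wpow_right.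
Qed.

Lemma chain_shift_left (a w b : seq (cedge C)) : 0 < size a -> 0 < size b ->
  chain_shift (lpt x0 a w b) -> chain_shift (lpt x0 a [::] a).
Proof.
move=> a0 b0 /(chain_shift_lptP _ _ a0 b0)[ha _ _ hN].
apply/chain_shift_lptP => //; split=> // [|N]; first exact: eqxx.
rewrite -wpowD => e; apply: (hN (N + N)).
by rewrite cval_cat e foldl_mstep_None.
Qed.

Lemma chain_shift_right (a w b : seq (cedge C)) : 0 < size a -> 0 < size b ->
  chain_shift (lpt x0 a w b) -> chain_shift (lpt x0 b [::] b).
Proof.
move=> a0 b0 /(chain_shift_lptP _ _ a0 b0)[_ _ hb hN].
apply/chain_shift_lptP => //; split=> // [|N]; first exact: eqxx.
rewrite -wpowD => e; apply: (@cval_infix C (wpow a (N + N) ++ w) _ [::] _ e).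
by rewrite cats0 -catA; apply: hN.
Qed.

End ChainShiftPoints.

Section BlockCode.
Variables (C D : chain) (x0 : cedge C) (y0 : cedge D).
Variables (F : (int -> cedge C) -> int -> cedge D) (n : nat).

(** Two independent positions [i] and [i'] express locality and commutation with the shift at
    once. *)
Definition window := forall x x' (i i' : int),
  chain_shift x -> chain_shift x' ->
  (forall k : int, (- n%:Z <= k <= n%:Z)%R -> x (i + k)%R = x' (i' + k)%R) ->
  F x i = F x' i'.

Hypothesis wF : window.

Local Notation pt := (lpt x0).
Local Notation pt' := (lpt y0).

Lemma window_shift x x' (s : int) : chain_shift x -> chain_shift x' ->
  (forall i, x i = x' (i - s)%R) -> forall i, F x i = F x' (i - s)%R.
Proof.
move=> Xx Xx' h i; apply: wF => // k _; rewrite h; congr x'; lia.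
Qed.

(** The words overlap in powers of [b] at least n long, so every window of the glued point occurs in
    one of the two given points, according to the side of the junction where it is centred. *)
Lemma code_glue a b c w1 w2 u1 u2 h a' b' c' w1' w2' :
  0 < size b -> n <= h * size b ->
  w1 = u1 ++ wpow b h -> w2 = wpow b h ++ u2 ->
  size w1' = size w1 -> size w2' = size w2 ->
  chain_shift (pt a w1 b) -> chain_shift (pt b w2 c) ->
  chain_shift (pt a (w1 ++ w2) c) ->
  F (pt a w1 b) = pt' a' w1' b' -> F (pt b w2 c) = pt' b' w2' c' ->
  F (pt a (w1 ++ w2) c) = pt' a' (w1' ++ w2') c'.
Proof.
move=> b0 nh e1 e2 s1 s2 X1 X2 X12 F1 F2; apply/funext => i.
have [lt|le] := boolP (i < (size w1)%:Z)%R.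
  have -> : pt' a' (w1' ++ w2') c' i = pt' a' w1' b' i.
    by rewrite -[in RHS](cats0 w1'); apply: lpt_prefix; rewrite s1.
  rewrite -F1; apply: wF => // k kn.
  rewrite -(lpt_wpow_right x0 a w1 h) // e2 catA -[in RHS](cats0 (w1 ++ _)).
  by apply: lpt_prefix; rewrite size_cat size_wpow; lia.
pose m := (i - (size w1)%:Z)%R.
have -> : pt' a' (w1' ++ w2') c' i = pt' b' w2' c' m.
  have -> : i = Posz (size w1' + absz m) by rewrite /m; lia.
  rewrite (lpt_suffix y0 a' b' w1' [::]); congr lpt; rewrite /= /m; lia.
rewrite -F2; apply: wF => // k kn.
have -> : pt b w2 c (m + k)%R =
    pt b (wpow b h ++ w2) c (m + k + (h * size b)%:Z)%R.
  by rewrite lpt_wpow_left //; congr lpt; lia.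
rewrite e1 -catA.
have -> : (i + k = (size u1 + absz (m + k + (h * size b)%:Z)%R)%:Z)%R.
  by move: (congr1 size e1); rewrite size_cat size_wpow /m; lia.
rewrite (lpt_suffix x0 a b u1 [::]); congr lpt; rewrite /m /=; lia.
Qed.

Lemma code_wpow_left a w b a' w' b' h :
  0 < size a -> size a' = size a ->
  chain_shift (pt a w b) -> chain_shift (pt a (wpow a h ++ w) b) ->
  F (pt a w b) = pt' a' w' b' ->
  F (pt a (wpow a h ++ w) b) = pt' a' (wpow a' h ++ w') b'.
Proof.
move=> a0 sa X1 X2 F1; apply/funext => i.
rewrite lpt_wpow_left ?sa // -F1; apply: window_shift => // j.
exact: lpt_wpow_left.
Qed.

Lemma code_periodic a : 0 < size a -> chain_shift (pt a [::] a) ->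
  exists2 a', size a' = size a & F (pt a [::] a) = pt' a' [::] a'.
Proof.
move=> a0 Xa; exists (block (F (pt a [::] a)) 0 (size a)).
  exact: size_block.
apply: lpt_periodic => // i.
rewrite -[in RHS](GRing.addrK (size a)%:Z%R i).
apply: window_shift => // j.
rewrite -[in LHS](lpt_wpow_periodic x0 1 a0) -[wpow a 1]cats0.
by rewrite lpt_wpow_left // mul1n.
Qed.

(** The padding has at least n symbols on each side, so a window centred outside the central word
    sees only a periodic tail. *)
Lemma code_image0 a u b a' b' h :
  0 < size a -> 0 < size b -> n <= h * size a -> n <= h * size b ->
  chain_shift (pt a [::] a) -> chain_shift (pt b [::] b) ->
  F (pt a [::] a) = pt' a' [::] a' -> F (pt b [::] b) = pt' b' [::] b' ->
  chain_shift (pt a (wpow a h ++ u ++ wpow b h) b) ->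
  exists2 w', size w' = size (wpow a h ++ u ++ wpow b h) &
    F (pt a (wpow a h ++ u ++ wpow b h) b) = pt' a' w' b'.
Proof.
move=> a0 b0 na nb Xa Xb Fa Fb; set w := _ ++ _; set x := pt a w b => Xx.
exists (block (F x) 0 (size w)); first exact: size_block.
apply/funext => i; have [lt|le] := boolP (i < 0)%R.
  have -> : pt' a' (block (F x) 0 (size w)) b' i = pt' a' [::] a' i.
    by case: i lt.
  rewrite -Fa; apply: wF => // k kn.
  rewrite -(lpt_wpow_periodic x0 h a0) -[in RHS](cats0 (wpow a h)).
  by apply: lpt_prefix; rewrite size_wpow; lia.
have [lt|le2] := boolP (i < (size w)%:Z)%R.
  case: i le lt => // m _ lt /=; rewrite size_block.
  have -> : m < size w by lia.
  by rewrite nth_block ?GRing.add0r //; lia.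
pose m := (i - (size w)%:Z)%R.
have -> : pt' a' (block (F x) 0 (size w)) b' i = pt' b' [::] b' m.
  have -> : i = Posz (size (block (F x) 0 (size w)) + absz m).
    by rewrite size_block /m; lia.
  have := lpt_suffix y0 a' b' (block (F x) 0 (size w)) [::] [::] b' (absz m).
  by rewrite cats0 => ->; congr lpt; rewrite /= /m; lia.
rewrite -Fb; apply: wF => // k kn.
have -> : pt b [::] b (m + k)%R = pt b (wpow b h) b (m + k + (h * size b)%:Z)%R.
  by rewrite -[wpow b h]cats0 lpt_wpow_left //; congr lpt; lia.
rewrite /x.
have -> : (i + k = (size (wpow a h ++ u) + absz (m + k + (h * size b)%:Z)%R)%:Z)%R.
  by move: le2; rewrite /m /w !size_cat !size_wpow; lia.
rewrite /w catA (lpt_suffix x0 a b _ [::]); congr lpt; rewrite /m /=; lia.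
Qed.

(** A second layer of padding makes the image itself begin and end with periods, as [code_glue]
    demands of words to be glued on that side. *)
Lemma code_image a u b a' b' h :
  0 < size a -> 0 < size b -> n <= h * size a -> n <= h * size b ->
  size a' = size a -> size b' = size b ->
  F (pt a [::] a) = pt' a' [::] a' -> F (pt b [::] b) = pt' b' [::] b' ->
  chain_shift (pt a u b) ->
  exists2 u', size u' = size (wpow a h ++ u ++ wpow b h) &
    F (pt a (wpow a h ++ (wpow a h ++ u ++ wpow b h) ++ wpow b h) b) =
    pt' a' (wpow a' h ++ u' ++ wpow b' h) b'.
Proof.
move=> a0 b0 na nb sa sb Fa Fb Xu.
have X1 := iffRL (chain_shift_wpow x0 u h h a0 b0) Xu.
have X2 := iffRL (chain_shift_wpow x0 _ h h a0 b0) X1.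
have Xa := chain_shift_left a0 b0 Xu; have Xb := chain_shift_right a0 b0 Xu.
have [u' su Fu] := code_image0 a0 b0 na nb Xa Xb Fa Fb X1.
exists u' => //; have a0' : 0 < size a' by rewrite sa.
have e : pt' a' (wpow a' h ++ u' ++ wpow b' h) b' =1 pt' a' (wpow a' h ++ u') b'.
  by move=> i; rewrite catA lpt_wpow_right // sb.
apply/funext => i; rewrite e lpt_wpow_left // sa -Fu.
apply: window_shift => // j; rewrite catA lpt_wpow_right // lpt_wpow_left //.
Qed.

End BlockCode.

Section Realize.
Variable C : chain.
Hypothesis okC : chain_ok C.

Lemma csrc_le (a : cedge C) : csrc a <= clen C.
Proof.
have [_ [ht he _ _ _] [_ he' _ _ _] _ _] := okC.
case: a => e /=.
  by case ek: (kneg e) => [l|i] /=; [have := he _ _ ek | have := ht i]; lia.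
by case ek: (kpos e) => [l|j] //=; have := he' _ _ ek; lia.
Qed.

Lemma ctgt_le (a : cedge C) : ctgt a <= clen C.
Proof.
have [_ [_ he _ _ _] [ht he' _ _ _] _ _] := okC.
case: a => e /=.
  by case ek: (kneg e) => [l|i] //=; have := he _ _ ek; lia.
by case ek: (kpos e) => [l|j] /=; [have := he' _ _ ek | have := ht j]; lia.
Qed.

Lemma conn_silent u v : u <= clen C -> v <= clen C ->
  exists2 w : seq (cedge C), conn u w v & pmap (@cletter C) w = [::].
Proof.
have [_ [_ _ hn _ _] [_ _ hp _ _] _ _] := okC.
move=> uK vK.
have [w1 c1 l1] : exists2 w : seq (cedge C), conn u w 0 & pmap (@cletter C) w = [::].
  elim: u uK => [|u IH] uK; first by exists [::].
  have [w cw lw] := IH (ltnW uK); have [e ek] := hp u.+1 uK.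
  by exists (inr e :: w); rewrite /= ek //= eqxx.
have [w2 c2 l2] : exists2 w : seq (cedge C), conn 0 w v & pmap (@cletter C) w = [::].
  elim: v vK => [|v IH] vK; first by exists [::].
  have [w cw lw] := IH (ltnW vK); have [e ek] := hn v.+1 vK.
  exists (rcons w (inl e)); first by rewrite conn_rcons /= ek /= cw eqxx.
  by rewrite -cats1 pmap_cat lw /= ek.
exists (w1 ++ w2); last by rewrite pmap_cat l1 l2.
by apply/conn_cat; exists 0.
Qed.

Lemma realize l u v : u <= clen C -> v <= clen C ->
  exists2 w : seq (cedge C), conn u w v & pmap (@cletter C) w = l.
Proof.
have [_ [_ _ _ hn _] [_ _ _ hp _] _ _] := okC.
elim: l u => [|x l IH] u uK vK; first exact: conn_silent.
have [a ea] : exists a : cedge C, cletter a = Some x.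
  case: x => [i|j]; first by have [e ek] := hn i; exists (inl e); rewrite /= ek.
  by have [e ek] := hp j; exists (inr e); rewrite /= ek.
have [w1 c1 l1] := conn_silent uK (csrc_le a).
have [w2 c2 l2] := IH (ctgt a) (ctgt_le a) vK.
exists (w1 ++ a :: w2); last by rewrite pmap_cat l1 /= ea /= l2.
by apply/conn_cat; exists (csrc a) => //=; rewrite eqxx.
Qed.

Lemma pmap_split (A B : Type) (f : A -> option B) w l1 l2 :
  pmap f w = l1 ++ l2 ->
  exists w1 w2, [/\ w = w1 ++ w2, pmap f w1 = l1 & pmap f w2 = l2].
Proof.
elim: w l1 => [|a w IH] l1 /=; first by case: l1 => //= <-; exists [::], [::].
case ea: (f a) => [b|] /=.
  case: l1 => [|b1 l1] /=.
    by move=> <-; exists [::], (a :: w); rewrite /= ea.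
  case=> <- /IH[w1 [w2 [-> e1 e2]]].
  by exists (a :: w1), w2; rewrite /= ea /= e1.
by move/IH=> [w1 [w2 [-> e1 e2]]]; exists (a :: w1), w2; rewrite /= ea.
Qed.

Variable x0 : cedge C.

Lemma chain_shift_homoclinic (q w : seq (cedge C)) :
  0 < size q -> cval q = cval [::] -> conn (start x0 q) q (start x0 q) ->
  chain_shift (lpt x0 q w q) <->
  conn (start x0 q) w (start x0 q) /\ cval w <> None.
Proof.
move=> q0 nq cq.
have nN N : cval (wpow q N) = cval [::].
  by rewrite /cval pmap_wpow neutral_wpow.
have e N : cval (wpow q N ++ w ++ wpow q N) = cval w.
  by rewrite cval_catl0 // cval_catr0.
split=> [/(chain_shift_lptP _ _ q0 q0)[_ cw _ /(_ 0)]|[cw nw]].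
  by rewrite e.
by apply/chain_shift_lptP => //; split=> // N; rewrite e.
Qed.

End Realize.

(** * Homoclinic points under a conjugacy *)

Section Conjugacy.
Variables (C D : chain).

Definition conj_codes (F : (int -> cedge C) -> int -> cedge D)
    (F' : (int -> cedge D) -> int -> cedge C) n :=
  [/\ forall x, chain_shift x -> chain_shift (F x),
      forall y, chain_shift y -> chain_shift (F' y),
      forall x, chain_shift x -> F' (F x) = x,
      forall y, chain_shift y -> F (F' y) = y &
      window F n /\ window F' n].

Variables (x0 : cedge C) (y0 : cedge D).

(** Moves the origin, so that the image of the base period can be cut where its value is 1. *)
Lemma conj_codes_shift F F' n (t : nat) : conj_codes F F' n ->
  conj_codes (fun x i => F x (i + t%:Z)%R)
             (fun y => F' (fun i => y (i - t%:Z)%R)) (n + t).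
Proof.
have sh (E : chain) (z : int -> cedge E) (s : int) :
    chain_shift z -> chain_shift (fun i => z (i + s)%R).
  by apply: (@chain_shift_shift _ _ _ (- s)) => i; rewrite GRing.opprK.
case=> XF XF' FK FK' [wF wF']; split.
- by move=> x Xx; apply/(sh D)/XF.
- by move=> y Yy; apply/XF'/(sh D).
- move=> x Xx; rewrite -[RHS]FK //; congr F'; apply/funext => i.
  by rewrite GRing.subrK.
- move=> y Yy; apply/funext => i; rewrite FK'; last exact: (sh D).
  by rewrite GRing.addrK.
- split=> x x' i i' Xx Xx' h.
    apply: wF => // k kn; rewrite -!GRing.addrA; apply: h; lia.
  apply: wF'; try exact: (sh D).
  move=> k kn; rewrite -!GRing.addrA; apply: h; lia.
Qed.

(* Otherwise the images of two points homoclinic to [q], with multipliers two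
   unrelated letters, could be glued along a power of [r]. *)
Lemma image_neutral F F' n q r : chain_ok C ->
  conj_codes F F' n -> 0 < size q -> size r = size q ->
  cval q = cval [::] -> conn (start x0 q) q (start x0 q) ->
  F (lpt x0 q [::] q) = lpt y0 r [::] r ->
  exists r1 r2, r = r1 ++ r2 /\ cval (r2 ++ r1) = cval [::].
Proof.
move=> okC [XF XF' FK FK' [wF wF']] q0 sr nq cq Fq.
have r0 : 0 < size r by rewrite sr.
have [_ _ _ _ [_ _ _ _ [i [j /negP nij]]]] := okC.
have sK : start x0 q <= clen C by exact: csrc_le.
have nq' : n <= n * size q by rewrite leq_pmulr.
have nr' : n <= n * size r by rewrite sr.
have nN N : cval (wpow q N) = cval [::].
  by rewrite /cval pmap_wpow neutral_wpow.
have image x : exists w w' u', [/\ cval w = mval (crel C) [:: x],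
    chain_shift (lpt y0 r w' r), w' = wpow r n ++ u' ++ wpow r n,
    size w' = size w & F' (lpt y0 r w' r) = lpt x0 q w q].
  have [u cu lu] := realize okC [:: x] sK sK.
  have Xu : chain_shift (lpt x0 q u q).
    by apply/chain_shift_homoclinic => //; rewrite /cval lu; case: x {lu}.
  have [u' su Fu] := code_image wF q0 q0 nq' nq' sr sr Fq Fq Xu.
  have X2 : chain_shift (lpt x0 q
      (wpow q n ++ (wpow q n ++ u ++ wpow q n) ++ wpow q n) q).
    by apply/chain_shift_wpow => //; apply/chain_shift_wpow.
  exists (wpow q n ++ (wpow q n ++ u ++ wpow q n) ++ wpow q n).
  exists (wpow r n ++ u' ++ wpow r n), u'; split=> //.
  - by do 2 rewrite (cval_catl0 _ (nN _)) (cval_catr0 _ (nN _)); rewrite /cval lu.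
  - by rewrite -Fu; apply: XF.
  - by rewrite !size_cat !size_wpow sr su !size_cat !size_wpow.
  - by rewrite -Fu FK.
have [w1 [w1' [u1' [v1 Y1 e1 s1 F1]]]] := image (inl i).
have [w2 [w2' [u2' [v2 Y2 e2 s2 F2]]]] := image (inr j).
have nz w' : chain_shift (lpt y0 r w' r) -> forall N, mval (crel D)
   (wpow (pmap (@cletter D) r) N ++ pmap (@cletter D) w' ++
    wpow (pmap (@cletter D) r) N) <> None.
  move=> /(chain_shift_lptP _ _ r0 r0)[_ _ _ h] N.
  by rewrite -pmap_wpow -!pmap_cat; apply: h.
case: (neutral_or_gluing (nz _ Y1) (nz _ Y2)) => [[r1 [r2 [er nr]]]|].
  have [q1 [q2 [-> l1 l2]]] := pmap_split er; exists q1, q2; split=> //.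
  by rewrite /cval pmap_cat l1 l2.
(* The images glued along [wpow r M] form a point of the second shift; its preimage contains [i] and
   then [j] with only neutral words around them, hence has value 0. *)
case=> M hM; exfalso.
have [hr c1 _ _] := (iffLR (chain_shift_lptP _ _ r0 r0) Y1).
have [_ c2 _ _] := (iffLR (chain_shift_lptP _ _ r0 r0) Y2).
have Y3 : chain_shift (lpt y0 r (wpow r M ++ w2') r).
  by have := iffRL (chain_shift_wpow y0 w2' M 0 r0 r0) Y2; rewrite cats0.
have Y12 : chain_shift (lpt y0 r (w1' ++ (wpow r M ++ w2')) r).
  apply/chain_shift_lptP => //; split=> // [|N].
    apply/conn_cat; exists (start y0 r) => //; apply/conn_cat.
    by exists (start y0 r) => //; apply: conn_wpow.
  by rewrite /cval !pmap_cat !pmap_wpow -!catA; apply: hM.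
have F3 := code_wpow_left wF' r0 (esym sr) Y2 Y3 F2.
have := XF' _ Y12.
rewrite (code_glue wF' (u1 := wpow r n ++ u1') (u2 := wpow r M ++ u2' ++ wpow r n)
  r0 nr' _ _ _ _ Y1 Y3 Y12 F1 F3).
- move/(chain_shift_lptP _ _ q0 q0)=> [_ _ _ /(_ 0)]; rewrite /= cats0; apply.
  rewrite /cval pmap_cat (@mval_congr _ _ _ _ [:: inl i] _ [:: inr j]) //.
    by rewrite /mval /=; case: (crel C i j) nij.
  exact: etrans (cval_catl0 _ (nN M)) v2.
- by rewrite e1 catA.
- by rewrite e2 !catA -!wpowD addnC.
- by rewrite s1.
- by rewrite !size_cat !size_wpow sr s2.
Qed.

Definition based_conj F F' n q r :=
  [/\ conj_codes F F' n,
      [/\ 0 < size q, size r = size q, cval q = cval [::] & cval r = cval [::]],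
      chain_shift (lpt x0 q [::] q), chain_shift (lpt y0 r [::] r) &
      F (lpt x0 q [::] q) = lpt y0 r [::] r /\
      F' (lpt y0 r [::] r) = lpt x0 q [::] q].

Lemma block_lpt_rot (A : Type) (z0 : A) (r1 r2 : seq A) : 0 < size (r1 ++ r2) ->
  block (lpt z0 (r1 ++ r2) [::] (r1 ++ r2)) (size r1)%:Z%R (size (r1 ++ r2)) =
  r2 ++ r1.
Proof.
move=> r0; pose r := r1 ++ r2.
have e : block (lpt z0 r [::] r) 0%R (size r1 + (size r + size r2)) = r ++ r.
  have := block_lpt z0 [::] 0 2 r0 r0; rewrite /wpow /= cats0 => <-.
  by congr block; rewrite /r size_cat; lia.
move: e; rewrite (block_cat z0) (block_cat z0) GRing.add0r.
move/(congr1 (fun s => take (size r) (drop (size r1) s))).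
rewrite drop_size_cat ?size_block // take_size_cat ?size_block // => ->.
rewrite /r -catA drop_size_cat // catA take_size_cat //.
by rewrite !size_cat addnC.
Qed.

(** A related pair of letters provides a nonempty neutral period. Its image is neutral only after a
    rotation, which a shift of the codes by [size r1] absorbs. *)
Lemma based_conj_exists F F' n : chain_ok C -> conj_codes F F' n ->
  exists F1 F1' n1 q r, based_conj F1 F1' n1 q r.
Proof.
move=> okC cF; have [_ _ _ _ [rows _ _ _ [i _]]] := okC; have [j ij] := rows i.
have [q cq lq] := realize okC [:: inl i; inr j] (leq0n _) (leq0n _).
have q0 : 0 < size q by case: q lq {cq}.
have nq : cval q = cval [::] by rewrite /cval lq /mval /= ij.
have e0 := conn_start x0 q0 cq; rewrite e0 in cq.
have Xq : chain_shift (lpt x0 q [::] q).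
  by apply/chain_shift_homoclinic => //; split; first exact: eqxx.
have [_ _ _ _ [wF _]] := cF.
have [r sr Fq] := code_periodic y0 wF q0 Xq.
have [r1 [r2 [er nr]]] := image_neutral okC cF q0 sr nq cq Fq.
have cF1 := conj_codes_shift (size r1) cF.
have [XF1 _ FK1 _ _] := cF1; move: cF1 XF1 FK1.
set F1 := fun x i => _; set F1' := fun y => _ => cF1 XF1 FK1.
have Fq1 : F1 (lpt x0 q [::] q) = lpt y0 (r2 ++ r1) [::] (r2 ++ r1).
  have e : block (F1 (lpt x0 q [::] q)) 0%R (size r) = r2 ++ r1.
    rewrite -(@block_lpt_rot _ y0 r1 r2) -er ?sr // -Fq.
    by apply: eq_block => k _; rewrite /F1 GRing.add0r GRing.addrC.
  rewrite -e; apply: lpt_periodic; first by rewrite sr.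
  move=> k; rewrite /F1 Fq.
  have -> : (k + size r + size r1 = (k + size r1) + (1 * size r)%:Z)%R by lia.
  rewrite -[in RHS](GRing.addrK (1 * size r)%:Z%R (k + _)%R).
  by rewrite -lpt_wpow_left ?sr // cats0 lpt_wpow_periodic ?sr.
exists F1, F1', (n + size r1), q, (r2 ++ r1); split=> //.
- by split=> //; rewrite -sr er !size_cat addnC.
- by rewrite -Fq1; apply: XF1.
- by rewrite -Fq1; split=> //; apply: FK1.
Qed.

End Conjugacy.

Section Paired.
Variables (C D : chain) (x0 : cedge C) (y0 : cedge D).
Variables (F : (int -> cedge C) -> int -> cedge D).
Variables (F' : (int -> cedge D) -> int -> cedge C).
Variables (n : nat) (q : seq (cedge C)) (r : seq (cedge D)).

(** The padding by n base periods on both sides is what allows excursions to be multiplied by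
    gluing; equal sizes keep positions aligned. *)
Definition paired w w' :=
  [/\ exists u, w = wpow q n ++ u ++ wpow q n,
      exists u', w' = wpow r n ++ u' ++ wpow r n,
      size w' = size w,
      chain_shift (lpt x0 q w q) /\ chain_shift (lpt y0 r w' r) &
      F (lpt x0 q w q) = lpt y0 r w' r /\ F' (lpt y0 r w' r) = lpt x0 q w q].

(* The correspondence between the two monoids induced by the conjugacy. *)
Definition paired_letters (l : seq (lneg C + lpos C)) (l' : seq (lneg D + lpos D)) :=
  exists w w', [/\ paired w w', cval w = mval (crel C) l
                 & cval w' = mval (crel D) l'].

End Paired.

Lemma based_conj_sym C D (x0 : cedge C) (y0 : cedge D) F F' n q r :
  based_conj x0 y0 F F' n q r -> based_conj y0 x0 F' F n r q.
Proof.
case=> -[? ? ? ? [? ?]] [q0 sr nq nr] Xq Yr [Fq Fr].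
by split=> //; split=> //; rewrite sr.
Qed.

Lemma paired_sym C D (x0 : cedge C) (y0 : cedge D) F F' n q r w w' :
  paired x0 y0 F F' n q r w w' <-> paired y0 x0 F' F n r q w' w.
Proof. by split; case=> ? ? ? [? ?] [? ?]. Qed.

Lemma paired_letters_sym C D (x0 : cedge C) (y0 : cedge D) F F' n q r l l' :
  paired_letters x0 y0 F F' n q r l l' <->
  paired_letters y0 x0 F' F n r q l' l.
Proof. by split=> -[w [w' [/paired_sym p e e']]]; exists w', w. Qed.

Section PairedTheory.
Variables (C D : chain) (x0 : cedge C) (y0 : cedge D).
Variables (F : (int -> cedge C) -> int -> cedge D).
Variables (F' : (int -> cedge D) -> int -> cedge C).
Variables (n : nat) (q : seq (cedge C)) (r : seq (cedge D)).
Hypothesis bF : based_conj x0 y0 F F' n q r.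
Hypothesis okC : chain_ok C.

Local Notation paired := (paired x0 y0 F F' n q r).
Local Notation th := (paired_letters x0 y0 F F' n q r).

Lemma paired_cat w1 w1' w2 w2' : paired w1 w1' -> paired w2 w2' ->
  chain_shift (lpt x0 q (w1 ++ w2) q) -> paired (w1 ++ w2) (w1' ++ w2').
Proof.
have [[XF _ FK _ [wF _]] [q0 sr _ _] _ _ _] := bF.
have nq : n <= n * size q by rewrite leq_pmulr.
case=> [[u1 e1] [u1' e1'] s1 [X1 Y1] [F1 _]] [[u2 e2] [u2' e2'] s2 [X2 Y2] [F2 _]] X12.
have eF : F (lpt x0 q (w1 ++ w2) q) = lpt y0 r (w1' ++ w2') r.
  apply: (code_glue wF q0 nq _ e2 s1 s2 X1 X2 X12 F1 F2).
  by rewrite e1 catA.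
have pad (T : Type) (z a b : seq T) : (z ++ a ++ z) ++ (z ++ b ++ z) =
  z ++ (a ++ z ++ z ++ b) ++ z by rewrite -!catA.
split.
- by eexists; rewrite e1 e2 pad.
- by eexists; rewrite e1' e2' pad.
- by rewrite !size_cat s1 s2.
- by split=> //; rewrite -eF; apply: XF.
- by split=> //; rewrite -eF FK.
Qed.

Lemma start_neutral : conn (start x0 q) q (start x0 q).
Proof.
have [_ [q0 _ _ _] Xq _ _] := bF.
by have [] := iffLR (chain_shift_lptP _ _ q0 q0) Xq.
Qed.

Lemma paired_total l : mval (crel C) l <> None -> exists l', th l l'.
Proof.
have [[XF XF' FK FK' [wF _]] [q0 sr nq _] Xq Yr [Fq Fr]] := bF.
have qn : n <= n * size q by rewrite leq_pmulr.
have nN N : cval (wpow q N) = cval [::] by rewrite /cval pmap_wpow neutral_wpow.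
have sK : start x0 q <= clen C by exact: csrc_le.
move=> nl; have [u cu lu] := realize okC l sK sK.
have Xu : chain_shift (lpt x0 q u q).
  by apply/chain_shift_homoclinic => //; [exact: start_neutral | rewrite /cval lu].
have [u' su Fu] := code_image wF q0 q0 qn qn sr sr Fq Fq Xu.
have Xw : chain_shift (lpt x0 q
    (wpow q n ++ (wpow q n ++ u ++ wpow q n) ++ wpow q n) q).
  by apply/chain_shift_wpow => //; apply/chain_shift_wpow.
set w := wpow q n ++ _ in Fu Xw; set w' := wpow r n ++ _ in Fu.
exists (pmap (@cletter D) w'), w, w'; split=> //.
  split=> //; try by eexists.
  - by rewrite /w /w' !size_cat !size_wpow sr su !size_cat !size_wpow.
  - by split=> //; rewrite -Fu; apply: XF.
  - by split=> //; rewrite -Fu FK.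
rewrite /w; do 2 rewrite (cval_catl0 _ (nN _)) (cval_catr0 _ (nN _)).
by rewrite /cval lu.
Qed.

Lemma paired_cat_nonzero w1 w1' w2 w2' : paired w1 w1' -> paired w2 w2' ->
  cval (w1 ++ w2) <> None -> chain_shift (lpt x0 q (w1 ++ w2) q).
Proof.
have [_ [q0 _ nq _] _ _ _] := bF; have cq := start_neutral.
case=> _ _ _ [X1 _] _ [_ _ _ [X2 _] _] nz.
have [_ c1 _ _] := iffLR (chain_shift_lptP _ _ q0 q0) X1.
have [_ c2 _ _] := iffLR (chain_shift_lptP _ _ q0 q0) X2.
apply/chain_shift_homoclinic => //; split=> //.
by apply/conn_cat; exists (start x0 q).
Qed.

Lemma paired_value w w' : paired w w' -> cval w <> None.
Proof.
have [_ [q0 _ nq _] _ _ _] := bF; have cq := start_neutral.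
by case=> _ _ _ [/(chain_shift_homoclinic _ q0 nq cq)[]].
Qed.

Lemma paired_letters_cat u u' v v' : th u u' -> th v v' ->
  mval (crel C) (u ++ v) <> None -> th (u ++ v) (u' ++ v').
Proof.
case=> w1 [w1' [p1 e1 e1']] [w2 [w2' [p2 e2 e2']]] nz.
have e12 : cval (w1 ++ w2) = mval (crel C) (u ++ v).
  by rewrite /cval pmap_cat; apply: mval_congr.
exists (w1 ++ w2), (w1' ++ w2'); split=> //.
  apply: paired_cat => //; apply: paired_cat_nonzero p1 p2 _.
  by rewrite e12.
by rewrite /cval pmap_cat; apply: mval_congr.
Qed.

Lemma paired_letters_nonzero l l' : th l l' -> mval (crel C) l <> None.
Proof. by case=> w [w' [/paired_value p <- _]]. Qed.

End PairedTheory.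

Lemma paired_letters_multiplicative C D (x0 : cedge C) (y0 : cedge D) F F' n q r :
  chain_ok C -> chain_ok D -> based_conj x0 y0 F F' n q r ->
  multiplicative (crel C) (crel D) (paired_letters x0 y0 F F' n q r).
Proof.
move=> okC okD bF; have bF' := based_conj_sym bF.
split.
- exact: paired_total.
- move=> l' /(paired_total bF' okD)[l h].
  by exists l; apply/paired_letters_sym.
- move=> l l' h; split; first exact: paired_letters_nonzero bF _ _ h.
  by apply: (paired_letters_nonzero bF'); apply/paired_letters_sym/h.
- move=> u u' v v' h1 h2; split=> nz.
    have h := paired_letters_cat bF h1 h2 nz.
    by apply: (paired_letters_nonzero bF'); apply/paired_letters_sym/h.
  apply: (paired_letters_nonzero bF); apply/paired_letters_sym.
  by apply: (paired_letters_cat bF') nz; apply/paired_letters_sym.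
- move=> u u' v v'; exact: (paired_letters_cat bF).
Qed.

Lemma mval_wpow_letter (I J : eqType) (R : I -> J -> bool) (x : I + J) m :
  mval R (wpow [:: x] m) <> None.
Proof.
case: x => [i|j]; first by rewrite mval_wpow_neg.
have -> : wpow [:: inr j] m = map inr (nseq m j) :> seq (I + J).
  by rewrite wpow_letter map_nseq.
by rewrite /mval foldl_inr.
Qed.

Lemma conn_le C u (w : seq (cedge C)) v :
  chain_ok C -> conn u w v -> u <= clen C -> v <= clen C.
Proof.
move=> okC; elim: w u => [|a w IH] u /=; first by move/eqP->.
by case/andP=> _ /IH h _; apply/h/ctgt_le.
Qed.

(** * Periodic points of a given multiplier under a conjugacy *)

Section MultiplierTransport.
Variables (C D : chain) (x0 : cedge C) (y0 : cedge D).
Variables (F : (int -> cedge C) -> int -> cedge D).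
Variables (F' : (int -> cedge D) -> int -> cedge C).
Variables (n : nat) (q : seq (cedge C)) (r : seq (cedge D)).
Hypothesis bF : based_conj x0 y0 F F' n q r.
Hypotheses (okC : chain_ok C) (okD : chain_ok D).

Local Notation th := (paired_letters x0 y0 F F' n q r).

Variables (x : lneg C + lpos C) (x' : lneg D + lpos D).
Hypothesis hx : forall l l', th l l' ->
  mval (crel C) l = mval (crel C) [:: x] -> mval (crel D) l' = mval (crel D) [:: x'].

Lemma paired_letters_wpow m l l' : th l l' ->
  mval (crel C) l = mval (crel C) (wpow [:: x] m.+1) ->
  mval (crel D) l' = mval (crel D) (wpow [:: x'] m.+1).
Proof.
have mth := paired_letters_multiplicative okC okD bF.
have [_ _ _ _ redD] := okD.
suff [t ht et] : exists2 t, th (wpow [:: x] m.+1) t &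
    mval (crel D) t = mval (crel D) (wpow [:: x'] m.+1).
  by move=> hl el; rewrite -et; apply: (corr_eq redD mth hl ht).
elim: m => [|m [t ht et]].
  have [t ht] := paired_total bF okC (@mval_wpow_letter _ _ (crel C) x 1).
  by exists t => //; apply: hx ht _.
have [s hs] := paired_total bF okC (@mval_wpow_letter _ _ (crel C) x 1).
exists (s ++ t); last by rewrite wpowS; apply: mval_congr => //; apply: hx hs _.
rewrite wpowS -[[:: x]]wpow1; apply: (paired_letters_cat bF) => //.
by rewrite -wpowD; apply: mval_wpow_letter.
Qed.

(** The periodic point is shadowed by points that leave the base point, follow [u] for N periods and
    return. Their values are powers of [x], those of their images the same powers of [x'], for every
    N; [multiplier_rotation] then reads off the multiplier of [u']. *)
Lemma multiplier_transport u : has_multiplier x u ->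
  chain_shift (lpt x0 u [::] u) /\
  exists2 u', size u' = size u &
    has_multiplier x' u' /\ F (lpt x0 u [::] u) = lpt y0 u' [::] u'.
Proof.
have [[XF XF' FK FK' [wF _]] [q0 sr nq nr] Xq Yr [Fq Fr]] := bF.
have qn : n <= n * size q by rewrite leq_pmulr.
case/has_multiplierP => cu [u1 [u2 [eu e21]]].
have u0 : 0 < size u.
  case: u cu eu => // _; case: u1 e21 => // e21; case: u2 e21 => //.
  by case: (x).
have un : n <= n * size u by rewrite leq_pmulr.
set s := start x0 u; have su : conn s u s.
  case: (u) cu @s u0 => // a w; rewrite closed_word_cons /= => -> _.
  by rewrite eqxx.
have [mid c1 c2] : exists2 mid, conn s u1 mid & conn mid u2 s.
  by apply/conn_cat; rewrite -eu.
have sK : s <= clen C by exact: csrc_le.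
have qK : start x0 q <= clen C by exact: csrc_le.
have mK := conn_le okC c1 sK.
(* Letterless paths between the base point and the vertex where [u] is cut with value [x]. *)
have [v cv lv] := conn_silent okC qK mK; have [w cw lw] := conn_silent okC mK qK.
have nv : cval v = cval [::] by rewrite /cval lv.
have nw : cval w = cval [::] by rewrite /cval lw.
have nN N : cval (wpow q N) = cval [::] by rewrite /cval pmap_wpow neutral_wpow.
have cq := start_neutral bF.
have val_pow N : cval (u2 ++ wpow u N ++ u1) = mval (crel C) (wpow [:: x] N.+1).
  rewrite eu -wpow_rotS /cval pmap_wpow; elim: (N.+1) => // k IH.
  by rewrite !wpowS; apply: mval_congr.
have nz N : cval (u2 ++ wpow u N ++ u1) <> None.
  by rewrite val_pow; apply: mval_wpow_letter.
have Xu : chain_shift (lpt x0 u [::] u).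
  apply/chain_shift_lptP => //; split=> // [|N]; first exact: eqxx.
  by rewrite -wpowD; apply: cval_infix (nz _).
split=> //; have [u' su' Fu] := code_periodic y0 wF u0 Xu; exists u' => //.
have u0' : 0 < size u' by rewrite su'.
have Yu : chain_shift (lpt y0 u' [::] u') by rewrite -Fu; apply: XF.
split=> //.
have XA : chain_shift (lpt x0 q (v ++ u2) u).
  apply/chain_shift_lptP => //; split=> // [|N].
    by apply/conn_cat; exists mid.
  rewrite cval_catl0 // -catA cval_catl0 //.
  by apply: (@cval_infix C [::] _ u1); rewrite -catA; apply: nz.
have XB : chain_shift (lpt x0 u (u1 ++ w) q).
  apply/chain_shift_lptP => //; split=> // [|N].
    by apply/conn_cat; exists mid.
  rewrite !catA cval_catr0 // cval_catr0 //.
  by apply: (@cval_infix C u2 _ [::]); rewrite cats0; apply: nz.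
have [A' sA FA] := code_image wF q0 u0 qn un sr su' Fq Fu XA.
have [B' sB FB] := code_image wF u0 q0 un qn su' sr Fu Fq XB.
set A := wpow q n ++ _ in FA; set A1 := _ ++ (A' ++ _) in FA.
set B := wpow u n ++ _ in FB; set B1 := _ ++ (B' ++ _) in FB.
have XA1 : chain_shift (lpt x0 q A u).
  by apply/chain_shift_wpow => //; apply/chain_shift_wpow.
have XB1 : chain_shift (lpt x0 u B q).
  by apply/chain_shift_wpow => //; apply/chain_shift_wpow.
have XBN N : chain_shift (lpt x0 u (wpow u N ++ B) q).
  by have := iffRL (chain_shift_wpow x0 B N 0 u0 q0) XB1; rewrite cats0.
have FBN N := code_wpow_left wF u0 su' XB1 (XBN N) FB.
(* Each of [A] and [B] contains 2n periods of [u], from the two layers of padding; the end pieces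
   [u2] and [u1] make one more. *)
have valW N : cval (A ++ wpow u N ++ B) =
    mval (crel C) (wpow [:: x] (N + (4 * n).+1)).
  rewrite addnS -val_pow.
  have -> : A ++ wpow u N ++ B = (wpow q n ++ wpow q n ++ v) ++
      ((u2 ++ wpow u (N + 4 * n) ++ u1) ++ (w ++ wpow q n ++ wpow q n)).
    have -> : N + 4 * n = n + (n + (N + (n + n))) by lia.
    by rewrite /A /B !wpowD -!catA.
  have n3 : cval (wpow q n ++ wpow q n ++ v) = cval [::].
    by do 2 rewrite cval_catl0 //.
  have n4 : cval (w ++ wpow q n ++ wpow q n) = cval [::].
    by do 2 rewrite cval_catl0 //.
  by rewrite cval_catl0 // cval_catr0.
have connAB N : conn (start x0 q) (A ++ wpow u N ++ B) (start x0 q).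
  have [_ h1 _ _] := iffLR (chain_shift_lptP _ _ q0 u0) XA1.
  have [_ h2 _ _] := iffLR (chain_shift_lptP _ _ u0 q0) (XBN N).
  by apply/conn_cat; exists s.
have XW N : chain_shift (lpt x0 q (A ++ wpow u N ++ B) q).
  apply/chain_shift_homoclinic => //; split=> //.
  by rewrite valW; apply: mval_wpow_letter.
have FW N : F (lpt x0 q (A ++ wpow u N ++ B) q) =
    lpt y0 r (A1 ++ wpow u' N ++ B1) r.
  apply: (code_glue wF (u1 := wpow q n ++ wpow q n ++ (v ++ u2) ++ wpow u n)
    (u2 := wpow u N ++ wpow u n ++ (u1 ++ w) ++ wpow q n ++ wpow q n) u0 un _ _ _ _
    XA1 (XBN N) (XW N) FA (FBN N)).
  - by rewrite /A -!catA.
  - by rewrite /B -!catA [LHS]catA [RHS]catA -!wpowD addnC.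
  - by rewrite /A /A1 !size_cat !size_wpow sr su' sA !size_cat !size_wpow.
  - by rewrite /B /B1 !size_cat !size_wpow sr su' sB !size_cat !size_wpow.
have thW N : th (wpow [:: x] (N + (4 * n).+1))
    (pmap (@cletter D) (A1 ++ wpow u' N ++ B1)).
  exists (A ++ wpow u N ++ B), (A1 ++ wpow u' N ++ B1); split=> //.
  split.
  - by eexists; rewrite /A /B -!catA; congr (_ ++ _); rewrite !catA.
  - by eexists; rewrite /A1 /B1 -!catA; congr (_ ++ _); rewrite !catA.
  - rewrite /A /A1 /B /B1 !size_cat !size_wpow sr su' sA sB.
    rewrite !size_cat !size_wpow; lia.
  - by split=> //; rewrite -FW; apply: XF.
  - by split=> //; rewrite -FW FK.
have [|S1 [S2 [eS hS]]] := @multiplier_rotation _ _ (crel D) x'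
  (pmap (@cletter D) u') (pmap (@cletter D) A1) (pmap (@cletter D) B1) (4 * n).+1.
  move=> N; rewrite -pmap_wpow -!pmap_cat addnS.
  by apply: (paired_letters_wpow (thW N)); rewrite addnS.
have [v1 [v2 [ev l1 l2]]] := pmap_split eS.
apply/has_multiplierP; split; last first.
  by exists v1, v2; split=> //; rewrite /cval pmap_cat l1 l2.
have [cu' _ _ _] := iffLR (chain_shift_lptP _ _ u0' u0') Yu.
case: (u') u0' cu' => // a z _; rewrite closed_word_cons /=.
by case/andP.
Qed.

Lemma card_periodic_le m :
  #|periodic_words x m| <= #|periodic_words x' m|.
Proof.
have [[_ _ FK _ _] _ _ _ _] := bF.
(* On words of multiplier [x] the block is the transported period, and applying [F'] to the periodic
   point recovers [u]. *)
pose f (u : m.-tuple (cedge C)) : m.-tuple (cedge D) :=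
  insubd (nseq_tuple m y0) (block (F (lpt x0 u [::] u)) 0%R m).
have fE (u : m.-tuple (cedge C)) : has_multiplier x u -> exists u',
   [/\ f u = u' :> seq _, chain_shift (lpt x0 u [::] u), has_multiplier x' u' &
   F (lpt x0 u [::] u) = lpt y0 u' [::] u'].
  move=> /multiplier_transport[Xu [u' su' [hu' Fu]]]; exists u'; split=> //.
  rewrite /f Fu -[X in block _ _ X](size_tuple u) -su' block_lpt_period.
  by rewrite val_insubd su' size_tuple eqxx.
have inj : {in periodic_words x m &, injective f}.
  move=> u v; rewrite !inE => /fE[u' [eu Xu _ Fu]] /fE[v' [ev Xv _ Fv]] e.
  have {}e : u' = v' by rewrite -eu -ev e.
  have : lpt x0 u [::] u = lpt x0 v [::] v.
    by rewrite -(FK _ Xu) -(FK _ Xv) Fu Fv e.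
  move=> /(congr1 (fun z => block z 0%R m)).
  have bu (z : m.-tuple (cedge C)) : block (lpt x0 z [::] z) 0%R m = z.
    by have := block_lpt_period x0 z; rewrite size_tuple.
  by rewrite !bu; apply: val_inj.
rewrite -(card_in_imset inj); apply/subset_leq_card/fintype.subsetP => u'.
by case/imsetP=> u; rewrite !inE => /fE[v [ev _ hv _]] ->; rewrite ev.
Qed.

End MultiplierTransport.

Lemma conj_letters C D (x0 : cedge C) (y0 : cedge D)
    (F : (int -> cedge C) -> int -> cedge D)
    (F' : (int -> cedge D) -> int -> cedge C) n :
  chain_ok C -> chain_ok D -> conj_codes F F' n ->
  exists (f : lneg C -> lneg D) (g : lpos C -> lpos D),
    [/\ bijective f, bijective g,
        forall i j, crel D (f i) (g j) = crel C i j &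
        forall x m, #|periodic_words (sum_map f g x) m| = #|periodic_words x m|].
Proof.
move=> okC okD cF; have [_ _ _ _ redC] := okC; have [_ _ _ _ redD] := okD.
have [F1 [F1' [n1 [q [r bF]]]]] := based_conj_exists x0 y0 okC cF.
have mth := paired_letters_multiplicative okC okD bF.
have [f [g [bf bg hR hx]]] := multiplicative_letters redC redD mth.
exists f, g; split=> // x m; apply/eqP; rewrite eqn_leq; apply/andP; split.
  apply: (card_periodic_le (based_conj_sym bF) okD okC) => l' l.
  by move/paired_letters_sym/hx => h /h.
by apply: (card_periodic_le bF okC okD) => l l' /hx h /h.
Qed.

(** * Uniform continuity of conjugacies *)

Section Cylinders.
Variable A : finType.
Local Open Scope classical_set_scope.
Local Notation fullA := {ptws int -> discrete_topology A}.

Definition cylinder (x : fullA) (m : nat) : set fullA :=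
  [set y | forall k : int, (- m%:Z <= k <= m%:Z)%R -> y k = x k].

Lemma nbhs_coordinate (x : fullA) (k : int) : nbhs x [set y : fullA | y k = x k].
Proof.
apply: (@proj_continuous int (fun=> discrete_topology A) k x [set x k]).
exact: discrete_set1.
Qed.

Lemma nbhsIS (x : fullA) (P Q W : set fullA) :
  nbhs x P -> nbhs x Q -> P `&` Q `<=` W -> nbhs x W.
Proof.
move=> hP hQ sub; apply: (@filterS _ _ (nbhs_filter x) _ _ sub).
exact: (@filterI _ _ (nbhs_filter x)).
Qed.

Lemma nbhs_cylinder (x : fullA) m : nbhs x (cylinder x m).
Proof.
elim: m => [|m IH].
  apply: filterS (nbhs_coordinate x 0%R) => y xy k k0.
  by have -> : k = 0%R by lia.
have h := nbhsIS (nbhs_coordinate x m.+1%:Z%R) (nbhs_coordinate x (- m.+1%:Z)%R).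
apply: nbhsIS IH (h _ (fun _ h => h)) _ => y [ym [y1 y2]] k km.
have [e|ne] := eqVneq k m.+1%:Z%R; first by rewrite e.
have [e|ne'] := eqVneq k (- m.+1%:Z)%R; first by rewrite e.
by apply: ym; lia.
Qed.

(** The filter generated by the cylinders at [x] converges to [x] in every coordinate, hence in the
    product topology. *)
Lemma cylinder_basis (x : fullA) (W : set fullA) : nbhs x W ->
  exists m, cylinder x m `<=` W.
Proof.
pose F := filter_from [set: nat] (cylinder x).
have FF : Filter F.
  apply: filter_from_filter; first by exists 0.
  move=> m n _ _; exists (maxn m n) => // y h.
  by split=> k kn; apply: h; lia.
suff Fx : F --> x by move=> /Fx[m _ h]; exists m.
apply/cvg_sup => k U [V] [[B] _ <-] Bx BU; exists (absz k) => // y h.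
by apply: BU => /=; rewrite h //; lia.
Qed.

Lemma fullA_compact : compact [set: fullA].
Proof.
have := @tychonoff int (fun=> discrete_topology A) (fun=> setT).
rewrite (_ : [set f : forall _, _ | _] = setT); last by apply/seteqP; split.
apply=> _; apply: finite_compact.
exact: (@finite_finset A setT).
Qed.

End Cylinders.

Section BlockCodes.
Variables (A B : finType).
Local Open Scope classical_set_scope.
Local Notation fullA := {ptws int -> discrete_topology A}.
Local Notation fullB := {ptws int -> discrete_topology B}.

(* The Curtis-Hedlund-Lyndon theorem, for closed sets of sequences. *)
Lemma uniform_window (X : set fullA) (Y : set fullB)
    (phi : set_type X -> set_type Y) :
  closed X -> continuous phi ->
  exists n, forall z z' : set_type X,
    (forall k : int, (- n%:Z <= k <= n%:Z)%R -> val z k = val z' k) ->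
    val (phi z) 0%R = val (phi z') 0%R.
Proof.
move=> clX cphi.
have cX : compact X by apply: (subclosed_compact clX (@fullA_compact A)).
move/compact_near_coveringP/near_covering_withinP: cX => cX.
(* The property is stated for ambient sequences, where [X] is compact. Near each point of [X] all
   large window sizes work on one cylinder, and compactness makes a size uniform. *)
pose P n (x : fullA) := forall z z' : set_type X, val z = x ->
    (forall k : int, (- n%:Z <= k <= n%:Z)%R -> val z k = val z' k) ->
    val (phi z) 0%R = val (phi z') 0%R.
have [n _ hn] : \forall n \near \oo, X `<=` P n.
  apply: cX => x Xx; pose z0 : set_type X := SigSub (mem_set Xx).
  have hU : nbhs (phi z0) [set y : set_type Y | val y 0%R = val (phi z0) 0%R].
    have c := @initial_continuous _ _ (@set_val _ Y).
    have := c (phi z0) _ (nbhs_coordinate (val (phi z0) : fullB) 0%R).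
    exact.
  have := cphi z0 _ hU; rewrite nbhs_simpl /= nbhsE => -[_ [[W oW <-] Wx] WU].
  have nW : nbhs (x : fullA) W by rewrite nbhsE; exists W.
  have [m hm] := cylinder_basis nW.
  exists (cylinder x m, [set n | m <= n]%N); first split => /=.
  - exact: nbhs_cylinder.
  - by exists m.
  case=> x' n [/= x'm mn] Xx' z z' ez h.
  have e1 : val (phi z) 0%R = val (phi z0) 0%R.
    by apply: (WU z); apply: hm; rewrite -ez in x'm.
  have -> : val (phi z') 0%R = val (phi z0) 0%R; last by [].
  apply: (WU z'); apply: hm => k km; have kn : (- n%:Z <= k <= n%:Z)%R by lia.
  by have := x'm k km; rewrite -ez (h k kn).
exists n => z z'; apply: (hn n (leqnn n) (val z)) => //.
exact: set_valP.
Qed.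
End BlockCodes.

Section RgraphShift.
Variable G : Rgraph.
Local Open Scope classical_set_scope.

Lemma rgraph_shift_closed : closed (rgraph_shift G).
Proof.
move=> x cx i n; pose m := absz i + n.+1.
have [y [Xy xy]] := cx _ (nbhs_cylinder x m).
have -> : block x i n.+1 = block (y : int -> edge G) i n.+1; last exact: Xy.
by apply: eq_block => k kn; rewrite xy // /m; lia.
Qed.

Lemma rgraph_shift_translate (x : full_shift G) (s : int) :
  rgraph_shift G x -> rgraph_shift G (fun i => x (i + s)%R).
Proof.
move=> Xx i n; have <- : block x (i + s)%R n.+1 =
    block (fun i => x (i + s)%R : edge G) i n.+1; last exact: Xx.
by apply: eq_block => k _; congr x; lia.
Qed.

Definition translate (z : set_type (rgraph_shift G)) (s : int) :
    set_type (rgraph_shift G) :=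
  SigSub (mem_set (@rgraph_shift_translate _ s (set_valP z))).

Lemma translateD z s t : translate (translate z s) t = translate z (t + s)%R.
Proof.
by apply: val_inj; apply/funext => i /=; congr (set_val z); lia.
Qed.

Lemma translate0 z : translate z 0%R = z.
Proof. by apply: val_inj; apply/funext => i /=; rewrite GRing.addr0. Qed.

Lemma translate1 z : translate z 1%R = shift_map z.
Proof. exact: val_inj. Qed.

End RgraphShift.

Section ConjugateCodes.

Lemma translate_equivariant (G H : Rgraph)
    (phi : set_type (rgraph_shift G) -> set_type (rgraph_shift H)) :
  (forall x, phi (shift_map x) = shift_map (phi x)) ->
  forall z s, phi (translate z s) = translate (phi z) s.
Proof.
move=> h; have hn z (n : nat) : phi (translate z n%:Z%R) = translate (phi z) n%:Z%R.
  elim: n => [|n IH]; first by rewrite !translate0.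
  have -> : (n.+1%:Z = 1 + n%:Z)%R by lia.
  by rewrite -!translateD !translate1 h IH.
move=> z [n|n]; first exact: hn.
have := hn (translate z (Negz n)) n.+1; rewrite translateD.
have -> : (n.+1%:Z + Negz n = 0)%R by lia.
rewrite translate0 => ->; rewrite translateD.
have -> : (Negz n + n.+1%:Z = 0)%R by lia.
by rewrite translate0.
Qed.

(** Extends [phi] by a constant outside the shift, giving a plain function on sequences as in
    [conj_codes]. *)
Definition code_of (G H : Rgraph) (y0 : edge H)
    (phi : set_type (rgraph_shift G) -> set_type (rgraph_shift H))
    (x : int -> edge G) : int -> edge H :=
  match pselect (rgraph_shift G x) with
  | left Xx => set_val (phi (SigSub (mem_set Xx)))
  | right _ => fun=> y0
  end.

Lemma code_ofE (G H : Rgraph) (y0 : edge H)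
    (phi : set_type (rgraph_shift G) -> set_type (rgraph_shift H)) z :
  code_of y0 phi (set_val z) = set_val (phi z).
Proof.
rewrite /code_of; case: pselect => [Xx|[]]; last exact: set_valP.
by congr (set_val (phi _)); apply: val_inj.
Qed.

Lemma code_of_window (G H : Rgraph) (y0 : edge H)
    (phi : set_type (rgraph_shift G) -> set_type (rgraph_shift H)) :
  continuous phi -> (forall x, phi (shift_map x) = shift_map (phi x)) ->
  exists n, forall m, n <= m -> forall x x' (i i' : int),
  rgraph_shift G x -> rgraph_shift G x' ->
  (forall k : int, (- m%:Z <= k <= m%:Z)%R -> x (i + k)%R = x' (i' + k)%R) ->
  code_of y0 phi x i = code_of y0 phi x' i'.
Proof.
move=> cphi sphi; have [n hn] := uniform_window (@rgraph_shift_closed G) cphi.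
exists n => m nm x x' i i' Xx Xx' h.
pose z : set_type (rgraph_shift G) := SigSub (mem_set Xx).
pose z' : set_type (rgraph_shift G) := SigSub (mem_set Xx').
rewrite -[x]/(set_val z) -[x']/(set_val z') !code_ofE.
have e (w : set_type (rgraph_shift H)) j : set_val w j = val (translate w j) 0%R.
  by rewrite /= GRing.add0r.
rewrite !e -!(translate_equivariant sphi); apply: hn => k kn /=.
have km : (- m%:Z <= k <= m%:Z)%R by lia.
by rewrite ![(k + _)%R]GRing.addrC; apply: h.
Qed.

Lemma conjugate_codes (G H : Rgraph) (x0 : edge G) (y0 : edge H) :
  topologically_conjugate G H ->
  exists (F : (int -> edge G) -> int -> edge H)
         (F' : (int -> edge H) -> int -> edge G) n,
  [/\ forall x, rgraph_shift G x -> rgraph_shift H (F x),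
      forall y, rgraph_shift H y -> rgraph_shift G (F' y),
      forall x, rgraph_shift G x -> F' (F x) = x,
      forall y, rgraph_shift H y -> F (F' y) = y &
      (forall x x' (i i' : int), rgraph_shift G x -> rgraph_shift G x' ->
        (forall k : int, (- n%:Z <= k <= n%:Z)%R -> x (i + k)%R = x' (i' + k)%R) ->
        F x i = F x' i') /\
      (forall y y' (i i' : int), rgraph_shift H y -> rgraph_shift H y' ->
        (forall k : int, (- n%:Z <= k <= n%:Z)%R -> y (i + k)%R = y' (i' + k)%R) ->
        F' y i = F' y' i')].
Proof.
case=> phi [psi [K1 K2 c1 c2 s1]].
have s2 y : psi (shift_map y) = shift_map (psi y).
  by rewrite -{1}(K2 y) -s1 K1.
have [n1 h1] := code_of_window y0 c1 s1.
have [n2 h2] := code_of_window x0 c2 s2.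
have lift (E : Rgraph) x : rgraph_shift E x -> exists z : set_type (rgraph_shift E), x = set_val z.
  by move=> Xx; exists (SigSub (mem_set Xx)).
exists (code_of y0 phi), (code_of x0 psi), (maxn n1 n2); split.
- by move=> x /lift[z ->]; rewrite code_ofE; apply: set_valP.
- by move=> x /lift[z ->]; rewrite code_ofE; apply: set_valP.
- by move=> x /lift[z ->]; rewrite !code_ofE K1.
- by move=> x /lift[z ->]; rewrite !code_ofE K2.
- by split; [apply: h1 | apply: h2]; lia.
Qed.

End ConjugateCodes.

From mathcomp Require Import fintype finset.

(** * The chain of an R-graph *)

(* Applied to the negative edges, and to the positive edges with reversed
   direction: [D l] are the edges from p_l to p_0, [B l] those from p_(l-1) to
   p_l, and [cls l] is the partition of [D l] into classes. *)
Section HalfChain.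
Variables (K : nat) (E : finType) (D B : 'I_K.+1 -> {set E}).
Variable cls : 'I_K.+1 -> {set {set E}}.

Hypothesis loop_or_link : forall e, exists2 l : 'I_K.+1, 0 < l & (e \in D l) \/ (e \in B l).
Hypothesis D_inj : forall (l l' : 'I_K.+1) e, e \in D l -> e \in D l' -> l = l'.
Hypothesis B_inj : forall (l l' : 'I_K.+1) e, 0 < l -> 0 < l' ->
  e \in B l -> e \in B l' -> l = l'.
Hypothesis DB : forall (l l' : 'I_K.+1) e, 0 < l' -> e \in D l -> e \notin B l'.
Hypothesis D_neq0 : forall l : 'I_K.+1, 0 < l -> D l != set0.
Hypothesis B_neq0 : forall l : 'I_K.+1, 0 < l -> B l != set0.
Hypothesis clsP : forall l, partition (cls l) (D l).

Definition class_letter :=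
  {x : 'I_K.+1 * {set E} | (0 < x.1) && (x.2 \in cls x.1)}.

Definition letter_type (i : class_letter) : nat := (val i).1.

(** Total by defaults: every edge is a loop or a link and loops lie in a class, so [insub] succeeds
    and the last [inl 0] is never reached. *)
Definition edge_kind (e : E) : nat + class_letter :=
  if [pick l : 'I_K.+1 | (0 < l) && (e \in D l)] is Some l then
    if insub (l, pblock (cls l) e) is Some i then inr i else inl (l : nat)
  else if [pick l : 'I_K.+1 | (0 < l) && (e \in B l)] is Some l then inl (l : nat)
  else inl 0.

Lemma class_sub l c e : c \in cls l -> e \in c -> e \in D l.
Proof.
move=> cl ec; have /and3P[/eqP <- _ _] := clsP l.
by apply/bigcupP; exists c.
Qed.

Lemma pblock_cls l e : e \in D l ->
  pblock (cls l) e \in cls l /\ e \in pblock (cls l) e.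
Proof.
move=> eD; have /and3P[/eqP cl _ _] := clsP l.
have ec : e \in cover (cls l) by rewrite cl.
by split; [exact: pblock_mem | rewrite mem_pblock].
Qed.

Lemma edge_kind_loop (l : 'I_K.+1) e : 0 < l -> e \in D l ->
  exists2 i, edge_kind e = inr i & val i = (l, pblock (cls l) e).
Proof.
move=> l0 eD; rewrite /edge_kind; case: pickP => [l' /andP[_ eD']|/(_ l)].
  rewrite (D_inj eD' eD); case: insubP => [i _ ei|]; first by exists i.
  by rewrite l0 /=; have [-> _] := pblock_cls eD.
by rewrite l0 eD.
Qed.

Lemma edge_kind_link (l : 'I_K.+1) e : 0 < l -> e \in B l ->
  edge_kind e = inl (l : nat).
Proof.
move=> l0 eB; rewrite /edge_kind; case: pickP => [l' /andP[_ eD']|_].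
  by have := DB l0 eD'; rewrite eB.
case: pickP => [l' /andP[l0' eB']|/(_ l)]; last by rewrite l0 eB.
by rewrite (B_inj l0' l0 eB' eB).
Qed.

Lemma edge_kind_inr e i : edge_kind e = inr i <-> e \in (val i).2.
Proof.
have /andP[i0 ci] := valP i; split=> [ek|ei].
  have [l l0 [eD|eB]] := loop_or_link e; last by rewrite (edge_kind_link l0 eB) in ek.
  have [i' ek' ei'] := edge_kind_loop l0 eD.
  move: ek; rewrite ek' => -[<-]; rewrite ei' /=.
  by have [] := pblock_cls eD.
have eD := class_sub ci ei; have [i' -> ei'] := edge_kind_loop i0 eD.
congr inr; apply: val_inj; rewrite ei'.
have /and3P[_ tI _] := clsP (val i).1.
by rewrite (def_pblock tI ci ei); case: (val i).
Qed.

Lemma edge_kind_inl e m : edge_kind e = inl m <->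
  exists l : 'I_K.+1, [/\ m = l :> nat, 0 < l & e \in B l].
Proof.
split=> [ek|[l [-> l0 eB]]]; last exact: edge_kind_link.
have [l l0 [eD|eB]] := loop_or_link e.
  by have [i ek' _] := edge_kind_loop l0 eD; rewrite ek in ek'.
by move: ek; rewrite (edge_kind_link l0 eB) => -[<-]; exists l.
Qed.

Lemma class_letter_mem (i : class_letter) : exists e, e \in (val i).2.
Proof.
have /andP[_ ci] := valP i; have /and3P[_ _ n0] := clsP (val i).1.
by apply/set0Pn; apply: contraNneq n0 => <-.
Qed.

Lemma half_chain_kind : half_chain_ok K letter_type edge_kind.
Proof.
split.
- move=> i; have /andP[i0 _] := valP i; rewrite /letter_type i0 /=.
  by rewrite -ltnS ltn_ord.
- move=> e m /edge_kind_inl[l [-> l0 _]]; rewrite l0 /=.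
  by rewrite -ltnS ltn_ord.
- move=> m /andP[m0 mK]; pose l : 'I_K.+1 := Ordinal (mK : m < K.+1).
  have /set0Pn[e eB] := @B_neq0 l m0; exists e.
  by apply/edge_kind_inl; exists l.
- move=> i; have [e ei] := class_letter_mem i; exists e.
  exact/edge_kind_inr.
- move=> m /andP[m0 mK]; pose l : 'I_K.+1 := Ordinal (mK : m < K.+1).
  have /set0Pn[e eD] := @D_neq0 l m0.
  have [i _ ei] := @edge_kind_loop l e m0 eD; exists i.
  by rewrite /letter_type ei.
Qed.

Lemma card_kind_class i : #|[set e | edge_kind e == inr i]| = #|(val i).2|.
Proof.
by apply: eq_card => e; rewrite inE; apply/eqP/idP => /edge_kind_inr.
Qed.

Lemma card_kind_link (l : 'I_K.+1) : 0 < l ->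
  #|[set e | edge_kind e == inl (l : nat)]| = #|B l|.
Proof.
move=> l0; apply: eq_card => e; rewrite inE; apply/eqP/idP => [|eB].
  by case/edge_kind_inl=> l' [/val_inj -> _].
by apply/edge_kind_inl; exists l.
Qed.

Lemma same_class (i i' : class_letter) e e' : (val i).1 = (val i').1 ->
  e \in (val i).2 -> e' \in (val i').2 ->
  e' \in pblock (cls (val i).1) e -> i = i'.
Proof.
move=> et ei ei' h; have /andP[_ ci] := valP i; have /andP[_ ci'] := valP i'.
have /and3P[_ tI _] := clsP (val i).1.
apply: val_inj; move: et ci ci' tI ei ei' h; case: (val i) (val i') => [l c] [l' c'] /=.
move=> <- ci ci' tI ei ei'; rewrite (def_pblock tI ci ei) => h; congr pair.
by rewrite -(def_pblock tI ci h) -(def_pblock tI ci' ei').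
Qed.

Lemma big_class_letter (R : Type) (idx : R) (op : Monoid.com_law idx)
    (l : 'I_K.+1) (f : {set E} -> R) : 0 < l ->
  \big[op/idx]_(c in cls l) f c =
  \big[op/idx]_(i : class_letter | letter_type i == l) f (val i).2.
Proof.
move=> l0; pose A := [set i : class_letter | letter_type i == l].
have -> : cls l = [set (val i).2 | i in A].
  apply/setP => c; apply/idP/imsetP => [cl|[i]].
    have h : (0 < (l, c).1) && ((l, c).2 \in cls (l, c).1) by rewrite l0.
    by exists (Sub (l, c) h : class_letter); rewrite ?inE /letter_type /=.
  rewrite inE => /eqP /val_inj il ->.
  by have /andP[_] := valP i; rewrite il.
rewrite big_imset /=; first by apply: eq_bigl => i; rewrite inE.
move=> [[l1 c1] h1] [[l2 c2] h2]; rewrite !inE /letter_type /=.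
by move=> /eqP/val_inj e1 /eqP/val_inj e2 ec; apply: val_inj; rewrite /= e1 e2 ec.
Qed.
End HalfChain.

Section FamilyChain.
Variables (K : nat) (G : Rgraph) (p : 'I_K.+1 -> vertex G).
Hypothesis famG : family_conditions p.
Hypothesis K0 : 0 < K.

Lemma nequiv_rel (q r : vertex G) : {in Eneg q r & &, equivalence_rel (nequiv q r)}.
Proof.
move=> e e' e'' _ _ _; split; first by apply/forall_inP => f _; rewrite eqxx.
move=> /forall_inP h; apply/forall_inP/forall_inP => h' f fP.
  by rewrite -(eqP (h f fP)); apply: h'.
by rewrite (eqP (h f fP)); apply: h'.
Qed.

Lemma pequiv_rel (q r : vertex G) : {in Epos q r & &, equivalence_rel (pequiv q r)}.
Proof.
move=> e e' e'' _ _ _; split; first by apply/forall_inP => f _; rewrite eqxx.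
move=> /forall_inP h; apply/forall_inP/forall_inP => h' f fP.
  by rewrite -(eqP (h f fP)); apply: h'.
by rewrite (eqP (h f fP)); apply: h'.
Qed.

Definition neg_loops l := Eneg (p l) (p ord0).
Definition pos_loops l := Epos (p l) (p ord0).
Definition neg_links (l : 'I_K.+1) := Eneg (p (inord l.-1)) (p l).
Definition pos_links (l : 'I_K.+1) := Epos (p (inord l.-1)) (p l).
Definition neg_cls l := nclasses (p l) (p ord0).
Definition pos_cls l := pclasses (p l) (p ord0).

Lemma p_inj : injective p.
Proof. by case: famG => /bij_inj. Qed.

Lemma link_pred (l l' : 'I_K.+1) : 0 < l -> 0 < l' ->
  p (inord l.-1) = p (inord l'.-1) -> l = l'.
Proof.
move=> l0 l0' /p_inj /(congr1 val) /=.
rewrite !inordK ?(leq_ltn_trans (leq_pred _)) // => e.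
by apply: val_inj => /=; clear K0; lia.
Qed.

Lemma p_neq0 (l : 'I_K.+1) : 0 < l -> p l != p ord0.
Proof. by move=> l0; apply: contraTneq l0 => /p_inj ->. Qed.

Lemma neg_cover (e : nedge G) : exists2 l : 'I_K.+1, 0 < l &
  (e \in neg_loops l) \/ (e \in neg_links l).
Proof. by case: famG => _ _ h _ _; apply: h. Qed.

Lemma mem_Eneg (e : nedge G) : e \in Eneg (nsrc e) (ntgt e).
Proof. by rewrite inE !eqxx. Qed.

Lemma mem_Epos (f : pedge G) : f \in Epos (ptgt f) (psrc f).
Proof. by rewrite inE !eqxx. Qed.

(** (ii) speaks of negative edges; a positive edge runs opposite to some negative one, whose l it
    shares. *)
Lemma pos_cover (f : pedge G) : exists2 l : 'I_K.+1, 0 < l &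
  (f \in pos_loops l) \/ (f \in pos_links l).
Proof.
have : Epos (ptgt f) (psrc f) != set0 by apply/set0Pn; exists f; apply: mem_Epos.
move/Eneg_Epos_neq0/set0Pn => [e]; rewrite inE => /andP[/eqP es /eqP et].
have [l l0 h] := neg_cover e; exists l => //; move: h.
by rewrite !inE es et ![(psrc f == _) && _]andbC.
Qed.

Lemma neg_loops_inj l l' e : e \in neg_loops l -> e \in neg_loops l' -> l = l'.
Proof.
rewrite !inE => /andP[/eqP e1 _] /andP[/eqP e2 _]; apply: p_inj.
by rewrite -e1 -e2.
Qed.

Lemma pos_loops_inj l l' e : e \in pos_loops l -> e \in pos_loops l' -> l = l'.
Proof.
rewrite !inE => /andP[_ /eqP e1] /andP[_ /eqP e2]; apply: p_inj.
by rewrite -e1 -e2.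
Qed.

Lemma neg_links_inj (l l' : 'I_K.+1) e : 0 < l -> 0 < l' ->
  e \in neg_links l -> e \in neg_links l' -> l = l'.
Proof.
move=> l0 l0'; rewrite !inE => /andP[/eqP e1 _] /andP[/eqP e2 _].
by apply: link_pred => //; rewrite -e1 -e2.
Qed.

Lemma pos_links_inj (l l' : 'I_K.+1) e : 0 < l -> 0 < l' ->
  e \in pos_links l -> e \in pos_links l' -> l = l'.
Proof.
move=> l0 l0'; rewrite !inE => /andP[_ /eqP e1] /andP[_ /eqP e2].
by apply: link_pred => //; rewrite -e1 -e2.
Qed.

Lemma neg_loop_link (l l' : 'I_K.+1) e : 0 < l' ->
  e \in neg_loops l -> e \notin neg_links l'.
Proof.
move=> l0; rewrite !inE => /andP[_ /eqP ->].
by rewrite [p ord0 == _]eq_sym (negPf (p_neq0 l0)) andbF.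
Qed.

Lemma pos_loop_link (l l' : 'I_K.+1) e : 0 < l' ->
  e \in pos_loops l -> e \notin pos_links l'.
Proof.
move=> l0; rewrite !inE => /andP[/eqP -> _].
by rewrite eq_sym (negPf (p_neq0 l0)).
Qed.

Lemma neg_loops_neq0 (l : 'I_K.+1) : 0 < l -> neg_loops l != set0.
Proof. by case: famG => _ h _ _ _ /h[]. Qed.

Lemma neg_links_neq0 (l : 'I_K.+1) : 0 < l -> neg_links l != set0.
Proof. by case: famG => _ h _ _ _ /h[]. Qed.

Lemma pos_loops_neq0 (l : 'I_K.+1) : 0 < l -> pos_loops l != set0.
Proof. by move=> /neg_loops_neq0 /Eneg_Epos_neq0. Qed.

Lemma pos_links_neq0 (l : 'I_K.+1) : 0 < l -> pos_links l != set0.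
Proof. by move=> /neg_links_neq0 /Eneg_Epos_neq0. Qed.

Lemma neg_clsP l : partition (neg_cls l) (neg_loops l).
Proof. by apply/equivalence_partitionP/nequiv_rel. Qed.

Lemma pos_clsP l : partition (pos_cls l) (pos_loops l).
Proof. by apply/equivalence_partitionP/pequiv_rel. Qed.

Definition nletter := class_letter neg_cls.
Definition pletter := class_letter pos_cls.
Definition nkind : nedge G -> nat + nletter := edge_kind neg_loops neg_links neg_cls.
Definition pkind : pedge G -> nat + pletter := edge_kind pos_loops pos_links pos_cls.

Definition class_related (i : nletter) (j : pletter) :=
  ((val i).1 == (val j).1) &&
  (setX (val i).2 (val j).2 \subset Rel (p (val i).1) (p ord0)).

Definition family_chain : chain :=
  @Chain K (nedge G) (pedge G) nletter pletter
    (@letter_type _ _ _) (@letter_type _ _ _) class_related nkind pkind.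

Lemma nkind_inr e i : nkind e = inr i <-> e \in (val i).2.
Proof.
exact: (edge_kind_inr neg_cover neg_loops_inj neg_links_inj neg_loop_link neg_clsP).
Qed.

Lemma pkind_inr f j : pkind f = inr j <-> f \in (val j).2.
Proof.
exact: (edge_kind_inr pos_cover pos_loops_inj pos_links_inj pos_loop_link pos_clsP).
Qed.

Lemma nkind_inl e m : nkind e = inl m <->
  exists l : 'I_K.+1, [/\ m = l :> nat, 0 < l & e \in neg_links l].
Proof.
exact: (edge_kind_inl neg_cover neg_loops_inj neg_links_inj neg_loop_link neg_clsP).
Qed.

Lemma pkind_inl f m : pkind f = inl m <->
  exists l : 'I_K.+1, [/\ m = l :> nat, 0 < l & f \in pos_links l].
Proof.
exact: (edge_kind_inl pos_cover pos_loops_inj pos_links_inj pos_loop_link pos_clsP).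
Qed.

Lemma nclass_loop (i : nletter) e : e \in (val i).2 -> e \in neg_loops (val i).1.
Proof. by have /andP[_ ci] := valP i; apply: (class_sub neg_clsP). Qed.

Lemma pclass_loop (j : pletter) f : f \in (val j).2 -> f \in pos_loops (val j).1.
Proof. by have /andP[_ cj] := valP j; apply: (class_sub pos_clsP). Qed.

Lemma nkind_loop (l : 'I_K.+1) e : 0 < l -> e \in neg_loops l ->
  exists2 i, nkind e = inr i & (val i).1 = l.
Proof.
move=> l0 el; have [i ei vi] := edge_kind_loop neg_links neg_loops_inj neg_clsP l0 el.
by exists i; rewrite ?vi.
Qed.

Lemma pkind_loop (l : 'I_K.+1) f : 0 < l -> f \in pos_loops l ->
  exists2 j, pkind f = inr j & (val j).1 = l.
Proof.
move=> l0 fl; have [j fj vj] := edge_kind_loop pos_links pos_loops_inj pos_clsP l0 fl.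
by exists j; rewrite ?vj.
Qed.

Lemma nclassE (i : nletter) e e' : e \in (val i).2 -> e' \in neg_loops (val i).1 ->
  (e' \in (val i).2) = nequiv (p (val i).1) (p ord0) e e'.
Proof.
move=> ei e'l; have /andP[_ ci] := valP i; have /and3P[_ tI _] := neg_clsP (val i).1.
rewrite -(def_pblock tI ci ei) pblock_equivalence_partition //.
  exact: nequiv_rel.
exact: nclass_loop.
Qed.

Lemma pclassE (j : pletter) f f' : f \in (val j).2 -> f' \in pos_loops (val j).1 ->
  (f' \in (val j).2) = pequiv (p (val j).1) (p ord0) f f'.
Proof.
move=> fj f'l; have /andP[_ cj] := valP j; have /and3P[_ tI _] := pos_clsP (val j).1.
rewrite -(def_pblock tI cj fj) pblock_equivalence_partition //.
  exact: pequiv_rel.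
exact: pclass_loop.
Qed.

Lemma mem_Rel (q r : vertex G) e f : e \in Eneg q r -> f \in Epos q r ->
  ((e, f) \in Rel q r) = related e f.
Proof. by move=> eE fE; rewrite !inE /= in eE fE *; rewrite eE fE. Qed.

(** Members of a class have the same related partners, so one related pair puts the whole product of
    the two classes into the relation. *)
Lemma class_relatedE (i : nletter) (j : pletter) e f :
  e \in (val i).2 -> f \in (val j).2 ->
  class_related i j = related e f.
Proof.
move=> ei fj; have el := nclass_loop ei; have fl := pclass_loop fj.
apply/andP/idP => [[/eqP eij /subsetP/(_ (e, f))]|ref].
  by rewrite in_setX ei fj => /(_ isT); rewrite inE => /andP[].
have eij : (val i).1 = (val j).1.
  have [q [r]] := related_Rel ref; rewrite !inE /= => /andP[/andP[]].
  move=> /andP[/eqP q1 _] /andP[_ /eqP q2] _; apply: p_inj.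
  move: el fl; rewrite !inE => /andP[/eqP e1 _] /andP[_ /eqP e2].
  by rewrite -e1 -e2 q1 q2.
split; first by rewrite eij.
apply/subsetP => -[e' f']; rewrite in_setX /= => /andP[ei' fj'].
have el' := nclass_loop ei'; have fl' := pclass_loop fj'.
move: ei' fj'; rewrite (nclassE ei el') (pclassE fj fl') -eij.
rewrite -eij in fl fl'.
move=> /forall_inP/(_ f fl)/eqP h1 /forall_inP/(_ e' el')/eqP <-.
by rewrite -h1 mem_Rel.
Qed.

Lemma class_related_type (i : nletter) (j : pletter) : class_related i j ->
  (val i).1 = (val j).1.
Proof. by case/andP=> /eqP. Qed.

Lemma exists_neg_related (i : nletter) : exists j, class_related i j.
Proof.
have [e ei] := class_letter_mem neg_clsP i; have el := nclass_loop ei.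
have /andP[i0 _] := valP i.
have [f] := Rel_complete_neg el; rewrite !inE /= => /andP[/andP[_ fl] ref].
have [|j /pkind_inr fj _] := @pkind_loop (val i).1 f i0; first by rewrite inE.
by exists j; rewrite (class_relatedE ei fj).
Qed.

Lemma exists_pos_related (j : pletter) : exists i, class_related i j.
Proof.
have [f fj] := class_letter_mem pos_clsP j; have fl := pclass_loop fj.
have /andP[j0 _] := valP j.
have [e] := Rel_complete_pos fl; rewrite !inE /= => /andP[/andP[el _] ref].
have [|i /nkind_inr ei _] := @nkind_loop (val j).1 e j0; first by rewrite inE.
by exists i; rewrite (class_relatedE ei fj).
Qed.

Lemma nclass_ext (i i' : nletter) :
  class_related i =1 class_related i' -> i = i'.
Proof.
move=> h; have [j ij] := exists_neg_related i.
have i'j : class_related i' j by rewrite -h.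
have et : (val i).1 = (val i').1 by rewrite (class_related_type ij) (class_related_type i'j).
have [e ei] := class_letter_mem neg_clsP i; have el := nclass_loop ei.
have [e' ei'] := class_letter_mem neg_clsP i'; have el' := nclass_loop ei'.
rewrite -et in el'.
have /andP[_ ci] := valP i; have /and3P[_ tI _] := neg_clsP (val i).1.
apply: (same_class neg_clsP et ei ei'); rewrite (def_pblock tI ci ei).
rewrite (nclassE ei el'); apply/forall_inP => f fl; apply/eqP.
have /andP[i0 _] := valP i.
have [k /pkind_inr fk _] := pkind_loop i0 fl.
by rewrite !mem_Rel // -(class_relatedE ei fk) -(class_relatedE ei' fk) h.
Qed.

Lemma pclass_ext (j j' : pletter) :
  class_related^~ j =1 class_related^~ j' -> j = j'.
Proof.
move=> h; have [i ij] := exists_pos_related j.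
have ij' : class_related i j' by rewrite -h.
have et : (val j).1 = (val j').1 by rewrite -(class_related_type ij) -(class_related_type ij').
have [f fj] := class_letter_mem pos_clsP j; have fl := pclass_loop fj.
have [f' fj'] := class_letter_mem pos_clsP j'; have fl' := pclass_loop fj'.
rewrite -et in fl'.
have /andP[_ cj] := valP j; have /and3P[_ tI _] := pos_clsP (val j).1.
apply: (same_class pos_clsP et fj fj'); rewrite (def_pblock tI cj fj).
rewrite (pclassE fj fl'); apply/forall_inP => e el; apply/eqP.
have /andP[j0 _] := valP j.
have [k /nkind_inr ek _] := nkind_loop j0 el.
by rewrite !mem_Rel // -(class_relatedE ek fj) -(class_relatedE ek fj'); exact: h.
Qed.

Lemma eta_pred (v q : vertex G) : v \in P1 G -> Eneg q v != set0 -> eta v = q.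
Proof.
rewrite inE => /cards1P[q0 ep] qv.
have eq0 u : (u \in predecessors v) -> u = q0 by rewrite ep inE => /eqP.
rewrite /eta; case: pickP => [u uv|/(_ q)]; last by rewrite inE qv.
by rewrite (eq0 u uv) [q](eq0 q) // inE.
Qed.

(** This is (iii), as eta(p_l) = p_(l-1). It is the reason why links carry no letter. *)
Lemma links_related (l : 'I_K.+1) e f : 0 < l -> e \in neg_links l ->
  f \in pos_links l -> related e f.
Proof.
move=> l0 el fl; case: famG => _ _ _ h _.
have := h l l0; rewrite inE => /andP[P1l].
have -> : eta (p l) = p (inord l.-1).
  by apply: eta_pred => //; apply: neg_links_neq0.
move/eqP => eR; have : (e, f) \in setX (neg_links l) (pos_links l).
  by rewrite in_setX el fl.
by rewrite -eR inE => /andP[].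
Qed.

(** For K = 1 from (iv), as eta(p_0) = p_1; for K > 1 classes at p_1 and p_2 are never related. *)
Lemma exists_unrelated : exists i j, ~~ class_related i j.
Proof.
case: famG => _ _ _ _ hK.
have l1K : 1 < K.+1 by [].
pose l1 : 'I_K.+1 := Ordinal l1K; have l10 : 0 < l1 by [].
have [K1|K2] : K = 1 \/ 1 < K by lia.
  move: (hK K1); rewrite inE => /andP[nR P0].
  have e0 : eta (p ord0) = p l1.
    by apply: eta_pred => //; apply: neg_loops_neq0.
  move: nR; rewrite inE P0 /= e0 => nR.
  have [[e f]] : exists x, x \in setX (neg_loops l1) (pos_loops l1) :\: Rel (p l1) (p ord0).
    apply/set0Pn; rewrite setD_eq0; apply: contra nR => sub.
    by rewrite eqEsubset sub andbT; apply/subsetP => x; rewrite inE => /andP[].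
  rewrite inE in_setX => /andP[nref /andP[el fl]].
  have [i /nkind_inr ei _] := nkind_loop l10 el.
  have [j /pkind_inr fj _] := pkind_loop l10 fl.
  by exists i, j; rewrite (class_relatedE ei fj) -(mem_Rel el fl).
pose l2 : 'I_K.+1 := Ordinal (K2 : 2 < K.+1); have l20 : 0 < l2 by [].
have /set0Pn[e el] := neg_loops_neq0 l10; have /set0Pn[f fl] := pos_loops_neq0 l20.
have [i _ ei] := nkind_loop l10 el; have [j _ ej] := pkind_loop l20 fl.
by exists i, j; apply/negP => /class_related_type; rewrite ei ej.
Qed.

Lemma family_chain_ok : chain_ok family_chain.
Proof.
split=> //.
- exact: (half_chain_kind neg_cover neg_loops_inj neg_links_inj neg_loop_link
            neg_loops_neq0 neg_links_neq0 neg_clsP).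
- exact: (half_chain_kind pos_cover pos_loops_inj pos_links_inj pos_loop_link
            pos_loops_neq0 pos_links_neq0 pos_clsP).
- by move=> i j /class_related_type e; rewrite /= /letter_type e.
- split; [exact: exists_neg_related | exact: exists_pos_related
         | exact: nclass_ext | exact: pclass_ext | exact: exists_unrelated].
Qed.

End FamilyChain.

(** * Admissible words and the values of their classes *)

Section Admissible.
Variables (K : nat) (G : Rgraph) (p : 'I_K.+1 -> vertex G).
Hypothesis famG : family_conditions p.
Hypothesis K0 : 0 < K.

Local Notation C := (family_chain p).

Definition vertex_index (v : vertex G) : nat :=
  if [pick l | p l == v] is Some l then l : nat else 0.

Lemma vertex_indexK l : vertex_index (p l) = l.
Proof.
rewrite /vertex_index; case: pickP => [l' /eqP/(p_inj famG) -> //|/(_ l)].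
by rewrite eqxx.
Qed.

Lemma vertex_index_inj : injective vertex_index.
Proof.
have [[q _ pK] _ _ _ _] := famG.
by move=> u v; rewrite -(pK u) -(pK v) !vertex_indexK => /val_inj ->.
Qed.

Lemma csrcE (a : edge G) : @csrc C a = vertex_index (esrc a).
Proof.
case: a => e /=.
  have [l l0 [el|el]] := neg_cover famG e.
    have [i -> ti] := nkind_loop famG l0 el; rewrite /= /letter_type ti.
    by move: el; rewrite inE => /andP[/eqP -> _]; rewrite vertex_indexK.
  have /(nkind_inl famG) -> : exists l' : 'I_K.+1, [/\ l = l' :> nat, 0 < l' & e \in neg_links p l'].
    by exists l.
  move: el; rewrite inE => /andP[/eqP -> _]; rewrite vertex_indexK /= inordK //.
  exact: leq_ltn_trans (leq_pred _) (ltn_ord l).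
have [l l0 [el|el]] := pos_cover famG e.
  have [i -> ti] := pkind_loop famG l0 el; rewrite /=.
  by move: el; rewrite inE => /andP[/eqP -> _]; rewrite vertex_indexK.
have /(pkind_inl famG) -> : exists l' : 'I_K.+1, [/\ l = l' :> nat, 0 < l' & e \in pos_links p l'].
  by exists l.
by move: el; rewrite inE => /andP[/eqP -> _]; rewrite vertex_indexK.
Qed.

Lemma ctgtE (a : edge G) : @ctgt C a = vertex_index (etgt a).
Proof.
case: a => e /=.
  have [l l0 [el|el]] := neg_cover famG e.
    have [i -> ti] := nkind_loop famG l0 el; rewrite /=.
    by move: el; rewrite inE => /andP[_ /eqP ->]; rewrite vertex_indexK.
  have /(nkind_inl famG) -> : exists l' : 'I_K.+1, [/\ l = l' :> nat, 0 < l' & e \in neg_links p l'].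
    by exists l.
  by move: el; rewrite inE => /andP[_ /eqP ->]; rewrite vertex_indexK.
have [l l0 [el|el]] := pos_cover famG e.
  have [i -> ti] := pkind_loop famG l0 el; rewrite /= /letter_type ti.
  by move: el; rewrite inE => /andP[_ /eqP ->]; rewrite vertex_indexK.
have /(pkind_inl famG) -> : exists l' : 'I_K.+1, [/\ l = l' :> nat, 0 < l' & e \in pos_links p l'].
  by exists l.
move: el; rewrite inE => /andP[_ /eqP ->]; rewrite vertex_indexK /= inordK //.
exact: leq_ltn_trans (leq_pred _) (ltn_ord l).
Qed.

(* Together with the value, an invariant of the defining relations. *)
Fixpoint gconn (u : nat) (w : seq (sgen G)) (v : nat) : bool :=
  match w with
  | [::] => u == v
  | Unit q :: w' => (vertex_index q == u) && gconn u w' v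
  | Edge a :: w' =>
      (vertex_index (esrc a) == u) && gconn (vertex_index (etgt a)) w' v
  end.

Definition gletter (x : sgen G) := if x is Edge a then @cletter C a else None.

(** A word denotes its possible ends together with its value, and zero denotes nothing; so a word
    with a denotation is nonzero in S(G). *)
Definition sem (a : sword G) (u v : nat) (m : nform (nletter p) (pletter p)) : Prop :=
  if a is Some w then gconn u w v /\ mval (crel C) (pmap gletter w) = Some m
  else False.

Lemma gconn_cat u w1 w2 v :
  gconn u (w1 ++ w2) v <-> exists2 z, gconn u w1 z & gconn z w2 v.
Proof.
elim: w1 u => [|[q|a] w1 IH] u /=.
- by split=> [h|[z /eqP->]] //; exists u.
- split=> [/andP[-> /IH]|[z /andP[-> h1] h2]] //.
  by apply/IH; exists z.
- split=> [/andP[-> /IH]|[z /andP[-> h1] h2]] //.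
  by apply/IH; exists z.
Qed.

Lemma sem_mul a b u v m : sem (smul a b) u v m <->
  exists z m1 m2, [/\ sem a u z m1, sem b z v m2 &
    foldl (mstep (crel C)) (Some m1) (nword m2) = Some m].
Proof.
case: a b => [w1|] [w2|] /=; last first.
- by split=> // -[? [? [? []]]].
- by split=> // -[? [? [? []]]].
- by split=> // -[? [? [? []]]].
rewrite gconn_cat pmap_cat mval_cat foldl_mval; split.
  case=> -[z h1 h2]; case e2: (mval _ (pmap gletter w2)) => [m2|] //.
  case e1: (mval _ (pmap gletter w1)) => [m1|]; last by rewrite foldl_mstep_None.
  by exists z, m1, m2.
case=> z [m1 [m2 [[h1 ->] [h2 ->]] ->]]; split=> //; by exists z.
Qed.

Lemma pair_value (f : nedge G) (g : pedge G) : ntgt f = psrc g ->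
  mval (crel C) (pmap (@cletter C) [:: inl f; inr g]) =
  if related f g then Some ([::], [::]) else None.
Proof.
move=> e; rewrite /=; have [l l0 [fl|fl]] := neg_cover famG f.
  have [i fi _] := nkind_loop famG l0 fl.
  have [l' l0' [gl|gl]] := pos_cover famG g; last first.
    move: fl gl; rewrite !inE => /andP[_ /eqP ft] /andP[/eqP gs _].
    by have := p_neq0 famG l0'; rewrite -gs -e ft eqxx.
  have [j gj _] := pkind_loop famG l0' gl; rewrite fi gj /= /mval /=.
  move/(nkind_inr famG): fi => fi; move/(pkind_inr famG): gj => gj.
  by rewrite (class_relatedE famG fi gj).
have [l' l0' [gl|gl]] := pos_cover famG g.
  move: fl gl; rewrite !inE => /andP[_ /eqP ft] /andP[/eqP gs _].
  by have := p_neq0 famG l0; rewrite -ft e gs eqxx.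
have ell' : l = l'.
  apply: (p_inj famG); move: fl gl; rewrite !inE => /andP[_ /eqP <-].
  by case/andP=> [/eqP <- _].
rewrite -ell' in gl; rewrite (links_related famG l0 fl gl).
have -> : nkind p f = inl (l : nat) by apply/(nkind_inl famG); exists l.
have -> // : pkind p g = inl (l : nat) by apply/(pkind_inl famG); exists l.
Qed.

Lemma related_ends (f : nedge G) (g : pedge G) : related f g ->
  ntgt f = psrc g /\ ptgt g = nsrc f.
Proof.
case/related_Rel=> q [r]; rewrite !inE /= => /andP[/andP[]].
by move=> /andP[/eqP -> /eqP ->] /andP[/eqP -> /eqP ->].
Qed.

Lemma sem_defining a b u v m : defining_relation a b -> sem a u v m <-> sem b u v m.
Proof.
case=> {a b} [q|q r qr|e|e|f g q r|f g nfg].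
- by rewrite /= andbA andbb.
- split=> // -[/andP[/eqP <- /andP[/eqP/vertex_index_inj]]] rq.
  by case: qr.
- by rewrite /= andbA andbb.
- by rewrite /= eqxx.
- rewrite inE => /andP[fgR ref]; have [ft gt] := related_ends ref.
  have -> : q = nsrc f by move: fgR; rewrite !inE /= => /andP[/andP[/eqP-> _] _].
  have := pair_value ft; rewrite ref /= => ->.
  by rewrite ft gt eqxx /=; case: eqP => // ->.
(* Unrelated edges that do not meet fail connectivity; if they meet, their value is [None] by
   [pair_value]. *)
- split=> // -[/= /andP[_ /andP[/eqP/vertex_index_inj e _]]].
  by have := pair_value (esym e); rewrite (negPf nfg) /= => ->.
Qed.

Lemma sem_eq a b : sg_eq a b -> forall u v m, sem a u v m <-> sem b u v m.
Proof.
elim=> {a b} [a b ab|a|a b _ IH|a b c _ IH1 _ IH2|a a' b b' _ IH1 _ IH2] u v m //.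
- exact: sem_defining.
- exact: iff_sym.
- exact: iff_trans (IH1 u v m) (IH2 u v m).
- by split=> /sem_mul[z [m1 [m2 [/IH1 h1 /IH2 h2 h]]]]; apply/sem_mul; exists z, m1, m2.
Qed.

Lemma gconn_edges u (w : seq (edge G)) v : gconn u (map (@Edge G) w) v = @conn C u w v.
Proof. by elim: w u => //= a w IH u; rewrite IH csrcE ctgtE. Qed.

Lemma gletter_edges (w : seq (edge G)) :
  pmap gletter (map (@Edge G) w) = pmap (@cletter C) w.
Proof. by elim: w => //= a w ->. Qed.

Lemma good_sem (w : seq (edge G)) :
  @good C w <-> exists u v m, sem (Some (map (@Edge G) w)) u v m.
Proof.
rewrite /good /cval; split=> [[[u [v c]]]|[u [v [m]]]].
  case e: (mval _ _) => [m|] // _; exists u, v, m.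
  by rewrite /= gconn_edges gletter_edges.
rewrite /= gconn_edges gletter_edges => -[c ->].
by split=> //; exists u, v.
Qed.

Lemma sg_context (a b x : seq (sgen G)) (s : sword G) :
  sg_eq (Some x) s -> sg_eq (Some (a ++ x ++ b)) (smul (smul (Some a) s) (Some b)).
Proof.
move=> h; rewrite catA -[Some _]/(smul (smul (Some a) (Some x)) (Some b)).
apply: sg_mul; last exact: sg_refl.
apply: sg_mul; [exact: sg_refl | exact: h].
Qed.

Definition reduced_word (P : seq (pedge G)) (N : seq (nedge G)) : seq (edge G) :=
  map inr P ++ map inl N.

Lemma reduced_word_value P N : mval (crel C) (pmap (@cletter C) (reduced_word P N)) <> None.
Proof.
have [U eU] : exists U, pmap (@cletter C) (map inr P) = map inr U.
  elim: P => [|f P [U eU]] /=; first by exists [::].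
  by rewrite eU; case: (pkind p f) => [_|j]; [exists U | exists (j :: U)].
have [V eV] : exists V, pmap (@cletter C) (map inl N) = map inl V.
  elim: N => [|f N [V eV]] /=; first by exists [::].
  by rewrite eV; case: (nkind p f) => [_|j]; [exists V | exists (j :: V)].
by rewrite pmap_cat eU eV /mval foldl_cat foldl_inr foldl_inl.
Qed.

(** For the converse of [sem_eq]: every nonempty product of edges is zero or has such a form, and
    these forms have a denotation. *)
Definition normal_form (w : seq (sgen G)) :=
  (exists q, w = [:: Unit q]) \/
  exists P N u v, [/\ w = map (@Edge G) (reduced_word P N), w <> [::] &
                      @conn C u (reduced_word P N) v].

Lemma normal_form_edge (L : seq (edge G)) (e : edge G) u v :
  L <> [::] -> @conn C u L v ->
  (exists P N, L = reduced_word P N) ->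
  sg_eq (Some (rcons (map (@Edge G) L) (Edge e))) None \/
  exists2 w', normal_form w' & sg_eq (Some (rcons (map (@Edge G) L) (Edge e))) (Some w').
Proof.
case/lastP: L => // L a _; rewrite conn_rcons map_rcons => /andP[cL /eqP av].
case=> P [N eL]; rewrite -!cats1 -catA /=.
have [ea|ne] := eqVneq (etgt a) (esrc e); last first.
  (* Where the ends do not meet, the two units inserted at the junction are orthogonal. *)
  left; have h1 : sg_eq (Some [:: Edge a; Edge e])
      (Some ([:: Edge a; Unit (etgt a)] ++ [:: Unit (esrc e); Edge e])).
    apply: sg_sym; apply: (@sg_mul _ (Some _) (Some [:: Edge a]) (Some _) (Some [:: Edge e])).
      exact/sg_rel/unit_tgt.
    exact/sg_rel/unit_src.
  have h2 : sg_eq (Some [:: Edge a; Edge e]) None.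
    apply: sg_trans h1 _.
    have := @sg_context [:: Edge a] [:: Edge e]
      [:: Unit (etgt a); Unit (esrc e)] None.
    by apply; apply/sg_rel/unit_orth/eqP.
  by have := sg_context (map (@Edge G) L) [::] h2.
have cfull : @conn C u (L ++ [:: a; e]) (@ctgt C e).
  apply/conn_cat; exists (@csrc C a) => //=.
  by rewrite !csrcE !ctgtE ea !eqxx.
have keep : (exists P' N', L ++ [:: a; e] = reduced_word P' N') ->
    exists2 w', normal_form w' &
      sg_eq (Some (map (@Edge G) L ++ [:: Edge a; Edge e])) (Some w').
  case=> P' [N' e']; exists (map (@Edge G) L ++ [:: Edge a; Edge e]); last exact: sg_refl.
  right; exists P', N', u, (@ctgt C e); split; rewrite -?e' ?map_cat //.
  by case: (L).
have eLe : L ++ [:: a; e] = reduced_word P N ++ [:: e] by rewrite -eL -cats1 -catA.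
case: e ea cfull keep eLe => [f|g] ea cfull keep eLe.
  right; apply: keep; exists P, (rcons N f).
  by rewrite eLe /reduced_word map_rcons -cats1 catA.
case/lastP: N eL eLe => [|N f] eL eLe.
  right; apply: keep; exists (rcons P g), [::].
  by rewrite eLe /reduced_word /= !cats0 map_rcons cats1.
have [eL' ea'] : L = reduced_word P N /\ a = inl f.
  by move: eL; rewrite /reduced_word map_rcons -rcons_cat => /rcons_inj[-> ->].
subst a; have [ref|nref] := boolP (related f g); last first.
  left; have := sg_context (map (@Edge G) L) [::] (sg_rel (mul_unrelated nref)).
  by [].
have fg : sg_eq (Some [:: Edge (inl f); Edge (inr g)]) (Some [:: Unit (nsrc f)]).
  apply/sg_rel/mul_related; rewrite mem_Rel //; first exact: mem_Eneg.
  have [_ <-] := related_ends ref; rewrite /= in ea; rewrite ea.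
  exact: mem_Epos.
right; have h1 := sg_context (map (@Edge G) L) [::] fg.
rewrite cats0 in h1.
(* The cancelled pair leaves the unit at the source of [f]: it is the whole product, or it is
   absorbed by the preceding edge [b]. *)
case/lastP: L cL {eL eLe keep cfull} eL' h1 => [|L b] cL eL h1.
  by exists [:: Unit (nsrc f)]; [left; exists (nsrc f) | exact: h1].
exists (map (@Edge G) (rcons L b)).
  right; exists P, N, u, (@csrc C (inl f)); split=> //; first by rewrite eL.
    by rewrite map_rcons; case: (map _ L).
  by rewrite -eL.
apply: sg_trans h1 _; rewrite map_rcons -cats1 /= -catA /=.
have eb : etgt b = nsrc f.
  by move: cL; rewrite conn_rcons !csrcE ctgtE => /andP[_ /eqP/vertex_index_inj].
have := sg_context (map (@Edge G) L) [::] (sg_rel (unit_tgt b)).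
by rewrite /= eb cats0 -catA.
Qed.

Lemma zero_or_normal_form (w : seq (edge G)) : w <> [::] ->
  sg_eq (Some (map (@Edge G) w)) None \/
  exists2 w', normal_form w' & sg_eq (Some (map (@Edge G) w)) (Some w').
Proof.
elim/last_ind: w => // w e IH _; have [->|nw] := eqVneq w [::].
  right; exists [:: Edge e]; last exact: sg_refl.
  right; case: e => e.
    exists [::], [:: e], (@csrc C (inl e)), (@ctgt C (inl e)); split=> //.
    by rewrite /= !eqxx.
  exists [:: e], [::], (@csrc C (inr e)), (@ctgt C (inr e)); split=> //.
  by rewrite /= !eqxx.
rewrite map_rcons -cats1.
case: (IH (elimN eqP nw)) => [h|[w' nf h]].
  by left; have := sg_context [::] [:: Edge e] h.
have h1 : sg_eq (Some (map (@Edge G) w ++ [:: Edge e])) (Some (w' ++ [:: Edge e])).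
  exact: (@sg_context [::] [:: Edge e] _ (Some w') h).
case: nf => [[q eq]|[P [N [u [v [ew nw' c]]]]]].
  rewrite eq /= in h1; have [qe|ne] := eqVneq q (esrc e).
    right; exists [:: Edge e].
      right; case: (e) => a.
        exists [::], [:: a], (@csrc C (inl a)), (@ctgt C (inl a)); split=> //.
        by rewrite /= !eqxx.
      exists [:: a], [::], (@csrc C (inr a)), (@ctgt C (inr a)); split=> //.
      by rewrite /= !eqxx.
    by apply: sg_trans h1 _; rewrite qe; apply/sg_rel/unit_src.
  left; apply: sg_trans h1 _.
  have h2 : sg_eq (Some [:: Unit q; Edge e]) (Some ([:: Unit q] ++ [:: Unit (esrc e); Edge e])).
    apply: sg_sym; apply: (@sg_mul _ (Some [:: Unit q]) (Some [:: Unit q]) (Some _) (Some [:: Edge e])).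
      exact: sg_refl.
    exact/sg_rel/unit_src.
  apply: sg_trans h2 _.
  have := @sg_context [::] [:: Edge e] [:: Unit q; Unit (esrc e)] None.
  by apply; apply/sg_rel/unit_orth/eqP.
have nL : reduced_word P N <> [::] by move=> eP; apply: nw'; rewrite ew eP.
have eL : exists P' N', reduced_word P N = reduced_word P' N' by exists P, N.
have [h2|[w'' nf h2]] := @normal_form_edge _ e _ _ nL c eL.
- by left; apply: sg_trans h1 _; rewrite ew cats1.
- by right; exists w'' => //; apply: sg_trans h1 _; rewrite ew cats1.
Qed.

Lemma admissible_good (w : seq (edge G)) : w <> [::] -> admissible w <-> @good C w.
Proof.
move=> nw; split=> [adm|/good_sem[u [v [m h]]] e]; last first.
  by have := iffLR (sem_eq e u v m) h.
case: (zero_or_normal_form nw) => [/adm //|[w' nf h]].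
apply/good_sem; case: nf => [[q eq]|[P [N [u [v [ew _ c]]]]]].
  exists (vertex_index q), (vertex_index q), ([::], [::]).
  by apply/(sem_eq h); rewrite eq /= eqxx.
case e: (mval (crel C) (pmap (@cletter C) (reduced_word P N))) => [m|]; last first.
  by have := @reduced_word_value P N.
exists u, v, m; apply/(sem_eq h); rewrite ew /= gconn_edges gletter_edges.
by [].
Qed.

Lemma rgraph_shiftE (x : int -> edge G) :
  rgraph_shift G x <-> @chain_shift C x.
Proof.
split=> [h i [|n]|h i n].
- split; last by [].
  by exists 0, 0; rewrite /= eqxx.
- by apply/admissible_good => //; apply: h.
- by apply/admissible_good => //; apply: h.
Qed.

End Admissible.

(** * Condition (D) and the isomorphism *)

(* In the notation of the header, [d'], [S'] belong to the second graph, [A l] is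
   the product of the first [d k], and [Gam l] is the product of the gcds of the
   cardinalities of the two kinds of classes of the second graph. *)
Section Arithmetic.
Variables (K : nat) (d d' S S' A A' Gam : nat -> nat).
Hypotheses (K0 : 0 < K)
  (A_0 : A 0 = 1) (A_S : forall l, A l.+1 = A l * d l.+1)
  (A'_0 : A' 0 = 1) (A'_S : forall l, A' l.+1 = A' l * d' l.+1)
  (d_pos : forall l, 0 < l <= K -> 0 < d l)
  (d'_pos : forall l, 0 < l <= K -> 0 < d' l)
  (d_K : d K.+1 = 0) (d'_K : d' K.+1 = 0)
  (S_pos : forall l, 0 < l <= K -> 0 < S l)
  (S_0 : S 0 = 0) (S'_0 : S' 0 = 0).

Definition partial_sums (d S : nat -> nat) l := \sum_(0 <= k < l.+1) (d k.+1 + S k).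

Hypotheses
  (AGam : forall l, 0 < l <= K -> A l = A' l * Gam l)
  (AS : forall l, 0 < l <= K -> A l * S l = A' l * S' l)
  (T_eq : forall l, 0 < l <= K -> partial_sums d S l = partial_sums d' S' l)
  (E_eq : d 1 * partial_sums d S 1 + d 2 * partial_sums d S 2 +
            S 1 * (partial_sums d S 1 + d 1) =
          d' 1 * partial_sums d' S' 1 + d' 2 * partial_sums d' S' 2 +
            S' 1 * (partial_sums d' S' 1 + d' 1))
  (K1 : K = 1 -> gcdn (d 1) (S 1) = 1 /\ 1 < S 1).

Lemma A'_pos l : l <= K -> 0 < A' l.
Proof.
elim: l => [|l IH] lK; first by rewrite A'_0.
by rewrite A'_S muln_gt0 IH ?d'_pos //; lia.
Qed.

Lemma partial_sumsS (u v : nat -> nat) l :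
  partial_sums u v l.+1 = partial_sums u v l + (u l.+2 + v l.+1).
Proof. by rewrite /partial_sums big_nat_recr. Qed.

Lemma partial_sums1 (u v : nat -> nat) : v 0 = 0 ->
  partial_sums u v 1 = u 1 + (u 2 + v 1).
Proof. by move=> v0; rewrite partial_sumsS /partial_sums big_nat1 v0 addn0. Qed.

Lemma S'_Gam l : 0 < l <= K -> S' l = Gam l * S l.
Proof.
move=> lK; have := AS lK; rewrite AGam // -mulnA => /eqP.
have a' : 0 < A' l by apply: A'_pos; lia.
by rewrite eqn_pmul2l // => /eqP.
Qed.

(** Descent from K. The sums at l and l - 1 give d_(l+1) + S_l = d'_(l+1) + S'_l; since Gam (l + 1)
    = 1, or both d vanish when l = K, the right side is Gam l times the left. *)
Lemma Gam_step l : 1 < l <= K -> Gam l = 1.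
Proof.
move=> /andP[l1 lK]; have [k] := ubnP (K - l); elim: k l l1 lK => // k IH l l1 lK lt.
have tau : d l.+1 + S l = d' l.+1 + S' l.
  have l1' : 0 < l.-1 <= K by lia.
  have l1'' : 0 < l <= K by lia.
  have := T_eq l1''; have := T_eq l1'.
  have -> : l = l.-1.+1 by lia.
  by rewrite /= !partial_sumsS => -> /addnI.
have lK' : 0 < l <= K by lia.
have Sl := S_pos lK'.
have dl : d' l.+1 = Gam l * d l.+1.
  have [e|lt'] : l = K \/ l < K by lia.
    by rewrite e d_K d'_K muln0.
  have g1 : Gam l.+1 = 1 by apply: IH; lia.
  have hl : 0 < l.+1 <= K by lia.
  have := AGam hl; rewrite g1 muln1 A_S A'_S AGam // -mulnA => /eqP.
  by rewrite eqn_pmul2l ?A'_pos // => /eqP <-.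
move: tau; rewrite S'_Gam // dl; nia.
Qed.

(** For K = 1 the sums give (Gam 1 - 1)(d'_1 - S_1) = 0, and d'_1 = S_1 would make S_1 > 1 a divisor
    of d_1. For K > 1 first d_2 = d'_2 is derived, and then d_1 d_2 = d'_1 d'_2 yields d_1 =
    d'_1. *)
Lemma Gam1 : Gam 1 = 1.
Proof.
have h1 : 0 < 1 <= K by lia.
have A1 : A 1 = d 1 by rewrite A_S A_0 mul1n.
have A'1 : A' 1 = d' 1 by rewrite A'_S A'_0 mul1n.
have eG : d 1 = d' 1 * Gam 1 by rewrite -A1 -A'1 AGam.
have eS := S'_Gam h1; have eT := T_eq h1.
have d1 := d_pos h1; have d1' := d'_pos h1; have S1 := S_pos h1.
have [eK|K2] : K = 1 \/ 1 < K by lia.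
  have [gcd1 S12] := K1 eK.
  move: eT; rewrite !partial_sums1 // -eK d_K d'_K eK !add0n eG eS => eT.
  have [//|ne] : Gam 1 = 1 \/ Gam 1 != 1 by case: eqP; [left|right].
  have e : d' 1 = S 1 by nia.
  by move: gcd1; rewrite eG e gcdnC gcdnMr; lia.
have h2 : 0 < 2 <= K by lia.
have G2 : Gam 2 = 1 by apply: Gam_step; lia.
have eT2 := T_eq h2.
have tau : d 3 + S 2 = d' 3 + S' 2.
  by move: eT2; rewrite (partial_sumsS d) (partial_sumsS d') eT => /addnI.
have SS : S 1 * d 1 = S' 1 * d' 1 by rewrite eG eS; lia.
have S2 := S_pos h2.
have d2 : d 2 = d' 2.
  have := E_eq; rewrite (partial_sumsS d S 1) (partial_sumsS d' S' 1) -tau -eT.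
  have := partial_sums1 d S_0; have := partial_sums1 d' S'_0; rewrite -eT.
  set T := partial_sums d S 1 => e' e; have : 0 < d 3 + S 2 by lia.
  move: (d 3 + S 2) => t t0.
  (* As T = d_1 + d_2 + S_1 and d_1 S_1 agree on both sides, [E_eq] reduces to d_2 t = d'_2 t with t
     = d_3 + S_2 > 0. *)
  have expand x y z : x * T + y * (T + t) + z * (T + x) =
    T * (x + (y + z)) + y * t + z * x by lia.
  rewrite !expand -e -e' SS => /addIn/addnI/eqP.
  by rewrite eqn_pmul2r // => /eqP.
have := AGam h2; rewrite G2 muln1 !A_S !A'_S A_0 A'_0 !mul1n d2 => /eqP.
have d2' := d'_pos h2.
by rewrite eqn_pmul2r // eG => /eqP; nia.
Qed.

Lemma Gam_eq1 l : 0 < l <= K -> Gam l = 1.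
Proof.
move=> lK; have [->|l1] : l = 1 \/ 1 < l by lia.
  exact: Gam1.
by apply: Gam_step; lia.
Qed.

Lemma A_eq l : l <= K -> A l = A' l.
Proof.
case: l => [|l] lK; first by rewrite A_0 A'_0.
by rewrite AGam ?Gam_eq1 ?muln1.
Qed.

Lemma arithmetic_rigidity l : 0 < l <= K ->
  [/\ Gam l = 1, d l = d' l & S l = S' l].
Proof.
move=> lK; split; first exact: Gam_eq1.
  case: l lK => // l lK; have := @A_eq l.+1 lK.
  rewrite A_S A'_S A_eq; last by lia.
  by move/eqP; rewrite eqn_pmul2l ?A'_pos; [move/eqP | lia..].
by rewrite S'_Gam // Gam_eq1 // mul1n.
Qed.
End Arithmetic.

Definition gcd_nclasses (C : chain) l :=
  \big[gcdn/0]_(i : lneg C | tneg i == l) num_nclass i.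

Definition gcd_pclasses (C : chain) l :=
  \big[gcdn/0]_(j : lpos C | tpos j == l) num_pclass j.

Definition chain_condition (C : chain) := forall l, 0 < l <= clen C ->
  [/\ gcdn (num_neg C l * num_pos C l) (related_pairs C l) = 1,
      gcd_nclasses C l = 1 & gcd_pclasses C l = 1].

Lemma muln_big_gcd (T : finType) (P : pred T) (F : T -> nat) c :
  c * \big[gcdn/0]_(i | P i) F i = \big[gcdn/0]_(i | P i) (c * F i).
Proof. by apply: big_morph; [exact: muln_gcdr | exact: muln0]. Qed.

Section ChainPositivity.
Variable C : chain.
Hypothesis okC : chain_ok C.

Lemma num_neg_gt0 l : 0 < l <= clen C -> 0 < num_neg C l.
Proof.
have [_ [_ _ h _ _] _ _ _] := okC; move=> /h[e ek].
by apply/card_gt0P; exists e; rewrite inE ek.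
Qed.

Lemma num_nclass_gt0 (i : lneg C) : 0 < num_nclass i.
Proof.
have [_ [_ _ _ h _] _ _ _] := okC; have [e ek] := h i.
by apply/card_gt0P; exists e; rewrite inE ek.
Qed.

Lemma neg_paths_gt0 l : l <= clen C -> 0 < neg_paths C l.
Proof.
elim: l => [|l IH] lK; first by rewrite neg_paths0.
by rewrite neg_pathsS muln_gt0 IH ?num_neg_gt0 //; lia.
Qed.

Lemma tneg_le (i : lneg C) : 0 < tneg i <= clen C.
Proof. by have [_ [h _ _ _ _] _ _ _] := okC. Qed.

Lemma exists_type l : 0 < l <= clen C -> exists i : lneg C, tneg i = l.
Proof. have [_ [_ _ _ _ h] _ _ _] := okC; exact: h. Qed.

End ChainPositivity.

Section ChainComparison.
Variables (C D : chain).
Hypotheses (okC : chain_ok C) (okD : chain_ok D).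
Variable f : lneg C -> lneg D.
Hypothesis count_f : forall i m,
  #|periodic_words (inl (f i) : lneg D + lpos D) m| =
  #|periodic_words (inl i : lneg C + lpos C) m|.

Lemma walks_f i m : num_nclass i * walks (C := C) m (tneg i) [::] =
  num_nclass (f i) * walks (C := D) m (tneg (f i)) [::].
Proof.
have /eqP := count_f i m.+1; rewrite !card_periodic_neg eqn_pmul2l //.
by move/eqP.
Qed.

Lemma walks_short m k : m < k -> walks (C := C) m k [::] = 0.
Proof. by move=> lt; apply: walks_small => //; rewrite /depth big_nil addn0. Qed.

End ChainComparison.

(** The shortest period with multiplier [inl i] has [tneg i] + 1 edges, so the counts determine the
    type. *)
Lemma tneg_le_f C D (f : lneg C -> lneg D) : chain_ok C -> chain_ok D ->
  (forall i m, #|periodic_words (inl (f i) : lneg D + lpos D) m| =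
     #|periodic_words (inl i : lneg C + lpos C) m|) ->
  forall i, tneg (f i) <= tneg i.
Proof.
move=> okC okD h i; rewrite leqNgt; apply/negP => lt.
have := walks_f h i (tneg i); rewrite walks_direct // (walks_short okD lt) muln0.
have := num_nclass_gt0 okC i; have := neg_paths_gt0 okC (l := tneg i).
have := tneg_le okC i; nia.
Qed.

Lemma tneg_ge_f C D (f : lneg C -> lneg D) : chain_ok C -> chain_ok D ->
  (forall i m, #|periodic_words (inl (f i) : lneg D + lpos D) m| =
     #|periodic_words (inl i : lneg C + lpos C) m|) ->
  forall i, tneg i <= tneg (f i).
Proof.
move=> okC okD h i; rewrite leqNgt; apply/negP => lt.
have := walks_f h i (tneg (f i)); rewrite walks_direct // (walks_short okC lt) muln0.
have := num_nclass_gt0 okD (f i); have := neg_paths_gt0 okD (l := tneg (f i)).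
have := tneg_le okD (f i); nia.
Qed.

Section ChainRigidity.
Variables (C D : chain).
Hypotheses (okC : chain_ok C) (okD : chain_ok D) (lenCD : clen C = clen D).
Variables (f : lneg C -> lneg D) (g : lpos C -> lpos D).
Hypotheses (bf : bijective f) (bg : bijective g)
  (fgR : forall i j, crel D (f i) (g j) = crel C i j)
  (fg_count : forall x m, #|periodic_words (sum_map f g x) m| = #|periodic_words x m|).

Local Notation K := (clen C).
Local Notation pos_paths C := (neg_paths (dual_chain C)).

Lemma tneg_f i : tneg (f i) = tneg i.
Proof.
have h i' := fg_count (inl i').
by apply/eqP; rewrite eqn_leq (tneg_le_f okC okD h) (tneg_ge_f okC okD h).
Qed.

(** Read off from a related negative class, which has the same type. *)
Lemma tpos_g j : tpos (g j) = tpos j.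
Proof.
have [_ _ _ hC [_ cols _ _ _]] := okC; have [_ _ _ hD _] := okD.
have [i ij] := cols j; rewrite -(hC i j ij) -tneg_f; symmetry.
by apply: hD; rewrite fgR.
Qed.

Lemma walks_f_type i m : num_nclass i * walks (C := C) m (tneg i) [::] =
  num_nclass (f i) * walks (C := D) m (tneg i) [::].
Proof. by rewrite (@walks_f C D f (fun i' => fg_count (inl i'))) tneg_f. Qed.

Lemma nclass_paths i : num_nclass i * neg_paths C (tneg i) =
  num_nclass (f i) * neg_paths D (tneg i).
Proof. by have := walks_f_type i (tneg i); rewrite !walks_direct. Qed.

Lemma pclass_paths j : num_pclass j * pos_paths C (tpos j) =
  num_pclass (g j) * pos_paths D (tpos j).
Proof.
have h : forall j m, #|@periodic_words (dual_chain D) (inl (g j)) m| =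
    #|@periodic_words (dual_chain C) (inl j) m|.
  by move=> k m; rewrite -!card_periodic_dual -(fg_count (inr k)).
have := @walks_f (dual_chain C) (dual_chain D) g h j (tpos j).
by rewrite /= tpos_g !walks_direct //; apply: dual_chain_ok.
Qed.

Lemma total_detours_eq l : 0 < l <= K -> total_detours C l = total_detours D l.
Proof.
move=> lK; have [i ti] := exists_type okC lK.
have := walks_f_type i l.+2; have := nclass_paths i; rewrite ti !walks_detour //.
move=> e; rewrite !mulnA e => /eqP; rewrite eqn_pmul2l; first by move/eqP.
by rewrite muln_gt0 (num_nclass_gt0 okD) neg_paths_gt0 // -lenCD; lia.
Qed.

Lemma two_detours_eq :
  num_neg C 1 * num_pos C 1 * total_detours C 1 +
  num_neg C 2 * num_pos C 2 * total_detours C 2 +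
  related_pairs C 1 * (total_detours C 1 + num_neg C 1 * num_pos C 1) =
  num_neg D 1 * num_pos D 1 * total_detours D 1 +
  num_neg D 2 * num_pos D 2 * total_detours D 2 +
  related_pairs D 1 * (total_detours D 1 + num_neg D 1 * num_pos D 1).
Proof.
have [K0 _ _ _ _] := okC; have h1 : 0 < 1 <= K by [].
have [i ti] := exists_type okC h1.
have := walks_f_type i 5; have := nclass_paths i; rewrite ti !walks_two_detours //.
rewrite !neg_pathsS !neg_paths0 !mul1n => e; rewrite !mulnA e => /eqP.
rewrite eqn_pmul2l; first by move/eqP.
by rewrite muln_gt0 (num_nclass_gt0 okD) num_neg_gt0 // -lenCD.
Qed.

Lemma related_pairs_paths l : neg_paths C l * pos_paths C l * related_pairs C l =
  neg_paths D l * pos_paths D l * related_pairs D l.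
Proof.
have [_ _ _ hC _] := okC.
rewrite /related_pairs (reindex f) /=; last exact: onW_bij.
rewrite !big_distrr /= [RHS](eq_bigl (fun i => tneg i == l)); last first.
  by move=> i; rewrite tneg_f.
apply: eq_bigr => i /eqP ti.
rewrite [\sum_(j | crel D _ j) _](reindex g) /=; last exact: onW_bij.
rewrite [X in _ = _ * (_ * X)](eq_bigl (fun j => crel C i j)); last by move=> j; rewrite fgR.
have := nclass_paths i; rewrite ti => e.
rewrite [LHS](_ : _ = (num_nclass i * neg_paths C l) *
  (pos_paths C l * \sum_(j | crel C i j) num_pclass j)); last by lia.
rewrite e big_distrr /= [in LHS](eq_bigr (fun j => num_pclass (g j) * pos_paths D l)).
  by rewrite -big_distrl /=; lia.
by move=> j /hC; rewrite ti => tj; rewrite mulnC tj pclass_paths.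
Qed.

(** The gcd of [nclass_paths] over the classes of type l. When the gcd on the left is 1, the ratio
    of path counts is a gcd of the other side. *)
Lemma nclass_gcd l : neg_paths C l * gcd_nclasses C l = neg_paths D l * gcd_nclasses D l.
Proof.
rewrite /gcd_nclasses [in RHS](reindex f) /=; last exact: onW_bij.
rewrite [in RHS](eq_bigl (fun i => tneg i == l)); last by move=> i; rewrite tneg_f.
rewrite !muln_big_gcd; apply: eq_bigr => i /eqP ti.
by have := nclass_paths i; rewrite ti mulnC => ->; rewrite mulnC.
Qed.

Lemma pclass_gcd l : pos_paths C l * gcd_pclasses C l = pos_paths D l * gcd_pclasses D l.
Proof.
rewrite /gcd_pclasses [in RHS](reindex g) /=; last exact: onW_bij.
rewrite [in RHS](eq_bigl (fun j => tpos j == l)); last by move=> j; rewrite tpos_g.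
rewrite !muln_big_gcd; apply: eq_bigr => j /eqP tj.
by have := pclass_paths j; rewrite tj mulnC => ->; rewrite mulnC.
Qed.

Lemma related_pairs_gt0 l : 0 < l <= K -> 0 < related_pairs C l.
Proof.
move=> lK; have [i ti] := exists_type okC lK.
have [_ _ _ _ [rows _ _ _ _]] := okC; have [j ij] := rows i.
rewrite /related_pairs (bigD1 i) ?ti //= (bigD1 j) //=.
have hi := num_nclass_gt0 okC i.
have hj : 0 < num_pclass j := @num_nclass_gt0 _ (dual_chain_ok okC) j.
by rewrite ltn_addr // muln_gt0 hi ltn_addr.
Qed.

(* All letters have the same type, and some pair of classes is unrelated. *)
Lemma related_pairs_gt1 : K = 1 -> 1 < related_pairs C 1.
Proof.
move=> K1; have [_ _ _ _ [rows cols _ _ [i0 [j0 nij]]]] := okC.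
have [j1 h1] := rows i0; have [i1 h2] := cols j0.
have t1 (i : lneg C) : tneg i = 1 by have := tneg_le okC i; lia.
have ne : i1 != i0 by apply: contraNneq nij => <-.
have posn i := num_nclass_gt0 okC i.
have posp j : 0 < num_pclass j := @num_nclass_gt0 _ (dual_chain_ok okC) j.
rewrite /related_pairs (bigD1 i0) ?t1 //= (bigD1 i1) ?t1 ?ne //=.
rewrite (bigD1 j1) //= [X in _ < _ + (_ * X + _)](bigD1 j0) //=.
have h3 : 0 < num_nclass i0 * (num_pclass j1 +
    \sum_(j | crel C i0 j && (j != j1)) num_pclass j).
  by rewrite muln_gt0 posn ltn_addr.
have h4 : 0 < num_nclass i1 * (num_pclass j0 +
    \sum_(j | crel C i1 j && (j != j0)) num_pclass j).
  by rewrite muln_gt0 posn ltn_addr.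
by move: h3 h4; lia.
Qed.

(** [arithmetic_rigidity] makes the product of the two gcds of [D] equal to 1, hence each of them,
    and identifies both arguments of the first gcd. *)
Lemma chain_condition_transfer : chain_condition C -> chain_condition D.
Proof.
move=> cC; have [K0 _ _ _ _] := okC.
have dokC := dual_chain_ok okC; have dokD := dual_chain_ok okD.
pose d (E : chain) l := num_neg E l * num_pos E l.
pose A (E : chain) l := neg_paths E l * pos_paths E l.
have A_S E l : A E l.+1 = A E l * d E l.+1.
  by rewrite /A /d !neg_pathsS -[num_neg (dual_chain E) _]/(num_pos E _); lia.
have A_0 E : A E 0 = 1 by rewrite /A !neg_paths0.
have npC l (lK : 0 < l <= K) : neg_paths C l = neg_paths D l * gcd_nclasses D l.
  by have := nclass_gcd l; have [_ -> _] := cC l lK; rewrite muln1.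
have ppC l (lK : 0 < l <= K) : pos_paths C l = pos_paths D l * gcd_pclasses D l.
  by have := pclass_gcd l; have [_ _ ->] := cC l lK; rewrite muln1.
have d_pos E (okE : chain_ok E) l : 0 < l <= clen E -> 0 < d E l.
  move=> lE; rewrite muln_gt0 num_neg_gt0 //=.
  exact: (@num_neg_gt0 _ (dual_chain_ok okE)).
have main l (lK : 0 < l <= K) : [/\ gcd_nclasses D l * gcd_pclasses D l = 1,
    d C l = d D l & related_pairs C l = related_pairs D l].
  apply: (@arithmetic_rigidity K (d C) (d D) (related_pairs C) (related_pairs D)
    (A C) (A D) (fun l => gcd_nclasses D l * gcd_pclasses D l)) => //.
  - exact: d_pos.
  - by rewrite lenCD; apply: d_pos.
  - by rewrite /d num_negS.
  - by rewrite /d lenCD num_negS.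
  - exact: related_pairs_gt0.
  - exact: related_pairs0.
  - exact: related_pairs0.
  - by move=> k kK; rewrite /A npC // ppC //; lia.
  - by move=> k _; apply: related_pairs_paths.
  - exact: total_detours_eq.
  - exact: two_detours_eq.
  - move=> K1; split; last exact: related_pairs_gt1.
    by have [|] := cC 1; rewrite ?K1.
move=> l; rewrite -lenCD => lK; have [eG dl <-] := main l lK.
rewrite -[num_neg D l * _]/(d D l) -dl.
have [-> _ _] := cC l lK; split=> //.
  by move/eqP: eG; rewrite muln_eq1 => /andP[/eqP].
by move/eqP: eG; rewrite muln_eq1 => /andP[_ /eqP].
Qed.

(** With all gcds of class sizes 1 on both sides, path counts agree; their successive quotients are
    the numbers of links, and [nclass_paths] gives the class sizes. *)
Lemma chain_numbers_eq : chain_condition C -> chain_condition D ->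
  [/\ forall i, num_nclass i = num_nclass (f i),
      forall j, num_pclass j = num_pclass (g j),
      num_neg C =1 num_neg D & num_pos C =1 num_pos D].
Proof.
move=> cC cD; have dokC := dual_chain_ok okC; have dokD := dual_chain_ok okD.
have np l : l <= K -> neg_paths C l = neg_paths D l.
  case: l => [|l] lK; first by rewrite !neg_paths0.
  have := nclass_gcd l.+1; have [_ -> _] := cC l.+1 lK.
  by have [|_ -> _] := cD l.+1; rewrite -?lenCD // !muln1.
have pp l : l <= K -> pos_paths C l = pos_paths D l.
  case: l => [|l] lK; first by rewrite !neg_paths0.
  have := pclass_gcd l.+1; have [_ _ ->] := cC l.+1 lK.
  by have [|_ _ ->] := cD l.+1; rewrite -?lenCD // !muln1.
have num_eq (E F : chain) : chain_ok E -> chain_ok F -> clen E = clen F ->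
    (forall l, l <= clen E -> neg_paths E l = neg_paths F l) ->
    num_neg E =1 num_neg F.
  move=> okE okF eK h l; have [->|l0] : l = 0 \/ 0 < l by lia.
    by rewrite !num_neg0.
  have [lK|lK] := leqP l (clen E); last first.
    have [_ [_ hE _ _ _] _ _ _] := okE; have [_ [_ hF _ _ _] _ _ _] := okF.
    rewrite /num_neg !eq_card0 // => e; rewrite inE; apply/eqP.
      by move/hF; rewrite -eK; lia.
    by move/hE; lia.
  case: l l0 lK => // l _ lK; have := h l.+1 lK; rewrite !neg_pathsS h; last by lia.
  by move/eqP; rewrite eqn_pmul2l ?neg_paths_gt0 //; [move/eqP | lia].
split.
- move=> i; have := nclass_paths i; have /andP[_ iK] := tneg_le okC i.
  rewrite np // => /eqP; rewrite eqn_pmul2r; first by move/eqP.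
  by rewrite neg_paths_gt0 // -lenCD.
- move=> j; have := pclass_paths j.
  have /andP[_ jK] := @tneg_le _ dokC j.
  rewrite pp // => /eqP; rewrite eqn_pmul2r; first by move/eqP.
  by rewrite neg_paths_gt0 //= -lenCD.
- exact: num_eq.
- exact: (num_eq _ _ dokC dokD).
Qed.

End ChainRigidity.

Section FamilyNumbers.
Variables (K : nat) (G : Rgraph) (p : 'I_K.+1 -> vertex G).
Hypothesis famG : family_conditions p.

Local Notation C := (family_chain p).

Lemma family_num_neg (l : 'I_K.+1) : 0 < l ->
  num_neg C l = #|Eneg (p (inord l.-1)) (p l)|.
Proof.
exact: (card_kind_link (neg_cover famG) (neg_loops_inj famG) (neg_links_inj famG)
  (neg_loop_link famG) (@neg_clsP _ _ p)).
Qed.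

Lemma family_num_pos (l : 'I_K.+1) : 0 < l ->
  num_pos C l = #|Epos (p (inord l.-1)) (p l)|.
Proof.
exact: (card_kind_link (pos_cover famG) (pos_loops_inj famG) (pos_links_inj famG)
  (pos_loop_link famG) (@pos_clsP _ _ p)).
Qed.

Lemma family_num_nclass (i : nletter p) : @num_nclass C i = #|(val i).2|.
Proof.
exact: (card_kind_class (neg_cover famG) (neg_loops_inj famG) (neg_links_inj famG)
  (neg_loop_link famG) (@neg_clsP _ _ p)).
Qed.

Lemma family_num_pclass (j : pletter p) : @num_pclass C j = #|(val j).2|.
Proof.
exact: (card_kind_class (pos_cover famG) (pos_loops_inj famG) (pos_links_inj famG)
  (pos_loop_link famG) (@pos_clsP _ _ p)).
Qed.

Lemma family_gcd_nclasses (l : 'I_K.+1) : 0 < l ->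
  gcd_nclasses C l = \big[gcdn/0]_(c in nclasses (p l) (p ord0)) #|c|.
Proof.
move=> l0; rewrite (big_class_letter (neg_cls p) gcdn (fun c => #|c|) l0).
by apply: eq_bigr => i _; apply: family_num_nclass.
Qed.

Lemma family_gcd_pclasses (l : 'I_K.+1) : 0 < l ->
  gcd_pclasses C l = \big[gcdn/0]_(c in pclasses (p l) (p ord0)) #|c|.
Proof.
move=> l0; rewrite (big_class_letter (pos_cls p) gcdn (fun c => #|c|) l0).
by apply: eq_bigr => i _; apply: family_num_pclass.
Qed.

Lemma family_related_pairs (l : 'I_K.+1) : 0 < l ->
  related_pairs C l = \sum_(x in Rhat (p l) (p ord0)) #|x.1| * #|x.2|.
Proof.
move=> l0.
have -> : \sum_(x in Rhat (p l) (p ord0)) #|x.1| * #|x.2| =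
    \sum_(c in neg_cls p l) \sum_(d in pos_cls p l)
      (setX c d \subset Rel (p l) (p ord0)) * (#|c| * #|d|).
  rewrite pair_big /= big_mkcond [RHS]big_mkcond; apply: eq_bigr => -[c d] _.
  have -> : ((c, d) \in Rhat (p l) (p ord0)) = [&& c \in neg_cls p l,
      d \in pos_cls p l & setX c d \subset Rel (p l) (p ord0)].
    by rewrite inE in_setX andbA.
  case: (c \in _); case: (d \in _) => //=.
  by case: (_ \subset _); rewrite ?mul1n.
rewrite (big_class_letter (neg_cls p) addn _ l0).
apply: eq_bigr => i /eqP ti; rewrite (big_class_letter (pos_cls p) addn _ l0).
rewrite family_num_nclass big_distrr /= big_mkcond [RHS]big_mkcond.
apply: eq_bigr => j _ /=; rewrite family_num_pclass /class_related.
have -> : (val i).1 = l by apply: val_inj.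
rewrite -(inj_eq val_inj) /= eq_sym -/(letter_type j).
by case: (letter_type j == l) => //=; case: ifP => _; rewrite ?mul1n ?mul0n.
Qed.

Lemma condition_DE : condition_D p <-> chain_condition C.
Proof.
split=> [h l /andP[l0 lK]|h l l0].
  have [] := h (Ordinal (lK : l < K.+1)) l0.
  rewrite -family_num_neg // -family_num_pos // -family_related_pairs //.
  by rewrite -family_gcd_nclasses // -family_gcd_pclasses.
have lK : 0 < l <= K by rewrite l0 /= -ltnS ltn_ord.
have [] := h l lK; rewrite family_num_neg // family_num_pos //.
by rewrite family_related_pairs // family_gcd_nclasses // family_gcd_pclasses.
Qed.

(** Expresses the relation by data of the chain alone, so that maps respecting kinds and types
    respect it. *)
Lemma relatedE (e : nedge G) (f : pedge G) :
  related e f = (@ctgt C (inl e) == @csrc C (inr f)) &&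
    (mval (crel C) (pmap (@cletter C) [:: inl e; inr f]) == Some ([::], [::])).
Proof.
rewrite (ctgtE famG (inl e)) (csrcE famG (inr f)) (inj_eq (vertex_index_inj famG)).
have [ends|ends] := boolP (etgt (inl e : edge G) == esrc (inr f : edge G)).
  by rewrite (pair_value famG (eqP ends)); case: (related e f).
apply/negP => /related_ends[ef _]; by rewrite /= ef eqxx in ends.
Qed.

End FamilyNumbers.

(** Elements of corresponding fibres are matched by their rank in the enumeration of the fibre. *)
Lemma fiber_bijection (E E' : finType) (T T' : eqType) (k : E -> T) (k' : E' -> T')
    (h : T -> T') :
  injective h -> (forall t', exists t, h t = t') ->
  (forall t, #|[set e | k e == t]| = #|[set e | k' e == h t]|) ->
  exists2 F : E -> E', bijective F & forall e, k' (F e) = h (k e).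
Proof.
move=> hinj hsurj card.
pose R e e' := k' e' = h (k e) /\
  index e (enum [set x | k x == k e]) = index e' (enum [set x | k' x == k' e']).
have Rl e : exists e', R e e'.
  have lt : index e (enum [set x | k x == k e]) < #|[set x | k' x == h (k e)]|.
    by rewrite -card cardE index_mem mem_enum inE.
  have [e0 _] : exists e0, e0 \in [set x | k' x == h (k e)].
    by apply/card_gt0P; apply: leq_ltn_trans lt.
  set i := index _ _ in lt; pose e' := nth e0 (enum [set x | k' x == h (k e)]) i.
  have : e' \in enum [set x | k' x == h (k e)] by rewrite mem_nth // -cardE.
  rewrite mem_enum inE => /eqP ke'; exists e'; split=> //.
  by rewrite ke' index_uniq // ?enum_uniq // -cardE.
have Rr e' : exists e, R e e'.
  have [t et] := hsurj (k' e').
  have lt : index e' (enum [set x | k' x == k' e']) < #|[set x | k x == t]|.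
    by rewrite card et cardE index_mem mem_enum inE.
  have [e0 _] : exists e0, e0 \in [set x | k x == t].
    by apply/card_gt0P; apply: leq_ltn_trans lt.
  set i := index _ _ in lt; pose e := nth e0 (enum [set x | k x == t]) i.
  have : e \in enum [set x | k x == t] by rewrite mem_nth // -cardE.
  rewrite mem_enum inE => /eqP ke; exists e; split; first by rewrite ke.
  by rewrite ke index_uniq // ?enum_uniq // -cardE.
have index_inj (A : finType) (B : eqType) (u : A -> B) x y : u x = u y ->
    index x (enum [set z | u z == u x]) = index y (enum [set z | u z == u y]) -> x = y.
  move=> uxy; rewrite uxy => e; have xs : x \in enum [set z | u z == u y].
    by rewrite mem_enum inE uxy.
  have ys : y \in enum [set z | u z == u y] by rewrite mem_enum inE.
  by rewrite -(nth_index x xs) e nth_index.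
have [F RF] := choice Rl; have [F' RF'] := choice Rr.
exists F; last by move=> e; have [] := RF e.
exists F' => [e|e'].
  have [k1 i1] := RF e; have [k2 i2] := RF' (F e).
  by apply: (index_inj _ _ k); [apply: hinj; rewrite -k1 -k2 | rewrite i1 i2].
have [k1 i1] := RF' e'; have [k2 i2] := RF (F' e').
by apply: (index_inj _ _ k'); [rewrite k1 k2 | rewrite -i1 -i2].
Qed.

Definition kind_map (I I' : Type) (f : I -> I') (k : nat + I) : nat + I' :=
  match k with inl l => inl l | inr i => inr (f i) end.

Lemma kind_bijection (E E' : finType) (I I' : eqType) (k : E -> nat + I)
    (k' : E' -> nat + I') (f : I -> I') : bijective f ->
  (forall l, #|[set e | k e == inl l]| = #|[set e | k' e == inl l]|) ->
  (forall i, #|[set e | k e == inr i]| = #|[set e | k' e == inr (f i)]|) ->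
  exists2 F : E -> E', bijective F & forall e, k' (F e) = kind_map f (k e).
Proof.
case=> f' fK f'K hl hi; apply: fiber_bijection.
- by move=> [l|i] [l'|i'] //= [] => [->|/(can_inj fK) ->].
- by case=> [l|i]; [exists (inl l) | exists (inr (f' i)); rewrite /= f'K].
- by case.
Qed.

Section FamilyIso.
Variables (K : nat) (G H : Rgraph).
Variables (p : 'I_K.+1 -> vertex G) (q : 'I_K.+1 -> vertex H).
Hypotheses (famG : family_conditions p) (famH : family_conditions q).

Local Notation C := (family_chain p).
Local Notation D := (family_chain q).

(** Edges of one kind are interchangeable, as ends and relation depend on kinds only; hence any
    bijections that carry kinds to kinds form an isomorphism. *)
Lemma chain_iso (f : lneg C -> lneg D) (g : lpos C -> lpos D) :
  bijective f -> bijective g -> (forall i j, crel D (f i) (g j) = crel C i j) ->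
  (forall i, tneg (f i) = tneg i) -> (forall j, tpos (g j) = tpos j) ->
  (forall i, num_nclass i = num_nclass (f i)) ->
  (forall j, num_pclass j = num_pclass (g j)) ->
  num_neg C =1 num_neg D -> num_pos C =1 num_pos D -> rgraph_iso G H.
Proof.
move=> bf bg fgR tf tg hn hp hN hP.
have [fn bfn kfn] := @kind_bijection _ _ _ _ (@kneg C) (@kneg D) f bf hN hn.
have [fp bfp kfp] := @kind_bijection _ _ _ _ (@kpos C) (@kpos D) g bg hP hp.
have [bp _ _ _ _] := famG; have [bq _ _ _ _] := famH.
have [p' pK p'K] := bp; pose fv v := q (p' v).
have fvI v : vertex_index q (fv v) = vertex_index p v.
  by rewrite -{2}(p'K v) !vertex_indexK.
have src_n e : @csrc D (inl (fn e)) = @csrc C (inl e).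
  rewrite -[LHS]/(ksrc (@tneg D) (@kneg D (fn e))) kfn.
  rewrite -[RHS]/(ksrc (@tneg C) (@kneg C e)).
  by case: (@kneg C e) => [l|i] //; apply: tf.
have tgt_n e : @ctgt D (inl (fn e)) = @ctgt C (inl e).
  rewrite -[LHS]/(ktgt (@kneg D (fn e))) kfn -[RHS]/(ktgt (@kneg C e)).
  by case: (@kneg C e).
have src_p e : @csrc D (inr (fp e)) = @csrc C (inr e).
  rewrite -[LHS]/(ktgt (@kpos D (fp e))) kfp -[RHS]/(ktgt (@kpos C e)).
  by case: (@kpos C e).
have tgt_p e : @ctgt D (inr (fp e)) = @ctgt C (inr e).
  rewrite -[LHS]/(ksrc (@tpos D) (@kpos D (fp e))) kfp.
  rewrite -[RHS]/(ksrc (@tpos C) (@kpos C e)).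
  by case: (@kpos C e) => [l|j] //; apply: tg.
exists fv, fn, fp; split; first split=> //.
  by apply: (bij_comp bq); exists p.
split.
- move=> e; apply: (vertex_index_inj famH); rewrite fvI.
  by have := src_n e; rewrite (csrcE famG (inl e)) (csrcE famH (inl (fn e))).
- move=> e; apply: (vertex_index_inj famH); rewrite fvI.
  by have := tgt_n e; rewrite (ctgtE famG (inl e)) (ctgtE famH (inl (fn e))).
- move=> e; apply: (vertex_index_inj famH); rewrite fvI.
  by have := src_p e; rewrite (csrcE famG (inr e)) (csrcE famH (inr (fp e))).
- move=> e; apply: (vertex_index_inj famH); rewrite fvI.
  by have := tgt_p e; rewrite (ctgtE famG (inr e)) (ctgtE famH (inr (fp e))).
move=> e e'; rewrite (relatedE famH) (relatedE famG) tgt_n src_p; congr (_ && _).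
rewrite /pmap /cletter kfn kfp.
case: (@kneg C e) => [l|i]; case: (@kpos C e') => [l'|j] //.
by have /= e1 := fgR i j; rewrite /mval /= e1; case: (class_related i j).
Qed.

Lemma conj_chain_letters : 0 < K -> topologically_conjugate G H ->
  exists (f : lneg C -> lneg D) (g : lpos C -> lpos D),
    [/\ bijective f, bijective g,
        forall i j, crel D (f i) (g j) = crel C i j &
        forall x m, #|periodic_words (sum_map f g x) m| = #|periodic_words x m|].
Proof.
move=> K0 conj.
have okC := family_chain_ok famG K0; have okD := family_chain_ok famH K0.
have inhabited (E : Rgraph) (r : 'I_K.+1 -> vertex E) : family_conditions r ->
    exists e : edge E, True.
  move=> fam; have /set0Pn[e _] := @neg_loops_neq0 _ _ _ fam (Ordinal (K0 : 1 < K.+1)) isT.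
  by exists (inl e).
have [x0 _] := inhabited _ _ famG; have [y0 _] := inhabited _ _ famH.
have [F [F' [n [XF XF' FK FK' [wF wF']]]]] := conjugate_codes x0 y0 conj.
apply: (@conj_letters C D x0 y0 F F' n okC okD); split.
- by move=> x /(rgraph_shiftE famG)/XF/(rgraph_shiftE famH).
- by move=> y /(rgraph_shiftE famH)/XF'/(rgraph_shiftE famG).
- by move=> x /(rgraph_shiftE famG)/FK.
- by move=> y /(rgraph_shiftE famH)/FK'.
- split=> x x' i i' Xx Xx'; first by apply: wF; apply/(rgraph_shiftE famG).
  by apply: wF'; apply/(rgraph_shiftE famH).
Qed.

End FamilyIso.

Lemma topologically_conjugate_sym G H :
  topologically_conjugate G H -> topologically_conjugate H G.
Proof.
case=> phi [psi [K1 K2 c1 c2 s]]; exists psi, phi; split=> // y.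
by rewrite -{1}(K2 y) -s K1.
Qed.

Lemma condition_D_transfer K (G H : Rgraph) (p : 'I_K.+1 -> vertex G)
    (q : 'I_K.+1 -> vertex H) : 0 < K ->
  family_conditions p -> family_conditions q ->
  topologically_conjugate G H -> condition_D p -> condition_D q.
Proof.
move=> K0 famG famH conj /(condition_DE famG) cC; apply/(condition_DE famH).
have okC := family_chain_ok famG K0; have okD := family_chain_ok famH K0.
have [f [g [bf bg fgR cnt]]] := conj_chain_letters famG famH K0 conj.
exact: (chain_condition_transfer okC okD (erefl K) bf bg fgR cnt cC).
Qed.

Lemma no_edges (G : Rgraph) (p : 'I_1 -> vertex G) :
  family_conditions p -> (nedge G -> False) * (pedge G -> False).
Proof.
case=> _ _ h _ _.
have no_neg : nedge G -> False by move=> e; have [l] := h e; rewrite ord1.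
split=> // f.
have : Epos (ptgt f) (psrc f) != set0 by apply/set0Pn; exists f; apply: mem_Epos.
by move/Eneg_Epos_neq0/set0Pn => [e _]; apply: no_neg.
Qed.

Theorem theorem4p2 (K : nat) (G H : Rgraph)
    (p : 'I_K.+1 -> vertex G) (q : 'I_K.+1 -> vertex H)
    (famG : family_conditions p) (famH : family_conditions q)
    (conjGH : topologically_conjugate G H) :
  (condition_D p <-> condition_D q) /\
  (condition_D p -> condition_D q -> rgraph_iso G H).
Proof.
(* For K = 0 there is one vertex and no edge and (D) is vacuous; [chain_ok] covers only K > 0. *)
have [K0|K0] := posnP K.
  subst K; have trivD (E : Rgraph) (r : 'I_1 -> vertex E) : condition_D r.
    by move=> l; rewrite ord1.
  split=> // _ _.
  have [nG pG] := no_edges famG; have [nH pH] := no_edges famH.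
  have [[p' pK p'K] _ _ _ _] := famG; have [bq _ _ _ _] := famH.
  exists (q \o p'), (fun e => match nG e with end), (fun e => match pG e with end).
  split; split=> //.
  - by apply: bij_comp bq _; exists p.
  - by exists (fun e => match nH e with end) => e; [case: (nG e) | case: (nH e)].
  - by exists (fun e => match pH e with end) => e; [case: (pG e) | case: (pH e)].
have conjHG := topologically_conjugate_sym conjGH.
split; first by split; apply: condition_D_transfer.
move=> /(condition_DE famG) cC /(condition_DE famH) cD.
have okC := family_chain_ok famG K0; have okD := family_chain_ok famH K0.
have [f [g [bf bg fgR cnt]]] := conj_chain_letters famG famH K0 conjGH.
have [hn hp hN hP] := chain_numbers_eq okC okD (erefl K) bf bg fgR cnt cC cD.
apply: (chain_iso famG famH bf bg fgR) => //.
- exact: (tneg_f okC okD cnt).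
- exact: (tpos_g okC okD fgR cnt).
Qed.
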